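(* Let $\sigma$ be a non-atomic Radon measure on $\mathbb{R}^d$ and let $\pi_\sigma$ be the Poisson measure with intensity $\sigma$ on the configuration space $\Gamma$ over $\mathbb{R}^d$. For any $\varphi\in\mathcal{D}$ and any $g\in\mathrm{Dom}(I_\sigma a^+(\varphi)I_\sigma^{-1})$, where $a^+(\varphi)$ is the creation operator in $\mathrm{Exp}L^2(\sigma)$, the following equality holds (for $\pi_\sigma$-a.e. $\gamma$): $$\big((\nabla^{P}_\varphi)^*g\big)(\gamma)=\int_{\mathbb{R}^d}g(\gamma-\varepsilon_x)\varphi(x)\,d\gamma(x)-g(\gamma)\int_{\mathbb{R}^d}\varphi(x)\,d\sigma(x).$$
   Context: $\mathcal{D}=C_0^\infty(\mathbb{R}^d)$ (real-valued). The configuration space is $\Gamma=\{\gamma\subset\mathbb{R}^d : |\gamma\cap K|<\infty \text{ for every compact } K\}$, each $\gamma$ being identified with the measure $\sum_{x\in\gamma}\varepsilon_x$ ($\varepsilon_x$ the Dirac measure at $x$), with the $\sigma$-algebra generated by the maps $\gamma\mapsto|\gamma\cap B|$, $B$ bounded Borel; $\langle\gamma,f\rangle=\int f\,d\gamma=\sum_{x\in\gamma}f(x)$. The Poisson measure $\pi_\sigma$ on $\Gamma$ is determined by $\int_\Gamma e^{\langle\gamma,\varphi\rangle}d\pi_\sigma(\gamma)=\exp\big(\int(e^{\varphi}-1)\,d\sigma\big)$, $\varphi\in\mathcal{D}$. $\mathcal{F}C_b^\infty(\mathcal{D},\Gamma)$ is the set of functions $f(\gamma)=F(\langle\gamma,\varphi_1\rangle,\dots,\langle\gamma,\varphi_N\rangle)$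 with $\varphi_i\in\mathcal{D}$ and $F\in C_b^\infty(\mathbb{R}^N)$ ($C^\infty$-functions with bounded derivatives). The directional derivative $\nabla^{P}_\varphi:\mathcal{F}C_b^\infty(\mathcal{D},\Gamma)\to L^2(\pi_\sigma)$ is $(\nabla^{P}_\varphi f)(\gamma)=\int(f(\gamma+\varepsilon_x)-f(\gamma))\varphi(x)\,d\sigma(x)$; it is closable, and $(\nabla^{P}_\varphi)^*$ is its adjoint in $L^2(\pi_\sigma)$. Fock space: $\mathrm{Exp}L^2(\sigma)=\bigoplus_{n\ge0}\mathrm{Exp}_nL^2(\sigma)$, where $\mathrm{Exp}_nL^2(\sigma)=L^2(\sigma)_{\mathbb{C}}^{\widehat\otimes n}$ (symmetric tensor power of the complexification) and $\mathrm{Exp}_0L^2(\sigma)=\mathbb{C}$, with squared norm $\sum_n n!\,|f^{(n)}|^2_{L^2(\sigma^{\otimes n})}$. The generalized Charlier kernels $C_n^\sigma(\gamma)\in\mathcal{D}'^{\widehat\otimes n}$ are defined by $\exp(\langle\gamma,\log(1+\psi)\rangle-\int\psi\,d\sigma)=\sum_n\frac1{n!}\langle C_n^\sigma(\gamma),\psi^{\otimes n}\rangle$ for $\psi\in\mathcal{D}$ near $0$; they satisfy $\int\langle C_n^\sigma,\varphi^{(n)}\rangle\langle C_m^\sigma,\psi^{(m)}\rangle d\pi_\sigma=\delta_{nm}n!(\varphi^{(n)},\psi^{(n)})_{L^2(\sigma^{\otimes n})}$ and hence $\langle C_n^\sigma(\cdot),f^{(n)}\rangle\in L^2(\pi_\sigma)$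 is defined by extension for all $f^{(n)}\in\mathrm{Exp}_nL^2(\sigma)$. $I_\sigma:\mathrm{Exp}L^2(\sigma)\to L^2(\pi_\sigma)$ is the unitary isomorphism $(f^{(n)})_n\mapsto\sum_n\langle C_n^\sigma(\cdot),f^{(n)}\rangle$. The annihilation operator $a^-(\varphi)$ is defined by $a^-(\varphi)\,\widehat\otimes_{i=1}^nf_i=\sum_{j=1}^n\langle\varphi,f_j\rangle\,\widehat\otimes_{i\ne j}f_i$, with $\langle\varphi,f_j\rangle=\int\varphi f_j\,d\sigma$, extended by linearity and boundedness to each $\mathrm{Exp}_nL^2(\sigma)$ and component-wise to sequences with finitely many nonzero entries. The creation operator $a^+(\varphi)$ is the adjoint of $a^-(\varphi)$ in $\mathrm{Exp}L^2(\sigma)$; it acts on $f^{(n)}\in\mathrm{Exp}_nL^2(\sigma)$ as $a^+(\varphi)f^{(n)}=\varphi\widehat\otimes f^{(n)}$. *)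

(* Defs.v *)
From HB Require Import structures.
From mathcomp Require Import all_boot all_order all_fingroup all_algebra.
From mathcomp Require Import all_classical all_reals all_analysis.
From mathcomp Require Import complex.

Set Implicit Arguments.
Unset Strict Implicit.
Unset Printing Implicit Defensive.

Import Order.TTheory GRing.Theory Num.Theory.
Import numFieldNormedType.Exports.

Local Open Scope classical_set_scope.
Local Open Scope ring_scope.
Local Open Scope complex_scope.

(** * The space R^d, Radon measures, test functions *)

(* 'rV[R]_d with its Borel sigma-algebra *)
Definition euclid (R : realType) (d : nat) := 'rV[R]_d.
HB.instance Definition _ R d := NormedModule.on (euclid R d).
HB.instance Definition _ R d :=
  Measurable.copy (euclid R d) (g_sigma_algebraType (@open 'rV[R]_d)).

(* On R^d a Borel measure that is finite on compact sets is automatically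
   regular, hence Radon. *)
Definition radon (R : realType) (d : nat) (mu : set (euclid R d) -> \bar R) :=
  forall K : set (euclid R d), compact K -> (mu K < +oo)%E.

(* Hence taking sigma in the type of sigma-finite measures, as the product
   measures below require, is no restriction for Radon measures. *)
Lemma radon_sigma_finite (R : realType) (d : nat)
    (mu : set (euclid R d) -> \bar R) : radon mu -> sigma_finite setT mu.
Proof.
move=> rmu.
exists (fun n => [set x : euclid R d | `|x| <= n%:R]).
  apply/seteqP; split=> // x _.
  exists (Num.truncn `|x|).+1 => //=.
  by apply: ltW; exact: truncnS_gt.
move=> n.
have cl : closed [set x : euclid R d | `|x| <= n%:R].
  rewrite [X in closed X](_ : _ =
    (fun x : euclid R d => `|x|) @^-1` [set r | r <= n%:R])//.
  apply: preimage_closed; last exact: closed_le.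
  by move=> x _; exact: norm_continuous.
split.
  rewrite -[X in measurable X]setCK; apply: measurableC.
  apply: sub_sigma_algebra; exact: closed_openC.
apply: rmu; apply: bounded_closed_compact => //.
exists n%:R; split; first exact: realn.
by move=> M nM x /= /le_trans; apply; exact: ltW.
Qed.

(* For Radon measures on R^d, having no atoms amounts to not charging points. *)
Definition nonatomic (R : realType) (d : nat)
    (mu : set (euclid R d) -> \bar R) :=
  forall x : euclid R d, mu [set x] = 0%E.

Definition iter_derive (R : realType) (n : nat) (vs : seq 'rV[R]_n)
    (f : 'rV[R]_n -> R) : 'rV[R]_n -> R :=
  foldr (fun v g x => 'D_v g x) f vs.

Definition smooth (R : realType) (n : nat) (f : 'rV[R]_n -> R) :=
  forall vs x, differentiable (iter_derive vs f) x.

(* bounded together with all its derivatives (order 0 is the case vs = [::]) *)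
Definition Cb_infty (R : realType) (n : nat) (f : 'rV[R]_n -> R) :=
  smooth f /\ forall vs, exists M : R, forall x, `|iter_derive vs f x| <= M.

(* the space D = C_0^infty(R^d) of real-valued test functions *)
Definition testfun (R : realType) (d : nat) (phi : euclid R d -> R) :=
  smooth phi /\ compact (closure [set x : euclid R d | phi x != 0]).

(** * The configuration space *)

Record conf (R : realType) (d : nat) := Conf {
  pts :> set (euclid R d) ;
  conf_locally_finite :
    forall K : set (euclid R d), compact K -> finite_set (pts `&` K) }.

Section conf_instances.
Variables (R : realType) (d : nat).

Lemma conf0_subproof (K : set (euclid R d)) :
  compact K -> finite_set (set0 `&` K).
Proof. by move=> _; rewrite set0I; exact: finite_set0. Qed.

HB.instance Definition _ := gen_eqMixin (conf R d).
HB.instance Definition _ := gen_choiceMixin (conf R d).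
HB.instance Definition _ := isPointed.Build (conf R d) (Conf conf0_subproof).

(* The maps gamma |-> |gamma n B| are nat-valued, so the sigma-algebra which
   they generate is generated by their level sets. *)
Definition counting_sets : set (set (conf R d)) :=
  [set A | exists (B : set (euclid R d)) (k : nat),
    [/\ measurable B, bounded_set B &
        A = [set gamma : conf R d | ((gamma : set _) `&` B #= `I_k)%card]]].

End conf_instances.

HB.instance Definition _ R d :=
  Measurable.copy (conf R d) (g_sigma_algebraType (@counting_sets R d)).

Section conf_operations.
Variables (R : realType) (d : nat).
Implicit Types (gamma : conf R d) (x : euclid R d).

Lemma conf_add_subproof gamma x (K : set (euclid R d)) :
  compact K -> finite_set ((gamma `|` [set x]) `&` K).
Proof.
move=> cK; rewrite setIUl finite_setU; split.
  exact: conf_locally_finite.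
by apply: finite_setIl; exact: finite_set1.
Qed.

(* gamma + eps_x when x is not in gamma.  The points x of gamma, where the value
   is a junk one, form a countable set, which a non-atomic sigma neglects. *)
Definition conf_add gamma x : conf R d := Conf (@conf_add_subproof gamma x).

Lemma conf_rem_subproof gamma x (K : set (euclid R d)) :
  compact K -> finite_set ((gamma `\` [set x]) `&` K).
Proof.
move=> cK; apply: (@sub_finite_set _ _ (gamma `&` K)).
  by move=> y [[]].
exact: conf_locally_finite.
Qed.

(* gamma - eps_x, for x in gamma *)
Definition conf_rem gamma x : conf R d := Conf (@conf_rem_subproof gamma x).

End conf_operations.

(* <gamma, f>, the integral of f against sum_(x in gamma) eps_x.  The sum has
   finitely many nonzero terms as soon as f vanishes off a compact set. *)
Definition pairing (R : realType) (d : nat) (V : nmodType)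
    (gamma : conf R d) (f : euclid R d -> V) : V :=
  \sum_(x \in (gamma : set (euclid R d))) f x.

Definition poisson (R : realType) (d : nat)
    (sigma : {measure set (euclid R d) -> \bar R})
    (P : probability (conf R d) R) :=
  forall phi, testfun phi ->
    (\int[P]_gamma (expR (pairing gamma phi))%:E
     = (expR (\int[sigma]_x (expR (phi x) - 1))%R)%:E)%E.

(** * Complex L^2 spaces and unbounded operators

  L^2 elements are represented by functions, with equality almost everywhere.
  An operator is represented by its graph. *)

Section complex_L2.
Context d (T : measurableType d) (R : realType).
Variable mu : {measure set T -> \bar R}.
Implicit Types f g : T -> R[i].

Definition cint f : R[i] :=
  (\int[mu]_x complex.Re (f x)) +i* (\int[mu]_x complex.Im (f x)).

Definition sqnorm f : \bar R := (\int[mu]_x ((Normc.normc (f x)) ^+ 2)%:E)%E.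

Definition L2 : set (T -> R[i]) :=
  [set f | [/\ measurable_fun setT (fun x => complex.Re (f x)),
               measurable_fun setT (fun x => complex.Im (f x)) &
               (sqnorm f < +oo)%E]].

Definition L2dot f g : R[i] := cint (fun x => f x * conjc (g x)).

Definition L2cvg (u : nat -> T -> R[i]) f :=
  (fun k => sqnorm (fun x => u k x - f x)) @ \oo --> 0%E.

End complex_L2.

Definition opdom (X Y : Type) (A : set (X * Y)) : set X :=
  [set x | exists y, A (x, y)].

(* graph of the adjoint of A, from the Hilbert space (H1, dot1) to (H2, dot2) *)
Definition adjoint (R : realType) (X Y : Type)
    (H1 : set X) (dot1 : X -> X -> R[i]) (H2 : set Y) (dot2 : Y -> Y -> R[i])
    (A : set (X * Y)) : set (Y * X) :=
  [set gh | [/\ H2 gh.1, H1 gh.2 &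
    forall f Af, A (f, Af) -> dot2 Af gh.1 = dot1 f gh.2]].

(* extension by linearity of a map given on generators by the pairs in B *)
Definition linear_ext (R : realType) (X Y : Type)
    (B : set ((X -> R[i]) * (Y -> R[i]))) : set ((X -> R[i]) * (Y -> R[i])) :=
  [set fh | exists (m : nat) (c : 'I_m -> R[i])
                   (b : 'I_m -> (X -> R[i]) * (Y -> R[i])),
    [/\ forall k, B (b k),
        forall x, fh.1 x = \sum_k c k * (b k).1 x &
        forall y, fh.2 y = \sum_k c k * (b k).2 y]].

(* extension by continuity of a bounded operator with graph A from L^2(mu) to
   L^2(nu): the closure of A *)
Definition L2_ext (R : realType) d (X : measurableType d)
    (mu : {measure set X -> \bar R}) d' (Y : measurableType d')
    (nu : {measure set Y -> \bar R})
    (A : set ((X -> R[i]) * (Y -> R[i]))) : set ((X -> R[i]) * (Y -> R[i])) :=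
  [set fh | [/\ L2 mu fh.1, L2 nu fh.2 &
    exists u : nat -> (X -> R[i]) * (Y -> R[i]),
      [/\ forall k, A (u k),
          L2cvg mu (fun k => (u k).1) fh.1 &
          L2cvg nu (fun k => (u k).2) fh.2]]].

(** * The product measures sigma^n on n.-tuple *)

Section product_power.
Context d (T : measurableType d) (R : realType).
Variable sigma : {sigma_finite_measure set T -> \bar R}.

Definition tcons n (p : n.-tuple T * T) : n.+1.-tuple T :=
  [tuple of p.2 :: p.1].

Lemma measurable_tcons n : measurable_fun setT (@tcons n).
Proof. exact: measurable_cons. Qed.

Fixpoint mpow n : {measure set (n.-tuple T) -> \bar R} :=
  match n with
  | 0 => \d_([tuple] : 0.-tuple T)
  | n'.+1 =>
    measure_function_pushforward__canonical__measure_function_Measure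
      (mpow n' \x sigma)%E (@measurable_tcons n')
  end.

End product_power.

(** * Fock space *)

Section fock.
Variables (R : realType) (d : nat).
Let E := euclid R d.
Variable sigma : {sigma_finite_measure set E -> \bar R}.

(* the symmetric tensor product of f_0, ..., f_(n-1) *)
Definition symtensor n (f : 'I_n -> E -> R[i]) : n.-tuple E -> R[i] :=
  fun t => n`!%:R^-1 * \sum_(s : 'S_n) \prod_(i < n) f (s i) (tnth t i).

(* Exp_n L^2(sigma): symmetric elements of complex L^2(sigma^n) *)
Definition Exp_n n : set (n.-tuple E -> R[i]) :=
  [set f | L2 (mpow sigma n) f /\
    forall s : 'S_n, {ae mpow sigma n, forall t,
      f [tuple tnth t (s i) | i < n] = f t}].

Definition fockvec := forall n, n.-tuple E -> R[i].

Definition Fock : set fockvec :=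
  [set f | (forall n, Exp_n (f n)) /\
    (\sum_(0 <= n <oo) (n`!%:R%:E * sqnorm (mpow sigma n) (f n)) < +oo)%E].

Definition Fock_dot (f h : fockvec) : R[i] :=
  let u n := n`!%:R * L2dot (mpow sigma n) (f n) (h n) in
  limn (series (fun n => complex.Re (u n))) +i*
  limn (series (fun n => complex.Im (u n))).

Variable phi : E -> R.

Definition annihilation_gen n :
    set ((n.+1.-tuple E -> R[i]) * (n.-tuple E -> R[i])) :=
  [set fh | exists f : 'I_n.+1 -> E -> R[i],
    [/\ forall i, L2 sigma (f i),
        fh.1 = symtensor f &
        fh.2 = fun t => \sum_(j < n.+1)
          cint sigma (fun x => (phi x)%:C * f j x)
            * symtensor (fun i : 'I_n => f (lift j i)) t]].

(* a^-(phi) from Exp_(n+1) to Exp_n *)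
Definition annihilation_n n :
    set ((n.+1.-tuple E -> R[i]) * (n.-tuple E -> R[i])) :=
  L2_ext (mpow sigma n.+1) (mpow sigma n) (linear_ext (@annihilation_gen n)).

(* a^-(phi) on the finite sequences; it kills the component of degree 0 *)
Definition annihilation : set (fockvec * fockvec) :=
  [set fh | [/\ Fock fh.1, Fock fh.2,
    (exists N, forall n, (N <= n)%N ->
       {ae mpow sigma n, forall t, fh.1 n t = 0}) &
    forall n, annihilation_n (fh.1 n.+1, fh.2 n)]].

Definition creation : set (fockvec * fockvec) :=
  adjoint Fock Fock_dot Fock Fock_dot annihilation.

End fock.

(** * Charlier kernels and the isomorphism I_sigma *)

Section charlier.
Variables (R : realType) (d : nat).
Let E := euclid R d.
Variable sigma : {sigma_finite_measure set E -> \bar R}.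

(* C gamma n psi stands for
     <C_n^sigma(gamma), psi_0 (x)^ ... (x)^ psi_(n-1)>.
   A symmetric multilinear form is determined by its diagonal, and this diagonal
   by the Taylor coefficients at 0 of the generating function along each ray, so
   there is at most one family of kernels; in particular its continuity on D is
   a consequence of the conditions below. *)
Definition kernel_family := conf R d -> forall n, ('I_n -> E -> R) -> R.

Definition is_charlier (C : kernel_family) :=
  forall gamma : conf R d,
  [/\ forall n (psi : 'I_n -> E -> R) (i : 'I_n) (a : R) (u v : E -> R),
        (forall j, testfun (psi j)) -> testfun u -> testfun v ->
        C gamma n [eta psi with i |-> (fun x => a * u x + v x)] =
        a * C gamma n [eta psi with i |-> u] + C gamma n [eta psi with i |-> v],
      forall n (psi : 'I_n -> E -> R) (s : 'S_n),
        (forall j, testfun (psi j)) -> C gamma n (fun j => psi (s j)) = C gamma n psi &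
      forall psi : E -> R, testfun psi -> \forall t \near (0 : R),
        series (fun n => n`!%:R^-1 * C gamma n (fun=> (fun x => t * psi x)))
          @ \oo -->
        expR (pairing gamma (fun x => ln (1 + t * psi x))
              - \int[sigma]_x (t * psi x))].

Variables (P : probability (conf R d) R) (C : kernel_family).

Definition charlier_gen n :
    set ((n.-tuple E -> R[i]) * (conf R d -> R[i])) :=
  [set fG | exists psi : 'I_n -> E -> R,
    [/\ forall i, testfun (psi i),
        fG.1 = symtensor (fun i x => (psi i x)%:C) &
        fG.2 = fun gamma => (@C gamma n psi)%:C]].

(* graph of f^(n) |-> <C_n^sigma, f^(n)> on Exp_n L^2(sigma) *)
Definition charlier_pairing n :
    set ((n.-tuple E -> R[i]) * (conf R d -> R[i])) :=
  L2_ext (mpow sigma n) P (linear_ext (@charlier_gen n)).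

(* graph of I_sigma *)
Definition chaos_iso : set (fockvec R d * (conf R d -> R[i])) :=
  [set fg | [/\ Fock sigma fg.1, L2 P fg.2 &
    exists G : nat -> conf R d -> R[i],
      (forall n, charlier_pairing (fg.1 n, G n)) /\
      L2cvg P (fun N gamma => \sum_(n < N) G n gamma) fg.2]].

(* I_sigma a^+(phi) I_sigma^-1; in this notation the left factor of \; acts
   last *)
Definition creation_on_conf (phi : E -> R) :
    set ((conf R d -> R[i]) * (conf R d -> R[i])) :=
  (chaos_iso \; (creation sigma phi \; chaos_iso^-1))%relation.

End charlier.

(** * The difference operator on configurations *)

Section nablaP.
Variables (R : realType) (d : nat).
Let E := euclid R d.

(* FC_b^infty(D, Gamma); F is complex-valued, as is L^2(pi_sigma) *)
Definition FCb_infty : set (conf R d -> R[i]) :=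
  [set f | exists (N : nat) (phi : 'I_N -> E -> R) (F : 'rV[R]_N -> R[i]),
    [/\ forall i, testfun (phi i),
        Cb_infty (fun y => complex.Re (F y)),
        Cb_infty (fun y => complex.Im (F y)) &
        f = fun gamma => F (\row_(i < N) pairing gamma (phi i))]].

Variables (sigma : {measure set E -> \bar R}) (P : probability (conf R d) R).

Definition nablaP (phi : E -> R) :
    set ((conf R d -> R[i]) * (conf R d -> R[i])) :=
  [set fh | FCb_infty fh.1 /\
    fh.2 = fun gamma =>
      cint sigma (fun x => (fh.1 (conf_add gamma x) - fh.1 gamma) * (phi x)%:C)].

Definition nablaP_adj (phi : E -> R) :
    set ((conf R d -> R[i]) * (conf R d -> R[i])) :=
  adjoint (L2 P) (L2dot P) (L2 P) (L2dot P) (nablaP phi).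

End nablaP.

(* Main.v *)
(** Write [nabla_star g] for the right-hand side of the asserted formula.  It can be
    recognised by weak identities on both sides.  The Mecke formula
      [int sum_(x in gamma) H (gamma - eps_x, x) = int int H (gamma, x) dsigma dP]
    follows by differentiating the Laplace functional of the Poisson measure and a
    monotone class argument.  It shows that [nabla_star] maps [L^1] to [L^1], that
    it is formally adjoint to the difference operator on bounded cylinder functions,
    and that for test functions [eta >= 0]
      [int e^(-<gamma, eta>) nabla_star g
         = (int (e^(-eta) - 1) phi dsigma) (int e^(-<gamma, eta>) g)].
    Comparing Taylor coefficients, the diagonal Charlier kernels are the iterates of
    [nabla_star] on the constant 1, so this identity and polarization give, with
    [chi := e^(-eta) - 1],
      [int e^(-<gamma, eta>) <C_n, f>
         = (int e^(-<gamma, eta>)) (int chi^(tensor n) f)].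
    Testing the adjoint relation that defines creation on the tensor powers of [chi]
    yields the same identity for [I a^+ I^-1 g] as for [nabla_star g].  The functions
    [e^(-<gamma, eta>)] are multiplicative and generate the sigma-algebra, hence
    [I a^+ I^-1 g = nabla_star g] almost everywhere.  In the same way the cylinder
    functions [cos (<gamma, psi> + theta)] determine the adjoint of the difference
    operator. *)

Require Import Defs.
From HB Require Import structures.
From mathcomp Require Import all_boot all_order all_fingroup all_algebra.
From mathcomp Require Import all_classical all_reals all_analysis.
From mathcomp Require Import finmap measurable_realfun complex ring lra.

Set Implicit Arguments.
Unset Strict Implicit.
Unset Printing Implicit Defensive.

Import Order.TTheory GRing.Theory Num.Theory.
Import numFieldNormedType.Exports.

Local Open Scope classical_set_scope.
Local Open Scope ring_scope.
Local Open Scope complex_scope.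

(** * Monotone classes *)

(** For [g] in [L^2] the function [nabla_star g] is a priori only in [L^1], so density arguments in
    [L^2] are out of reach. All comparisons go through integrals against bounded functions, whence
    the monotone classes. That [g] lies in the domain of the adjoint is due to [I a^+ I^-1 g], which
    is in [L^2] by definition. Two test families occur. The exponentials are multiples of coherent
    states, whose Fock components are multiples of [chi^(tensor n)], where annihilation is explicit.
    But [y |-> e^(-y)] is unbounded on the line and would need a smooth cut-off to give an element
    of [FC_b^infty]; cosines are bounded with all their derivatives. As annihilation acts on finite
    sequences only, a coherent state is not an admissible test vector: the adjoint relation is
    tested in one degree at a time, and the degrees are summed afterwards. A configuration is a set,
    so [gamma + eps_x] is wrong for [x] in [gamma]. The Mecke formula is stated with removals, where
    nothing goes wrong; non-atomicity of [sigma] enters when [conf_add] is replaced by a jointly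
    measurable expression. *)

Section mclass.
Context (T : Type) (R : realType) (M : set (T -> R)).

(** The closure is under bounded limits, not monotone ones: a linear property that survives
    dominated convergence is then proved by induction, one case per constructor. *)
Inductive mclass : (T -> R) -> Prop :=
| mclass_base Y : M Y -> mclass Y
| mclass_cst c : mclass (fun=> c)
| mclass_lin a Y Z : mclass Y -> mclass Z -> mclass (fun x => a * Y x + Z x)
| mclass_lim (Y : nat -> T -> R) Z K : (forall n, mclass (Y n)) ->
    (forall n x, `|Y n x| <= K) -> (forall x, Y ^~ x @ \oo --> Z x) ->
    mclass Z.

Hypothesis M_bounded : forall Y, M Y -> exists K, forall x, `|Y x| <= K.
Hypothesis M_mul : forall Y Z, M Y -> M Z -> mclass (fun x => Y x * Z x).

Lemma mclass_bounded Y : mclass Y -> exists K, forall x, `|Y x| <= K.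
Proof.
elim=> {Y}.
- by move=> Y /M_bounded.
- by move=> c; exists `|c|.
- move=> a Y Z _ [K HK] _ [L HL]; exists (`|a| * K + L) => x.
  rewrite (le_trans (ler_normD _ _))// lerD// normrM ler_wpM2l//.
- move=> Y Z K _ _ HK cv; exists K => x.
  rewrite -(cvg_lim _ (cvg_norm (cv x)))//.
  apply: limr_le; first by apply/cvg_ex; eexists; exact: cvg_norm (cv x).
  exact: nearW.
Qed.

Lemma mclassZ a Y : mclass Y -> mclass (fun x => a * Y x).
Proof.
move=> mY; rewrite (_ : (fun x => _) = fun x => a * Y x + (fun=> 0) x).
  exact: mclass_lin (mclass_cst 0).
by apply/funext => x; rewrite addr0.
Qed.

Lemma mclassD Y Z : mclass Y -> mclass Z -> mclass (fun x => Y x + Z x).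
Proof.
move=> mY mZ; rewrite (_ : (fun x => _) = fun x => 1 * Y x + Z x).
  exact: mclass_lin.
by apply/funext => x; rewrite mul1r.
Qed.

Lemma mclassB Y Z : mclass Y -> mclass Z -> mclass (fun x => Y x - Z x).
Proof.
move=> mY mZ; rewrite (_ : (fun x => _) = fun x => Y x + -1 * Z x).
  by apply: mclassD => //; exact: mclassZ.
by apply/funext => x; rewrite mulN1r.
Qed.

Lemma mclass_sum (I : Type) (r : seq I) (P : pred I) (Y : I -> T -> R) :
  (forall i, P i -> mclass (Y i)) -> mclass (fun x => \sum_(i <- r | P i) Y i x).
Proof.
move=> mY; elim: r => [|i r IH].
  rewrite (_ : (fun x => _) = fun=> 0); first exact: mclass_cst.
  by apply/funext => x; rewrite big_nil.
case Pi : (P i); last first.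
  rewrite (_ : (fun x => _) = fun x => \sum_(i <- r | P i) Y i x)//.
  by apply/funext => x; rewrite big_cons Pi.
rewrite (_ : (fun x => _) = fun x => Y i x + \sum_(i <- r | P i) Y i x).
  by apply: mclassD => //; exact: mY.
by apply/funext => x; rewrite big_cons Pi.
Qed.

(** The two-stage argument of the pi-lambda theorem: with the second factor in [M], induct on the
    first; then induct on the second. [M_mul] only asks that products of generators lie in the
    class, because a product of two cosines is a combination of cosines and not a cosine. *)
Lemma mclassM Y Z : mclass Y -> mclass Z -> mclass (fun x => Y x * Z x).
Proof.
move=> mY mZ; elim: mZ Y mY => {Z}; last first.
- move=> Z W K mZ IH HK cv Y mY.
  have [L HL] := mclass_bounded mY.
  apply: (@mclass_lim (fun n x => Y x * Z n x) _ (L * K)).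
  + by move=> n; exact: IH.
  + by move=> n x; rewrite normrM ler_pM.
  + by move=> x; apply: cvgM => //; exact: cvg_cst.
- move=> a Z W _ IHZ _ IHW Y mY.
  rewrite (_ : (fun x => _) = fun x => a * (Y x * Z x) + Y x * W x).
    by apply: mclass_lin; [exact: IHZ|exact: IHW].
  by apply/funext => x; ring.
- move=> c Y mY; rewrite (_ : (fun x => _) = fun x => c * Y x).
    exact: mclassZ.
  by apply/funext => x; rewrite mulrC.
- move=> Z MZ Y; elim=> {Y}.
  + by move=> Y MY; exact: M_mul.
  + by move=> c; apply: mclassZ; exact: mclass_base.
  + move=> a Y W _ IHY _ IHW.
    rewrite (_ : (fun x => _) = fun x => a * (Y x * Z x) + W x * Z x).
      exact: mclass_lin.
    by apply/funext => x; ring.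
  + move=> Y W K mY IH HK cv.
    have [L HL] := M_bounded MZ.
    apply: (@mclass_lim (fun n x => Y n x * Z x) _ (K * L)).
    * by move=> n; exact: IH.
    * by move=> n x; rewrite normrM ler_pM.
    * by move=> x; apply: cvgM => //; exact: cvg_cst.
Qed.

Lemma mclassX n Y : mclass Y -> mclass (fun x => Y x ^+ n).
Proof.
move=> mY; elim: n => [|n IH].
  rewrite (_ : (fun x => _) = fun=> 1); first exact: mclass_cst.
  by apply/funext => x; rewrite expr0.
rewrite (_ : (fun x => _) = fun x => Y x * Y x ^+ n); first exact: mclassM.
by apply/funext => x; rewrite exprS.
Qed.

Lemma mclass_prod (I : Type) (r : seq I) (Y : I -> T -> R) :
  (forall i, mclass (Y i)) -> mclass (fun x => \prod_(i <- r) Y i x).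
Proof.
move=> mY; elim: r => [|i r IH].
  rewrite (_ : (fun x => _) = fun=> 1); first exact: mclass_cst.
  by apply/funext => x; rewrite big_nil.
rewrite (_ : (fun x => _) = fun x => Y i x * \prod_(i <- r) Y i x).
  exact: mclassM.
by apply/funext => x; rewrite big_cons.
Qed.

(** Stability under [expR] takes the place of Weierstrass approximation: indicators of superlevel
    sets become limits of explicit double exponentials. *)
Lemma mclass_expR Y : mclass Y -> mclass (fun x => expR (Y x)).
Proof.
move=> mY; have [K HK] := mclass_bounded mY.
apply: (@mclass_lim (fun n x => series (exp_coeff (Y x)) n) _ (expR `|K|)).
- move=> n; apply: mclass_sum => i _.
  rewrite (_ : (fun x => _) = fun x => (i`!%:R)^-1 * Y x ^+ i).
    by apply: mclassZ; exact: mclassX.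
  by apply/funext => x; rewrite /exp_coeff/= mulrC.
- move=> n x; rewrite /series /=.
  apply: (le_trans (ler_norm_sum _ _ _)).
  apply: (@le_trans _ _ (series (exp_coeff `|K|) n)).
    rewrite /series/=; apply: ler_sum => i _.
    rewrite /exp_coeff/= normrM normfV normrX !(@ger0_norm _ (i`!%:R))//.
    rewrite ler_wpM2r// ?invr_ge0//; apply: lerXn2r; rewrite ?nnegrE//.
    exact: le_trans (HK x) (ler_norm _).
  apply: nondecreasing_cvgn_le; last exact: is_cvg_series_exp_coeff.
  apply/nondecreasing_seqP => k; rewrite /series/= big_nat_recr//= lerDl.
  by rewrite /exp_coeff/= mulr_ge0// ?exprn_ge0// invr_ge0.
- move=> x; exact: is_cvg_series_exp_coeff.
Qed.

(* [exp (- exp (n - n^2 (Y - a)))] tends to the indicator of [Y > a], including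
   at the points where [Y = a]. *)
Lemma mclass_gt Y a : mclass Y -> mclass \1_[set x | a < Y x].
Proof.
move=> mY.
apply: (@mclass_lim
  (fun n x => expR (0 - expR (n%:R + - n%:R ^+ 2 * (Y x - a)))) _ 1).
- move=> n; apply: mclass_expR; apply: mclassB; first exact: mclass_cst.
  apply: mclass_expR; apply: mclassD; first exact: mclass_cst.
  by apply: mclassZ; apply: mclassB => //; exact: mclass_cst.
- by move=> n x; rewrite ger0_norm ?expR_ge0// expR_le1 sub0r oppr_le0 expR_ge0.
- move=> x; rewrite indicE; case: (ltP a (Y x)) => h.
  + rewrite mem_set//=.
    apply: (@squeeze_cvgr _ _ _ _ (fun n => 1 - expR (- n%:R)) (cst 1)).
    * near=> n.
      rewrite /cst/= expR_le1 sub0r oppr_le0 expR_ge0 andbT.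
      apply: le_trans (expR_ge1Dx _); rewrite lerD2l lerN2 ler_expR.
      (* Hence [n - n^2 (Y x - a) <= - n], and the inner exponential is at most [e^(-n)]. *)
      have n2 : 2 <= n%:R * (Y x - a).
        rewrite -ler_pdivrMr ?subr_gt0//; near: n; exact: nbhs_infty_ger.
      have n0 : 0 <= n%:R :> R by [].
      nra.
    * rewrite -[X in _ --> X](subr0 1); apply: cvgB; first exact: cvg_cst.
      exact: cvgn_expR.
    * exact: cvg_cst.
  + rewrite memNset/=; last by apply/negP; rewrite -leNgt.
    apply: (@squeeze_cvgr _ _ _ _ (cst 0) (fun n => expR (- n%:R))).
    * near=> n; rewrite /cst/= expR_ge0/= ler_expR sub0r lerN2.
      apply: le_trans (_ : n%:R <= n%:R + - n%:R ^+ 2 * (Y x - a)) _.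
        rewrite lerDl mulNr -mulrN mulr_ge0// ?exprn_ge0//.
        by rewrite oppr_ge0 subr_le0.
      by apply: le_trans (expR_ge1Dx _); rewrite lerDr.
    * exact: cvg_cst.
    * exact: cvgn_expR.
Unshelve. all: by end_near. Qed.

(** Products make this a sigma-algebra and not merely a Dynkin class: the indicator of a union is
    the limit of [1 - prod (1 - 1_(F i))], without making the sets disjoint. *)
Lemma mclass_sigma_algebra : sigma_algebra setT [set A | mclass \1_A].
Proof.
split => /=.
- rewrite (_ : \1_set0 = fun=> 0); first exact: mclass_cst.
  by apply/funext => x; rewrite indic0.
- move=> A mA; rewrite (_ : \1_(_) = fun x => 1 - \1_A x :> R).
    by apply: mclassB => //; exact: mclass_cst.
  by apply/funext => x; rewrite setTD !indicE in_setC; case: (_ \in _); rewrite ?subrr ?subr0.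
- move=> F mF.
  apply: (@mclass_lim (fun n x => 1 - \prod_(i < n) (1 - \1_(F i) x)) _ 1).
  + move=> n; apply: mclassB; first exact: mclass_cst.
    by apply: mclass_prod => i; apply: mclassB => //; exact: mclass_cst.
  + move=> n x.
    have p01 : 0 <= \prod_(i < n) (1 - \1_(F i) x : R) <= 1.
      apply/andP; split.
        by apply: prodr_ge0 => i _; rewrite indicE; case: (_ \in _); rewrite /= ?subrr ?subr0.
      apply: (@Num.Theory.prodr_ile1) => i _; rewrite indicE.
      by case: (_ \in _); rewrite /= ?subrr ?subr0 ?lexx ?ler01.
    by rewrite ger0_norm; lra.
  + move=> x; rewrite indicE; have [[k _ Fk]|h] := pselect ((\bigcup_k F k) x).
      rewrite mem_set//; last by exists k.
      apply: cvg_near_cst; near=> n.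
      have kn : (k < n)%N by near: n; exists k.+1.
      by rewrite (bigD1 (Ordinal kn))//= indicE mem_set// subrr mul0r subr0.
    rewrite memNset//=; apply: cvg_near_cst; apply: nearW => n.
    rewrite big1 ?subrr// => i _; rewrite indicE memNset ?subr0// => Fi.
    by apply: h; exists i.
Unshelve. all: by end_near. Qed.

End mclass.

Import HBNNSimple.

Section mclass_measurable.
Context d (T : measurableType d) (R : realType) (M : set (T -> R)).
Hypothesis M_indic : forall A, measurable A -> mclass M \1_A.

Lemma mclass_measurable (f : T -> R) (K : R) :
  measurable_fun setT f -> (forall x, `|f x| <= K) -> mclass M f.
Proof.
have pos (g : T -> R) : measurable_fun setT g -> (forall x, 0 <= g x <= K) -> mclass M g.
  move=> mg g01.
  have mg' : measurable_fun setT (EFin \o g : T -> \bar R) by exact/measurable_EFinP.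
  pose h := nnsfun_approx measurableT mg'.
  have g0 x : setT x -> (0 <= (EFin \o g) x)%E.
    by move=> _; rewrite /= lee_fin; case/andP: (g01 x).
  have cvh x : (fun n => h n x) @ \oo --> g x.
    exact: (fine_cvg (cvg_nnsfun_approx measurableT mg' g0 (x:=x) I)).
  apply: (@mclass_lim _ _ _ (fun n => h n : T -> R) _ K) => //.
    move=> n.
    rewrite (_ : (h n : T -> R) = fun x => \sum_(y <- fset_set (range (h n)))
         y * \1_(h n @^-1` [set y]) x).
      apply: mclass_sum => y _; apply: mclassZ; apply: M_indic.
      exact: measurable_funPTI.
    by apply/funext => x; rewrite fimfunE fsbig_finite.
  move=> n x; rewrite ger0_norm ?fun_ge0//.
  apply: (@le_trans _ _ (g x)); last by case/andP: (g01 x).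
  rewrite -lee_fin /h nnsfun_approxE.
  exact: (@le_approx _ T R setT (EFin \o g) n x g0 I).
move=> mf fK.
rewrite (_ : f = fun x => Num.max (f x) 0 - Num.max (- f x) 0); last first.
  apply/funext => x; have [fx|] := boolP (0 <= f x).
    by rewrite max_l// max_r ?oppr_le0// subr0.
  rewrite -ltNge => /ltW fx.
  by rewrite max_r// max_l ?oppr_ge0// sub0r opprK.
apply: mclassB; apply: pos.
- by apply: measurable_maxr => //; exact: measurable_cst.
- move=> x; rewrite le_max lexx orbT/= ge_max (le_trans (ler_norm _))//=.
  exact: le_trans (fK x).
- apply: measurable_maxr; last exact: measurable_cst.
  exact: measurableT_comp.
- move=> x; rewrite le_max lexx orbT/= ge_max (le_trans (ler_norm _)) ?normrN//=.
  exact: le_trans (fK x).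
Qed.

End mclass_measurable.

(** * Smooth functions and test functions *)

Section smooth_class.
Context (R : realType) (n : nat).
Implicit Types (f g : 'rV[R]_n -> R) (G : set (R -> R)).

Definition closed_under_derive G :=
  forall h, G h -> (forall x, derivable h x 1) /\ G (derive1 h).

(** Smoothness quantifies over all iterated derivatives, and the derivative of a product or a
    composite is a sum of products and composites. The induction therefore runs over this syntactic
    closure, which directional derivatives preserve once [G] is stable under derivation. *)
Inductive smooth_class G : ('rV[R]_n -> R) -> Prop :=
| smooth_class_base f : smooth f -> smooth_class G f
| smooth_class_cst c : smooth_class G (cst c)
| smooth_class_coord i : smooth_class G (fun x => x 0 i)
| smooth_class_add f g : smooth_class G f -> smooth_class G g ->
    smooth_class G (f + g)
| smooth_class_mul f g : smooth_class G f -> smooth_class G g ->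
    smooth_class G (f * g)
| smooth_class_comp h f : G h -> smooth_class G f -> smooth_class G (h \o f).

Lemma iter_derive_rcons vs v f :
  iter_derive (rcons vs v) f = iter_derive vs (fun x => 'D_v f x).
Proof. by rewrite /iter_derive foldr_rcons. Qed.

Lemma smooth_derive v f : smooth f -> smooth (fun x => 'D_v f x).
Proof. by move=> sf vs x; rewrite -iter_derive_rcons; exact: sf. Qed.

Lemma derive_coord v i (x : 'rV[R]_n) :
  'D_v (fun y : 'rV[R]_n => y 0 i) x = v 0 i.
Proof.
rewrite deriveE; last exact: differentiable_coord.
pose f := fun y : 'rV[R]_n => y 0 i : R.
have lf : linear f by move=> a y z; rewrite /f !mxE.
pose hf := GRing.isLinear.Build _ _ _ _ f lf.
pose F : {linear 'rV[R]_n -> R} := HB.pack f hf.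
rewrite -[X in 'd X _]/(F : 'rV[R]_n -> R) diff_lin//.
exact: coord_continuous.
Qed.

Lemma derive_comp v (h : R -> R) f x : differentiable f x -> derivable h (f x) 1 ->
  differentiable (h \o f) x /\
  'D_v (h \o f) x = derive1 h (f x) * 'D_v f x.
Proof.
move=> df dh; have dh' : differentiable h (f x) by exact/derivable1_diffP.
split; first exact: differentiable_comp.
rewrite deriveE; last exact: differentiable_comp.
by rewrite diff_comp//= deriv1E// (deriveE _ df) mulrC.
Qed.

Lemma smooth_class_derive G f : closed_under_derive G -> smooth_class G f ->
  (forall x, differentiable f x) /\
  forall v, smooth_class G (fun x => 'D_v f x).
Proof.
move=> cG; elim=> {f}.
- move=> f sf; split => [x|v]; first exact: (sf [::]).
  by apply: smooth_class_base; exact: smooth_derive.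
- move=> c; split => [x|v]; first exact: differentiable_cst.
  rewrite (_ : (fun x => _) = cst 0); first exact: smooth_class_cst.
  by apply/funext => x; rewrite derive_cst.
- move=> i; split => [x|v]; first exact: differentiable_coord.
  rewrite (_ : (fun x => _) = cst (v 0 i)); first exact: smooth_class_cst.
  by apply/funext => x; rewrite derive_coord.
- move=> f g sf [df Df] sg [dg Dg]; split => [x|v].
    exact: differentiableD.
  rewrite (_ : (fun x => _) =
    (fun x => 'D_v f x) + (fun x => 'D_v g x)); first exact: smooth_class_add.
  by apply/funext => x; rewrite deriveD//; exact: diff_derivable.
- move=> f g sf [df Df] sg [dg Dg]; split => [x|v].
    exact: differentiableM.
  rewrite (_ : (fun x => _) =
    f * (fun x => 'D_v g x) + g * (fun x => 'D_v f x)).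
    by apply: smooth_class_add; exact: smooth_class_mul.
  by apply/funext => x; rewrite deriveM//; exact: diff_derivable.
- move=> h f Gh sf [df Df]; have [dh Gh'] := cG _ Gh; split => [x|v].
    by have [] := derive_comp 0 (df x) (dh (f x)).
  rewrite (_ : (fun x => _) = (derive1 h \o f) * (fun x => 'D_v f x)).
    by apply: smooth_class_mul => //; exact: smooth_class_comp.
  by apply/funext => x; have [_] := derive_comp v (df x) (dh (f x)).
Qed.

Lemma smooth_class_smooth G f :
  closed_under_derive G -> smooth_class G f -> smooth f.
Proof.
move=> cG sf vs.
suff : smooth_class G (iter_derive vs f) by move/(smooth_class_derive cG) => [].
elim: vs => [//|v vs IH] /=.
by have [_ /(_ v)] := smooth_class_derive cG IH.
Qed.

Lemma closed_under_derive0 : closed_under_derive set0.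
Proof. by []. Qed.

Lemma smooth_cst c : smooth (cst c : 'rV[R]_n -> R).
Proof.
exact: smooth_class_smooth closed_under_derive0 (smooth_class_cst _ c).
Qed.

Lemma smooth_coord i : smooth (fun x : 'rV[R]_n => x 0 i).
Proof.
exact: smooth_class_smooth closed_under_derive0 (smooth_class_coord _ i).
Qed.

Lemma smoothD f g : smooth f -> smooth g -> smooth (fun x => f x + g x).
Proof.
move=> sf sg; apply: (smooth_class_smooth closed_under_derive0).
by apply: smooth_class_add; exact: smooth_class_base.
Qed.

Lemma smoothM f g : smooth f -> smooth g -> smooth (fun x => f x * g x).
Proof.
move=> sf sg; apply: (smooth_class_smooth closed_under_derive0).
by apply: smooth_class_mul; exact: smooth_class_base.
Qed.

Lemma smooth_comp G h f : closed_under_derive G -> G h -> smooth f ->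
  smooth (fun x => h (f x)).
Proof.
move=> cG Gh sf; apply: (smooth_class_smooth cG).
by apply: (smooth_class_comp (f := f)) => //; exact: smooth_class_base.
Qed.

Lemma smooth_prod (I : Type) (r : seq I) (f : I -> 'rV[R]_n -> R) :
  (forall i, smooth (f i)) -> smooth (fun x => \prod_(i <- r) f i x).
Proof.
move=> sf; elim: r => [|i r IH].
  rewrite (_ : (fun x => _) = cst 1); first exact: smooth_cst.
  by apply/funext => x; rewrite big_nil.
rewrite (_ : (fun x => _) = fun x => f i x * \prod_(i <- r) f i x).
  exact: smoothM.
by apply/funext => x; rewrite big_cons.
Qed.

Lemma smooth_expR f : smooth f -> smooth (fun x => expR (f x)).
Proof.
apply: (@smooth_comp [set (@expR R)]) => // _ ->; split => //=.
apply/funext => x; rewrite derive1E; have [_ ->] := is_derive_expR x.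
by [].
Qed.

Lemma smooth_continuous f : smooth f -> continuous f.
Proof. by move=> sf x; exact: differentiable_continuous (sf [::] x). Qed.

End smooth_class.

(* The functions [p(1/s) e^(-1/s)] for [s > 0], extended by [0]. *)
Section flat.
Context (R : realType).
Implicit Types (p : {poly R}) (s : R).

Definition flat p s : R :=
  if 0 < s then p.[s^-1] * expR (- s^-1) else 0.

Lemma expRXn_le (u : R) i : 0 <= u -> u ^+ i <= i`!%:R * expR u.
Proof.
case: i => [|i] u0; first by rewrite expr0 fact0 mul1r -expR0 ler_expR.
rewrite mulrC -ler_pdivrMr ?ltr0n ?fact_gt0//.
by apply: le_trans (expR_ge1Dxn i u0); rewrite lerDr.
Qed.

Lemma poly_expR_bound p : exists C : R,
  forall u, 0 <= u -> `|p.[u]| <= C * expR u.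
Proof.
exists (\sum_(i < size p) `|p`_i| * i`!%:R) => u u0.
rewrite horner_coef mulr_suml (le_trans (ler_norm_sum _ _ _))//.
apply: ler_sum => i _; rewrite normrM -mulrA ler_wpM2l//.
by rewrite ger0_norm ?exprn_ge0//; exact: expRXn_le.
Qed.

(** This is [u^2 |p(u)| <= C e^u] at [u = 1/s]. The square makes the difference quotient at [0] tend
    to [0]. *)
Lemma flat_bound p : exists C, forall s, `|flat p s| <= C * s ^+ 2.
Proof.
have [C HC] := poly_expR_bound (p * 'X^2).
have C0 : 0 <= C.
  by have := HC 0 (lexx _); rewrite expR0 mulr1; exact: le_trans.
exists C => s; rewrite /flat; case: ifPn => s0; last first.
  by rewrite normr0 mulr_ge0// sqr_ge0.
have u0 : 0 < s^-1 by rewrite invr_gt0.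
have := HC s^-1 (ltW u0).
rewrite hornerM hornerXn !(normrM p.[s^-1]) (ger0_norm (expR_ge0 _)) => h.
rewrite expRN ler_pdivrMr ?expR_gt0//.
move: h; rewrite (ger0_norm (exprn_ge0 _ (ltW u0))) exprVn.
rewrite ler_pdivrMr ?exprn_gt0//; lra.
Qed.

Lemma is_derive1V (s : R) : s != 0 -> is_derive s 1 (@GRing.inv R) (- s ^- 2).
Proof.
move=> s0; have -> : @GRing.inv R = (fun y : R => (id y)^-1) by [].
split; first exact: derivableV.
by rewrite deriveV// derive_id [_ *: _]mulr1.
Qed.

(** With [u = 1/s] one has [du/ds = - u^2], so differentiating [p(u) e^(-u)] gives
    [(p - p')(u) u^2 e^(-u)]: the family is closed under derivation. *)
Lemma is_derive_flat p s : is_derive s 1 (flat p) (flat ((p - deriv p) * 'X^2) s).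
Proof.
have [s0|s0|s0] := ltgtP s 0.
- rewrite [X in is_derive _ _ _ X](_ : _ = 0); last by rewrite /flat ltNge (ltW s0).
  apply: (@near_eq_is_derive _ _ _ (cst 0)) => //.
  near=> t; rewrite /flat ifN// -leNgt ltW//.
  by near: t; exact: lt_nbhsl.
- apply: (@near_eq_is_derive _ _ _ ((horner p \o @GRing.inv R) *
    (@expR R \o (- (@GRing.inv R : R -> R))))) => //.
    near=> t; rewrite /flat ifT//.
    by near: t; exact: lt_nbhsr.
  have dV := is_derive1V (lt0r_neq0 s0).
  have dp : is_derive s^-1 1 (horner p) (deriv p).[s^-1].
    by split; [exact: derivable_horner|rewrite derivE derive1E].
  have dN : is_derive s 1 (- (@GRing.inv R : R -> R)) (s ^- 2).
    by rewrite -[s ^- 2]opprK; exact: is_deriveN.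
  apply: is_derive_eq (is_deriveM (is_derive1_comp dp dV)
    (is_derive1_comp (is_derive_expR _) dN)) _.
  rewrite /flat s0 /= hornerM hornerXn hornerD hornerN exprVn -!exprVn.
  rewrite /GRing.scale/=; ring.
- rewrite s0.
  rewrite [X in is_derive _ _ _ X](_ : _ = 0); last by rewrite /flat ltxx.
  have cv : h^-1 *: (flat p (h *: 1 + 0) - flat p 0) @[h --> 0^'] --> (0 : R).
    have [C HC] := flat_bound p.
    apply: norm_cvg0.
    apply: (@squeeze_cvgr _ _ _ _ (cst 0) (fun h => C * `|h|)).
    + near=> h; have h0 : h != 0 by near: h; exact: nbhs_dnbhs_neq.
      rewrite /= normr_ge0/= addr0 [h%:A]mulr1 {2}/flat ltxx subr0.
      rewrite normrM normfV mulrC ler_pdivrMr ?normr_gt0//.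
      by rewrite -mulrA -normrM -expr2 (ger0_norm (sqr_ge0 _)); exact: HC.
    + exact: cvg_cst.
    + rewrite -[X in _ --> X](mulr0 C); apply: cvgM; first exact: cvg_cst.
      apply/cvgr0Pnorm_lt => e e0; near=> h; rewrite normr_id.
      by near: h; exact: dnbhs0_lt.
  split; first by apply/cvg_ex; exists 0.
  exact: cvg_lim cv.
Unshelve. all: by end_near. Qed.

End flat.

Section testfun.
Context (R : realType) (d : nat).
Let E := euclid R d.
Implicit Types (f u v : E -> R).

Lemma closed_under_derive_flat : closed_under_derive (range (@flat R)).
Proof.
move=> _ [p _ <-]; split => [x|]; first by have [] := is_derive_flat p x.
exists ((p - deriv p) * 'X^2) => //.
by apply/funext => x; rewrite derive1E; have [_ ->] := is_derive_flat p x.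
Qed.

(** A closed set of [R^d] is compact as soon as it is bounded, and a bound on the points where [f]
    is nonzero passes through sums and products more easily than a closure. *)
Lemma testfunP f : testfun f <->
  smooth f /\ exists K : R, forall x, f x != 0 -> `|x| <= K.
Proof.
split=> -[sf].
  move=> /compact_bounded [K [Kreal HK]]; split=> //.
  exists (K + 1) => x fx; apply: (HK (K + 1)); first by rewrite ltrDl.
  exact: subset_closure.
move=> [K HK]; split=> //.
have cK : closed [set x : E | `|x| <= K].
  rewrite [X in closed X](_ : _ = (fun x : E => `|x|) @^-1` [set r | r <= K])//.
  by apply: preimage_closed; [move=> x _; exact: norm_continuous|exact: closed_le].
apply: bounded_closed_compact; last exact: closed_closure.
exists K; split; first exact: num_real.
move=> M KM x; have sub : [set x | f x != 0] `<=` [set x : E | `|x| <= K].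
  by move=> y /HK.
by move=> /(closure_subset sub); rewrite -(closure_id _).1//= => /le_trans; apply; exact: ltW.
Qed.

Lemma testfun_smooth f : testfun f -> smooth f. Proof. by case. Qed.

Lemma testfun0 : testfun ((fun=> 0) : E -> R).
Proof.
apply/testfunP; split; first exact: smooth_cst.
by exists 0 => x; rewrite eqxx.
Qed.

Lemma testfunMl u f : smooth f -> testfun u -> testfun (fun x => f x * u x).
Proof.
move=> sf /testfunP[su [K HK]]; apply/testfunP; split; first exact: smoothM.
by exists K => x; rewrite mulf_eq0 negb_or => /andP[_ /HK].
Qed.

Lemma testfunZ a u : testfun u -> testfun (fun x => a * u x).
Proof. by apply: testfunMl; exact: smooth_cst. Qed.

Lemma testfunD u v : testfun u -> testfun v -> testfun (fun x => u x + v x).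
Proof.
move=> /testfunP[su [K HK]] /testfunP[sv [L HL]]; apply/testfunP.
split; first exact: smoothD.
exists (Num.max K L) => x; rewrite le_max.
have [->|u0 _] := eqVneq (u x) 0; last by rewrite HK.
by rewrite add0r => /HL ->; rewrite orbT.
Qed.

Lemma testfun_lin a u v : testfun u -> testfun v ->
  testfun (fun x => a * u x + v x).
Proof. by move=> tu tv; apply: testfunD => //; exact: testfunZ. Qed.

Lemma testfun_sum (I : Type) (r : seq I) (P : pred I) (u : I -> E -> R) :
  (forall i, testfun (u i)) -> testfun (fun x => \sum_(i <- r | P i) u i x).
Proof.
move=> tu; elim: r => [|i r IH].
  rewrite (_ : (fun x => _) = fun=> 0); first exact: testfun0.
  by apply/funext => x; rewrite big_nil.
case Pi : (P i).
  rewrite (_ : (fun x => _) = fun x => u i x + \sum_(i <- r | P i) u i x).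
    exact: testfunD.
  by apply/funext => x; rewrite big_cons Pi.
rewrite (_ : (fun x => _) = fun x => \sum_(i <- r | P i) u i x)//.
by apply/funext => x; rewrite big_cons Pi.
Qed.

Lemma testfun_bounded f : testfun f -> exists K, forall x, `|f x| <= K.
Proof.
move=> [sf cf].
have : compact (f @` closure [set x | f x != 0]).
  apply: continuous_compact => //; apply: continuous_subspaceT.
  exact: smooth_continuous.
move=> /compact_bounded [K [Kr HK]]; exists (Num.max 0 (K + 1)) => x.
have [->|fx] := eqVneq (f x) 0; first by rewrite normr0 le_max lexx.
rewrite le_max; apply/orP; right; apply: HK; first by rewrite ltrDl.
by exists x => //; exact: subset_closure.
Qed.

Lemma coord_le_norm (x : E) i : `|x 0 i| <= `|x|.
Proof.
rewrite [leRHS]/Num.norm/= mx_normrE.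
exact: (le_bigmax _ (fun ij => `|x ij.1 ij.2|) (ord0, i)).
Qed.

Lemma norm_le (x : E) K : 0 <= K -> (forall i, `|x 0 i| <= K) -> `|x| <= K.
Proof.
move=> K0 xK; rewrite [leLHS]/Num.norm/= mx_normrE.
by apply/bigmax_leP; split=> //= -[i j] _ /=; rewrite ord1.
Qed.

Definition box (a b : 'I_d -> R) : set E :=
  [set x : E | forall i, a i < x 0 i < b i].

(** Since [e^(-1/(k s))] tends to [1] as [k] grows, for every [s > 0], the bumps tend to the
    indicator of the box while all of them vanish off that same box. *)
Definition box_bump (a b : 'I_d -> R) n (x : E) : R :=
  \prod_(i < d) (flat 1 (n.+1%:R * (x 0 i - a i))
               * flat 1 (n.+1%:R * (b i - x 0 i))).

Lemma flat1_ge0_le1 (s : R) : 0 <= flat 1 s <= 1.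
Proof.
rewrite /flat; case: ifPn => s0; last by rewrite lexx ler01.
by rewrite hornerC mul1r expR_ge0 expR_le1 oppr_le0 invr_ge0 ltW.
Qed.

Lemma flat1_gt0 (s : R) : (0 < flat 1 s) = (0 < s).
Proof.
rewrite /flat; case: ifPn => s0; last by rewrite ltxx.
by rewrite hornerC mul1r expR_gt0.
Qed.

Lemma box_bump_ge0_le1 a b n x : 0 <= box_bump a b n x <= 1.
Proof.
have h i : 0 <= flat 1 (n.+1%:R * (x 0 i - a i))
               * flat 1 (n.+1%:R * (b i - x 0 i)) <= 1.
  have /andP[? ?] := flat1_ge0_le1 (n.+1%:R * (x 0 i - a i)).
  have /andP[? ?] := flat1_ge0_le1 (n.+1%:R * (b i - x 0 i)).
  by rewrite mulr_ge0// mulr_ile1.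
apply/andP; split; first by apply: prodr_ge0 => i _; case/andP: (h i).
by apply: (@Num.Theory.prodr_ile1) => i _.
Qed.

Lemma box_bump_gt0 a b n x : box a b x -> 0 < box_bump a b n x.
Proof.
move=> xab; apply: prodr_gt0 => i _; have /andP[ax xb] := xab i.
by rewrite mulr_gt0// flat1_gt0 mulr_gt0// subr_gt0.
Qed.

Lemma box_bump_eq0 a b n x : ~ box a b x -> box_bump a b n x = 0.
Proof.
move=> nab; have [ i ] := (existsNP _).2 nab; rewrite /box_bump (bigD1 i)//= => /negP.
rewrite negb_and -!leNgt => h; rewrite [X in X * _](_ : _ = 0) ?mul0r//.
have z s : s <= 0 -> flat 1 (n.+1%:R * s) = 0 :> R.
  by move=> s0; rewrite /flat ifN// -leNgt mulr_ge0_le0.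
by case/orP: h => h; [rewrite z ?subr_le0// mul0r|
  rewrite (z (b i - _)) ?subr_le0// mulr0].
Qed.

Lemma box_bump_cvg a b x : box_bump a b ^~ x @ \oo --> (\1_(box a b) x : R).
Proof.
rewrite indicE; have [xab|xab] := pselect (box a b x); last first.
  by rewrite memNset//; apply: cvg_near_cst; apply: nearW => n; exact: box_bump_eq0.
rewrite mem_set//=.
have flatcvg s : 0 < s -> flat 1 (n.+1%:R * s) @[n --> \oo] --> (1 : R).
  move=> s0.
  have -> : (fun n => flat 1 (n.+1%:R * s)) = fun n => expR (- (s^-1 * n.+1%:R^-1)).
    by apply/funext => n; rewrite /flat mulr_gt0// hornerC mul1r invfM mulrC.
  rewrite -[X in _ --> X]expR0 -[X in _ --> expR X]oppr0 -[X in _ --> expR (- X)](mulr0 s^-1).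
  apply: continuous_cvg; first exact: continuous_expR.
  apply: cvgN; apply: cvgM; first exact: cvg_cst.
  exact: cvg_harmonic.
rewrite [X in _ --> X](_ : 1 = \prod_(i < d) (1 * 1)); last by rewrite mulr1 big1.
apply: cvg_big => [|i _]; first exact: mul_continuous.
by have /andP[ax xb] := xab i; apply: cvgM; apply: flatcvg; rewrite subr_gt0.
Qed.

Lemma box_bounded a b : exists K : R, forall x, box a b x -> `|x| <= K.
Proof.
exists (\sum_i (`|a i| + `|b i|)) => x xab.
have K0 : 0 <= \sum_i (`|a i| + `|b i|).
  by apply: sumr_ge0 => i _; rewrite addr_ge0 ?normr_ge0.
apply: norm_le => // j.
rewrite (bigD1 j)//=; have /andP[ax xb] := xab j.
apply: ler_wpDr; first by apply: sumr_ge0 => k _; rewrite addr_ge0 ?normr_ge0.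
have := ler_norm (b j); have := ler_norm (- a j); rewrite normrN => ? ?.
have := normr_ge0 (a j); have := normr_ge0 (b j) => ? ?.
by rewrite ler_norml; apply/andP; split; lra.
Qed.

Lemma testfun_box_bump a b n : testfun (box_bump a b n).
Proof.
apply/testfunP; split.
  apply: smooth_prod => i; apply: smoothM.
    apply: (smooth_comp closed_under_derive_flat); first by exists 1.
    apply: smoothM; first exact: smooth_cst.
    apply: smoothD; [exact: smooth_coord|exact: smooth_cst].
  apply: (smooth_comp closed_under_derive_flat); first by exists 1.
  apply: smoothM; first exact: smooth_cst.
  apply: smoothD; first exact: smooth_cst.
  rewrite (_ : (fun x => _) = fun x : E => -1 * x 0 i).
    by apply: smoothM; [exact: smooth_cst|exact: smooth_coord].
  by apply/funext => x; rewrite mulN1r.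
have [K HK] := box_bounded a b; exists K => x bx; apply: HK.
by apply: contrapT => /(box_bump_eq0 n)/eqP; exact/negP.
Qed.

Lemma norm_box (K : R) (x : E) :
  `|x| < K -> box (fun=> - K) (fun=> K) x.
Proof.
move=> xK i; rewrite -ltr_norml; exact: le_lt_trans (coord_le_norm _ _) xK.
Qed.

(* A test function that is positive wherever [f] does not vanish. *)
Lemma testfun_majorant f : testfun f -> exists w : E -> R,
  [/\ testfun w, forall x, 0 <= w x & forall x, f x != 0 -> 0 < w x].
Proof.
move=> /testfunP[_ [K HK]].
exists (box_bump (fun=> - (K + 1)) (fun=> K + 1) 0); split.
- exact: testfun_box_bump.
- by move=> x; case/andP: (box_bump_ge0_le1 (fun=> - (K + 1)) (fun=> K + 1) 0 x).
- move=> x /HK xK; apply: box_bump_gt0; apply: norm_box.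
  by rewrite (le_lt_trans xK)// ltrDl.
Qed.

End testfun.

(** * Measurability on R^d and on configurations *)

Section real_valued_measurable.
Context d (T : measurableType d) (R : realType).
Implicit Types f : T -> R.

Lemma measurable_fun_gt f : (forall r, measurable [set x | r < f x]) ->
  measurable_fun setT f.
Proof.
move=> mf; apply: (measurability _ (RGenOInfty.measurableE R)) => //.
move=> _ [_ [r ->] <-]; rewrite setTI.
rewrite (_ : _ @^-1` _ = [set x | r < f x])//.
by apply/seteqP; split => x /=; rewrite in_itv/= andbT.
Qed.

Lemma measurable_gt f r : measurable_fun setT f -> measurable [set x | r < f x].
Proof.
move=> mf; rewrite (_ : [set x | _] = f @^-1` `]r, +oo[).
  by rewrite -[_ @^-1` _]setTI; exact: mf.
by apply/seteqP; split => x /=; rewrite in_itv/= andbT.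
Qed.

Lemma measurable_fun_pointwise_cvg (f_ : nat -> T -> R) f :
  (forall n, measurable_fun setT (f_ n)) -> (forall x, f_ ^~ x @ \oo --> f x) ->
  measurable_fun setT f.
Proof. by move=> mf cf; apply: measurable_fun_cvg => // x _; exact: cf. Qed.

(** Unlike in [mclass], the limits need not be bounded, so truncation at height [n] reaches every
    measurable function. This suits measurability statements, where no domination is involved. *)
Lemma measurable_fun_ind (V : (T -> R) -> Prop) :
  (forall A, measurable A -> V \1_A) ->
  (forall a f g, V f -> V g -> V (fun x => a * f x + g x)) ->
  (forall (f_ : nat -> T -> R) f, (forall n, V (f_ n)) ->
     (forall x, f_ ^~ x @ \oo --> f x) -> V f) ->
  forall f, measurable_fun setT f -> V f.
Proof.
move=> V1 Vlin Vlim f mf.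
have Vm g : mclass [set \1_A | A in measurable] g -> V g.
  elim=> {g}; [| |by move=> *; exact: Vlin|].
  - by move=> _ [A mA <-]; exact: V1.
  - move=> c; rewrite (_ : (fun=> c) = fun x => (c - 1) * \1_setT x + \1_setT x :> R).
      by apply: Vlin; apply: V1.
    by apply/funext => x; rewrite indicT/=; ring.
  - by move=> f_ g K _ Vf _ cf; exact: Vlim cf.
pose f_ n x : R := Num.max (Num.min (f x) n%:R) (- n%:R).
apply: (Vlim f_) => [n|x].
  apply: Vm; apply: (@mclass_measurable _ _ _ _ _ _ n%:R) => [A mA||x].
  - by apply: mclass_base; exists A.
  - by apply: measurable_maxr => //; exact: measurable_minr.
  - rewrite ler_norml /f_ le_max lexx orbT/= ge_max ge_min lexx orbT/=.
    by rewrite (@le_trans _ _ 0)// oppr_le0.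
apply: cvg_near_cst; near=> n.
have fn : `|f x| <= n%:R by near: n; exact: nbhs_infty_ger.
move: fn; rewrite ler_norml => /andP[h1 h2].
by rewrite /f_ min_l// max_l.
Unshelve. all: by end_near. Qed.

End real_valued_measurable.

Lemma mclass_measurable_sigma (T : pointedType) (R : realType)
    (M : set (T -> R)) (S : set (set T)) (Y : T -> R) :
  (forall Z, M Z -> exists K, forall x, `|Z x| <= K) ->
  (forall Z W, M Z -> M W -> mclass M (fun x => Z x * W x)) ->
  [set A | mclass M \1_A] `<=` S -> mclass M Y ->
  measurable_fun setT (Y : g_sigma_algebraType S -> R).
Proof.
move=> Mb MM MS mY; apply: measurable_fun_gt => r.
by apply: sub_sigma_algebra; apply: MS; exact: mclass_gt.
Qed.

Section euclid_measurable.
Context (R : realType) (d : nat).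
Let E := euclid R d.

Lemma open_measurable_euclid (U : set E) : open U -> measurable U.
Proof. exact: sub_sigma_algebra. Qed.

Lemma continuous_measurable_euclid (f : E -> R) :
  continuous f -> measurable_fun setT f.
Proof.
move=> cf; apply: measurable_fun_gt => r; apply: open_measurable_euclid.
rewrite (_ : [set x | _] = f @^-1` [set y | r < y])//.
by apply: open_comp => [x _|]; [exact: cf|exact: open_gt].
Qed.

Lemma testfun_measurable (f : E -> R) : testfun f -> measurable_fun setT f.
Proof.
by move=> [sf _]; apply: continuous_measurable_euclid; exact: smooth_continuous.
Qed.

Lemma measurable_box (a b : 'I_d -> R) : measurable (box a b).
Proof.
rewrite (_ : box a b = [set x | 0 < box_bump a b 0 x]).
  by apply: measurable_gt; apply: testfun_measurable; exact: testfun_box_bump.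
apply/seteqP; split => x /=; first exact: box_bump_gt0.
by move=> bx; apply: contrapT => /(box_bump_eq0 0) b0; rewrite b0 ltxx in bx.
Qed.

Lemma boxI (a b a' b' : 'I_d -> R) : box a b `&` box a' b' =
  box (fun i => Num.max (a i) (a' i)) (fun i => Num.min (b i) (b' i)).
Proof.
apply/seteqP; split => x /=.
  move=> [h h'] i; have /andP[? ?] := h i; have /andP[? ?] := h' i.
  by rewrite gt_max lt_min; apply/andP; split; apply/andP.
move=> h; split => i; have := h i; rewrite gt_max lt_min => /andP[/andP[? ?] /andP[? ?]];
  exact/andP.
Qed.

(** Balls of the maximum norm are boxes, so an open set is the union of the countably many cubes
    with rational centre and radius [1 / n.+1] that it contains; [F] enumerates them, with the empty
    set for all other codes. *)
Lemma boxes_generate (S : set (set E)) : sigma_algebra setT S ->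
  (forall a b, S (box a b)) -> measurable `<=` S.
Proof.
move=> sS Sb; apply: smallest_sub => // U oU.
pose Q (p : {ffun 'I_d -> rat} * nat) :=
  box (fun i => ratr (p.1 i) - p.2.+1%:R^-1) (fun i => ratr (p.1 i) + p.2.+1%:R^-1 : R).
pose F k := if choice.unpickle k is Some p then
  if `[< Q p `<=` U >] then Q p else set0 else set0.
have [S0 _ SU] := sS.
have -> : U = \bigcup_k F k; last first.
  apply: SU => k; rewrite /F; case: (choice.unpickle k) => [p|//].
  by case: asboolP => // _; exact: Sb.
apply/seteqP; split => x; last first.
  move=> [k _]; rewrite /F; case: (choice.unpickle k) => [p|//].
  by case: asboolP => // sub; exact: sub.
move=> Ux; have : nbhs x U by exact: open_nbhs_nbhs.
move=> /nbhs_ballP [e /= e0 xeU].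
(* Both [x] and an arbitrary point of the cube are within [1 / n.+1] of its centre, hence the factor
   2. *)
have [n ne] : exists n, 2 * n.+1%:R^-1 < e.
  have : \forall n \near \oo, n.+1%:R^-1 < e / 2.
    by apply: near_infty_natSinv_lt (PosNum (divr_gt0 e0 _)).
  move=> [n _ /(_ n (leqnn n))/= h]; by exists n; rewrite -ltr_pdivlMl// [_^-1 * e]mulrC.
have [r rE] : exists r : R, r = n.+1%:R^-1 by exists n.+1%:R^-1.
have r0 : 0 < r by rewrite rE.
rewrite -rE in ne.
have /choice[q qP] (i : 'I_d) : exists q : rat, `|x 0 i - ratr q| < r.
  have [|q] := @rat_in_itvoo R (x 0 i - r) (x 0 i + r).
    by rewrite ltrD2l gt0_cp.
  rewrite in_itv/= => /andP[h1 h2]; exists q.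
  by rewrite ltr_norml; apply/andP; split; lra.
exists (choice.pickle ([ffun i => q i], n)) => //.
rewrite /F choice.pickleK /Q /= -rE asboolT.
  move=> i /=; rewrite ffunE; have := qP i; rewrite ltr_norml => /andP[? ?].
  by apply/andP; split; lra.
move=> y yQ; apply: xeU; rewrite -ball_normE /ball_/=.
apply: le_lt_trans ne; apply: norm_le => [|i]; first by rewrite mulr_ge0// ltW.
have := yQ i; have := qP i; rewrite ltr_norml !mxE/= !ffunE => /andP[? ?] /andP[? ?].
by rewrite ler_norml; apply/andP; split; lra.
Qed.

Lemma measurable_fun_euclid d' (T : measurableType d') (f : T -> E) :
  (forall i, measurable_fun setT (fun t => f t 0 i)) -> measurable_fun setT f.
Proof.
move=> mf; suff H : measurable `<=` [set A | measurable (f @^-1` A)].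
  by move=> _ A mA; rewrite setTI; exact: H.
apply: boxes_generate.
  split => /=; first by rewrite preimage_set0.
    by move=> A mA; rewrite setTD -preimage_setC; exact: measurableC.
  by move=> F mF; rewrite preimage_bigcup; exact: bigcupT_measurable.
move=> a b /=.
rewrite (_ : _ @^-1` _ = \bigcap_(i in [set: 'I_d])
    ([set t | a i < f t 0 i] `&` [set t | - b i < - f t 0 i])).
  apply: fin_bigcap_measurable => // i _; apply: measurableI.
    exact: measurable_gt.
  by apply: measurable_gt; exact: measurableT_comp.
apply/seteqP; split => t /=.
  by move=> h i _; have /andP[? ?] := h i; split => //=; rewrite ltrN2.
by move=> h i; have [/= ? ] := h i I; rewrite ltrN2 => ?; apply/andP.
Qed.

End euclid_measurable.

(** * Sums over the points of a configuration *)

Section pairing.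
Context (R : realType) (d : nat).
Let E := euclid R d.
Implicit Types (gamma : conf R d) (f : E -> R) (K : R).

(** The sum in [pairing] takes the default value 0 when infinitely many terms are nonzero. A bound
    on the support turns it into a genuine finite sum, for which linearity holds. *)
Definition supported_in K (V : nmodType) (f : E -> V) :=
  forall x, f x != 0 -> `|x| <= K.

Definition pts_in gamma K : {fset E} := fset_set (gamma `&` [set x | `|x| <= K]).

Lemma compact_norm_ball K : compact [set x : E | `|x| <= K].
Proof.
apply: bounded_closed_compact.
  exists K; split; first exact: num_real.
  by move=> M KM x /= /le_trans; apply; exact: ltW.
rewrite [X in closed X](_ : _ = (fun x : E => `|x|) @^-1` [set r | r <= K])//.
by apply: preimage_closed; [move=> x _; exact: norm_continuous|exact: closed_le].
Qed.

Lemma pts_inP gamma K x : x \in pts_in gamma K <-> (pts gamma x /\ `|x| <= K).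
Proof.
rewrite /pts_in in_fset_set; last first.
  by apply: conf_locally_finite; exact: compact_norm_ball.
by split=> [/set_mem|] h; [|exact: mem_set].
Qed.

Lemma pairingE (V : nmodType) gamma K (f : E -> V) : supported_in K f ->
  pairing gamma f = \sum_(x <- pts_in gamma K) f x.
Proof.
move=> fK; rewrite /pairing.
have fin : finite_set (gamma `&` [set x | `|x| <= K]).
  by apply: conf_locally_finite; exact: compact_norm_ball.
rewrite -[RHS]fsbig_finite//; apply/esym/fsbig_widen; first by move=> x [].
move=> x [/= gx ngx]; apply/eqP/negPn/negP => fx.
by apply: ngx; split => //=; exact: fK.
Qed.

Lemma pairingD gamma K (V : nmodType) (f g : E -> V) :
  supported_in K f -> supported_in K g ->
  pairing gamma (fun x => f x + g x) = pairing gamma f + pairing gamma g.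
Proof.
move=> fK gK; rewrite !(@pairingE _ _ K)//; first by rewrite big_split.
move=> x; have [->|fx _] := eqVneq (f x) 0; last exact: fK.
by rewrite add0r; exact: gK.
Qed.

Lemma supported_inMl K (f g : E -> R) :
  supported_in K f -> supported_in K (fun x => g x * f x).
Proof. by move=> fK x; rewrite mulf_eq0 negb_or => /andP[_ /fK]. Qed.

Lemma pairingZ gamma K a f : supported_in K f ->
  pairing gamma (fun x => a * f x) = a * pairing gamma f.
Proof.
move=> fK; rewrite !(@pairingE _ _ K)//; first by rewrite mulr_sumr.
exact: supported_inMl.
Qed.

Lemma pairing_lin gamma K a f g : supported_in K f -> supported_in K g ->
  pairing gamma (fun x => a * f x + g x) = a * pairing gamma f + pairing gamma g.
Proof.
move=> fK gK; rewrite (@pairingD _ K)//; last exact: supported_inMl.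
by rewrite (@pairingZ _ K).
Qed.

Lemma pairing_ge0 gamma f : (forall x, 0 <= f x) -> 0 <= pairing gamma f.
Proof. by move=> f0; apply: sumr_ge0. Qed.

Lemma le_pairing gamma K f g : supported_in K f -> supported_in K g ->
  (forall x, pts gamma x -> f x <= g x) -> pairing gamma f <= pairing gamma g.
Proof.
move=> fK gK fg; rewrite !(@pairingE _ _ K)// !big_seq; apply: ler_sum => x.
by move=> /pts_inP[gx _]; exact: fg.
Qed.

Lemma ler_norm_pairing gamma K f : supported_in K f ->
  `|pairing gamma f| <= pairing gamma (fun x => `|f x|).
Proof.
move=> fK; rewrite !(@pairingE _ _ K)//; first exact: ler_norm_sum.
by move=> x; rewrite normr_eq0; exact: fK.
Qed.

Lemma eq_pairing (V : nmodType) gamma (f g : E -> V) :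
  (forall x, pts gamma x -> f x = g x) -> pairing gamma f = pairing gamma g.
Proof. by move=> fg; apply: eq_fsbigr => x /set_mem; exact: fg. Qed.

Lemma pairing_cvg gamma K (f_ : nat -> E -> R) f :
  (forall n, supported_in K (f_ n)) -> supported_in K f ->
  (forall x, f_ ^~ x @ \oo --> f x) ->
  (fun n => pairing gamma (f_ n)) @ \oo --> pairing gamma f.
Proof.
move=> f_K fK cf; rewrite (@pairingE _ _ K)//.
under eq_cvg do rewrite (@pairingE _ _ K)//.
by apply: cvg_big => [|x _]; [exact: add_continuous|exact: cf].
Qed.

Lemma testfun_supported f : testfun f -> exists K, supported_in K f.
Proof. by move=> /testfunP[_ [K HK]]; exists K. Qed.

Lemma box_supported a b : exists K, supported_in K (\1_(box a b) : E -> R).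
Proof.
have [K HK] := box_bounded a b; exists K => x; rewrite indicE.
by have [/set_mem/HK//|] := boolP (x \in _); rewrite eqxx.
Qed.

Lemma box_bump_supported a b : exists K,
  (forall n, supported_in K (box_bump a b n)) /\
  supported_in K (\1_(box a b) : E -> R).
Proof.
have [K HK] := box_bounded a b; exists K; split => [n x bx|x].
  by apply: HK; apply: contrapT => /(box_bump_eq0 n)/eqP; exact/negP.
rewrite indicE.
by have [/set_mem/HK//|] := boolP (x \in _); rewrite eqxx.
Qed.

Lemma supported_in_le K K' (V : nmodType) (f : E -> V) :
  K <= K' -> supported_in K f -> supported_in K' f.
Proof. by move=> KK' fK x /fK /le_trans; apply. Qed.

Lemma pairing_conf_add gamma x (V : nmodType) K (f : E -> V) :
  supported_in K f -> ~ pts gamma x ->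
  pairing (conf_add gamma x) f = f x + pairing gamma f.
Proof.
move=> fK ngx; pose K' := Num.max K `|x|.
have fK' : supported_in K' f by apply: supported_in_le fK; rewrite le_max lexx.
rewrite !(pairingE _ fK') -big_fsetU1/=; last by apply/negP => /pts_inP[].
apply: perm_big; apply: uniq_perm; rewrite ?fset_uniq// => y.
rewrite in_fset1U; apply/idP/idP.
  by move=> /pts_inP[[gy|->] yK]; rewrite ?eqxx//; apply/orP; right; exact/pts_inP.
move=> /predU1P[->|/pts_inP[gy yK]]; apply/pts_inP; split => //=.
- by right.
- by rewrite le_max lexx orbT.
- by left.
Qed.

Lemma pairing_conf_rem gamma x (V : nmodType) K (f : E -> V) :
  supported_in K f -> pts gamma x ->
  pairing gamma f = f x + pairing (conf_rem gamma x) f.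
Proof.
move=> fK gx; rewrite -(@pairing_conf_add (conf_rem gamma x) x _ K f)//; last first.
  by move=> /= -[_]; exact.
congr (\sum_(y \in _) _); apply/seteqP; split => y /=.
  by move=> gy; have [->|yx] := eqVneq y x; [right|left; split => //; exact/eqP].
by move=> [[]//|->].
Qed.

End pairing.

Section conf_measurable.
Context (R : realType) (d : nat).
Let E := euclid R d.

(** The arbitrary map [c] lets this serve twice: for the identity on configurations, and for the
    identity from configurations that carry another sigma-algebra. *)
Lemma measurable_box_sums d' (T : measurableType d') (c : T -> conf R d) :
  (forall a b, measurable_fun setT (fun t => pairing (c t) (\1_(box a b) : E -> R))) ->
  forall K (f : E -> R), supported_in K f -> measurable_fun setT f ->
  measurable_fun setT (fun t => pairing (c t) f).
Proof.
move=> mc K f fK mf.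
(* The class contains constants, which have no bounded support. All functions are therefore cut off
   by one box [Q] that contains the support of [f]. *)
pose Q : set E := box (fun=> - (K + 1)) (fun=> K + 1).
have [L LQ] : exists L, supported_in L (\1_Q : E -> R) :=
  box_supported (fun=> - (K + 1)) (fun=> K + 1 : R).
pose V (Z : E -> R) := measurable_fun setT (fun t => pairing (c t) (fun x => Z x * \1_Q x)).
have Vlin a Y Z : V Y -> V Z -> V (fun x => a * Y x + Z x).
  move=> VY VZ; rewrite /V (_ : (fun t => _) = fun t =>
      a * pairing (c t) (fun x => Y x * \1_Q x) + pairing (c t) (fun x => Z x * \1_Q x)).
    by apply: measurable_funD => //; apply: measurable_funM.
  apply/funext => t; rewrite -(@pairing_lin _ _ _ L); [|exact: supported_inMl..].
  by apply: eq_pairing => x _; ring.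
have Vlim (Y : nat -> E -> R) Z : (forall n, V (Y n)) ->
    (forall x, Y ^~ x @ \oo --> Z x) -> V Z.
  move=> VY cY; apply: (measurable_fun_pointwise_cvg VY) => t.
  apply: (@pairing_cvg _ _ _ L); [move=> n; exact: supported_inMl|exact: supported_inMl|].
  by move=> x; apply: cvgM => //; exact: cvg_cst.
pose M : set (E -> R) := [set Y | exists a b, Y = \1_(box a b)].
have Mb Y : M Y -> exists k : R, forall x, `|Y x| <= k.
  move=> [a [b ->]]; exists 1 => x; rewrite indicE.
  by case: (_ \in _); rewrite ?normr1 ?normr0.
have MM Y Z : M Y -> M Z -> mclass M (fun x => Y x * Z x).
  move=> [a [b ->]] [a' [b' ->]]; apply: mclass_base.
  exists (fun i => Num.max (a i) (a' i)), (fun i => Num.min (b i) (b' i)).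
  by rewrite -boxI indicI.
have VM Y : mclass M Y -> V Y.
  elim=> {Y} [_ [a [b ->]]|k|a Y Z _ VY _ VZ|Y Z k _ VY _ cY]; last 2 first.
  - exact: Vlin.
  - exact: Vlim cY.
  - rewrite /V.
    rewrite (_ : (fun x => _) = \1_(box a b `&` Q)); last by rewrite indicI.
    by rewrite /Q boxI.
  - rewrite /V (_ : (fun t => _) = fun t => k * pairing (c t) \1_Q).
      by apply: measurable_funM => //; exact: mc.
    by apply/funext => t; exact: (@pairingZ _ _ _ L).
suff : V f.
  rewrite /V (_ : (fun x => _) = f)//; apply/funext => x; rewrite indicE.
  have [->|fx] := eqVneq (f x) 0; first by rewrite mul0r.
  rewrite mem_set ?mulr1//; apply: norm_box.
  by rewrite (le_lt_trans (fK _ fx))// ltrDl.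
apply: (measurable_fun_ind _ Vlin Vlim mf) => A mA; apply: VM.
apply: (boxes_generate (mclass_sigma_algebra Mb MM)) => // a b.
by apply: mclass_base; exists a, b.
Qed.

Lemma counting_set_pairing (B : set E) K (gamma : conf R d) k :
  (forall x, B x -> `|x| <= K) ->
  (pts gamma `&` B #= `I_k)%card <-> pairing gamma (\1_B : E -> R) = k%:R.
Proof.
move=> BK.
have fin : finite_set (pts gamma `&` B).
  apply: (@sub_finite_set _ _ (pts gamma `&` [set x | `|x| <= K])).
    by move=> x [gx /BK].
  by apply: conf_locally_finite; exact: compact_norm_ball.
have -> : pairing gamma (\1_B : E -> R) = (#|` fset_set (pts gamma `&` B)|)%:R.
  rewrite /pairing -(fsbig_widen (pts gamma `&` B)) => [|x []//|x [/= gx nBx]].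
    transitivity (\sum_(x \in pts gamma `&` B) (1 : R)).
      by apply: eq_fsbigr => x /set_mem[_ Bx]; rewrite indicE mem_set.
    by rewrite fsbig_finite//= big_const_seq count_predT iter_addr_0.
  by rewrite indicE memNset// => Bx; exact: nBx.
split=> [/card_fset_set ->//|].
have /finite_setP[m Am] := fin.
by rewrite (card_fset_set Am) => /eqP; rewrite eqr_nat => /eqP <-.
Qed.

Lemma measurable_pairing K (f : E -> R) : supported_in K f ->
  measurable_fun setT f ->
  measurable_fun setT (fun gamma : conf R d => pairing gamma f).
Proof.
apply: measurable_box_sums => a b; have [L HL] := box_bounded a b.
apply: measurable_fun_gt => r.
rewrite (_ : [set gamma | _] = \bigcup_(k in [set k | r < k%:R])
   [set gamma : conf R d | (pts gamma `&` box a b #= `I_k)%card]).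
  apply: bigcup_measurable => k _; apply: sub_sigma_algebra.
  exists (box a b), k; split => //; first exact: measurable_box.
  exists L; split; first exact: num_real.
  by move=> M LM x /HL /le_trans; apply; exact: ltW.
apply/seteqP; split => gamma /=; last first.
  by move=> [k /= rk /(counting_set_pairing _ _ HL) ->].
have fin : finite_set (pts gamma `&` box a b).
  apply: (@sub_finite_set _ _ (pts gamma `&` [set x | `|x| <= L])).
    by move=> x [gx /HL].
  by apply: conf_locally_finite; exact: compact_norm_ball.
move: fin => /finite_setP[k hk].
have := (counting_set_pairing _ _ HL).1 hk => h; rewrite h => rk.
by exists k.
Qed.

(* The sigma-algebra of the configuration space is generated by the numbers of
   points in open boxes. *)
Lemma conf_boxes_generate (S : set (set (conf R d))) : sigma_algebra setT S ->
  (forall a b, measurable_fun setT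
     (fun gamma : g_sigma_algebraType S => pairing gamma (\1_(box a b) : E -> R))) ->
  measurable `<=` S.
Proof.
move=> sS mS; apply: smallest_sub => // _ [B [k [mB bB ->]]].
have [K HK] : exists K, forall x, B x -> `|x| <= K.
  by case: bB => K [Kr HK]; exists (K + 1) => x Bx; apply: (HK (K + 1)) => //; rewrite ltrDl.
rewrite (_ : [set gamma | _] = [set gamma | pairing gamma (\1_B : E -> R) = k%:R]); last first.
  by apply/seteqP; split => gamma /=; apply (counting_set_pairing gamma k HK).
rewrite -[S](measurable_g_measurableTypeE sS).
have mN : measurable_fun setT (fun gamma : g_sigma_algebraType S => pairing gamma (\1_B : E -> R)).
  apply: (measurable_box_sums mS (K := K)); last exact: measurable_indic.
  move=> x; rewrite indicE; by have [/set_mem/HK//|] := boolP (x \in _); rewrite eqxx.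
by have := mN measurableT _ (measurable_set1 k%:R); rewrite setTI.
Qed.

End conf_measurable.

(** * The Poisson measure and the Mecke formula *)

Notation Rintegrable mu f := (mu.-integrable setT (EFin \o f)).

Section Rintegral_tools.
Context d (T : measurableType d) (R : realType).
Variable mu : {measure set T -> \bar R}.
Implicit Types f g : T -> R.

Lemma RintegralE f : Rintegrable mu f ->
  (\int[mu]_x (f x)%:E)%E = (\int[mu]_x f x)%:E.
Proof. by move=> fi; rewrite /Rintegral fineK//; exact: integrable_fin_num. Qed.

Lemma Rintegrable_measurable f : Rintegrable mu f -> measurable_fun setT f.
Proof. by move=> /measurable_int/measurable_EFinP. Qed.

Lemma Rintegrable_le f g : measurable_fun setT f -> Rintegrable mu g ->
  (forall x, `|f x| <= g x) -> Rintegrable mu f.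
Proof.
move=> mf ig fg; apply: le_integrable ig => //.
  exact/measurable_EFinP.
move=> x _ /=; rewrite lee_fin (le_trans (fg x))//; exact: ler_norm.
Qed.

Lemma RintegrableD f g : Rintegrable mu f -> Rintegrable mu g ->
  Rintegrable mu (fun x => f x + g x).
Proof. by move=> fi gi; exact: (integrableD measurableT fi gi). Qed.

Lemma RintegrableB f g : Rintegrable mu f -> Rintegrable mu g ->
  Rintegrable mu (fun x => f x - g x).
Proof. by move=> fi gi; exact: (integrableB measurableT fi gi). Qed.

Lemma RintegrableZ a f : Rintegrable mu f -> Rintegrable mu (fun x => a * f x).
Proof. by move=> fi; exact: (integrableZl measurableT a fi). Qed.

Lemma Rintegrable_norm f : Rintegrable mu f -> Rintegrable mu (fun x => `|f x|).
Proof. by move=> fi; exact: (integrable_abse fi). Qed.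

Lemma Rintegrable_bounded_mul f g K : measurable_fun setT f ->
  (forall x, `|f x| <= K) -> Rintegrable mu g -> Rintegrable mu (fun x => f x * g x).
Proof.
move=> mf fK ig.
apply: (@Rintegrable_le _ (fun x => K * `|g x|)).
- by apply: measurable_funM => //; exact: Rintegrable_measurable.
- by apply: RintegrableZ; exact: Rintegrable_norm.
- by move=> x; rewrite normrM ler_wpM2r.
Qed.

Lemma Rintegral_dominated_cvg (f_ : nat -> T -> R) f g :
  (forall n, measurable_fun setT (f_ n)) -> Rintegrable mu g ->
  (forall n x, `|f_ n x| <= g x) -> (forall x, f_ ^~ x @ \oo --> f x) ->
  Rintegrable mu f /\ (fun n => \int[mu]_x f_ n x) @ \oo --> \int[mu]_x f x.
Proof.
move=> mf_ ig f_g cf.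
have mf : measurable_fun setT f := measurable_fun_pointwise_cvg mf_ cf.
have fg x : `|f x| <= g x.
  rewrite -(cvg_lim _ (cvg_norm (cf x)))//.
  apply: limr_le; first by apply/cvg_ex; eexists; exact: cvg_norm (cf x).
  exact: nearW.
have fi := Rintegrable_le mf ig fg; split => //.
apply: fine_cvg; rewrite -/(Rintegral mu setT f) -RintegralE//.
apply: (@dominated_cvg _ _ _ mu setT _ (fun n => EFin \o f_ n) (EFin \o f) (EFin \o g)) => //.
- by move=> n; exact/measurable_EFinP.
- by move=> x _; apply: cvg_EFin; [exact: nearW|exact: cf].
- by move=> n x _; rewrite /= lee_fin.
Qed.

Lemma integral_EFin_monotone_cvg (f_ : nat -> T -> R) f :
  (forall n, measurable_fun setT (f_ n)) -> (forall n x, 0 <= f_ n x) ->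
  (forall x, {homo f_ ^~ x : n m / (n <= m)%N >-> n <= m}) ->
  (forall x, f_ ^~ x @ \oo --> f x) ->
  ((fun n => \int[mu]_x (f_ n x)%:E) @ \oo --> \int[mu]_x (f x)%:E)%E.
Proof.
move=> mf_ f_0 nd cf.
have := @cvg_monotone_convergence _ _ _ mu setT measurableT (fun n x => (f_ n x)%:E).
rewrite (_ : (\int[mu]_x (fun x => limn (fun n => (f_ n x)%:E)) x =
  \int[mu]_x (f x)%:E)%E); last first.
  apply: eq_integral => x _; apply/cvg_lim => //.
  by apply: cvg_EFin; [exact: nearW|exact: cf].
apply.
- by move=> n; exact/measurable_EFinP.
- by move=> n x _; rewrite lee_fin.
- by move=> x _ n m nm; rewrite lee_fin; exact: nd.
Qed.

Lemma Rintegral_sum (I : Type) (r : seq I) (F : I -> T -> R) :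
  (forall i, Rintegrable mu (F i)) ->
  Rintegrable mu (fun x => \sum_(i <- r) F i x) /\
  \int[mu]_x (\sum_(i <- r) F i x) = \sum_(i <- r) \int[mu]_x F i x.
Proof.
move=> Fi; elim: r => [|i r [IH1 IH2]].
  rewrite big_nil (_ : (fun x => _) = cst 0); last by apply/funext => x; rewrite big_nil.
  by split; [exact: integrable0|rewrite /Rintegral integral0].
rewrite big_cons -IH2.
rewrite (_ : (fun x => _) = fun x => F i x + \sum_(i <- r) F i x); last first.
  by apply/funext => x; rewrite big_cons.
by split; [exact: RintegrableD|rewrite RintegralD].
Qed.

End Rintegral_tools.

Section expm1_limit.
Context (R : realType).

Lemma expm1_bounds (x : R) : 0 <= x -> x / (1 + x) <= 1 - expR (- x) <= x.
Proof.
move=> x0; have x1 : 0 < 1 + x by rewrite ltr_pwDl.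
apply/andP; split; last by have := expR_ge1Dx (- x); lra.
rewrite (_ : x / (1 + x) = 1 - (1 + x)^-1); last by field; rewrite gt_eqF.
by rewrite lerD2l lerN2 expRN lef_pV2 ?posrE ?expR_gt0// expR_ge1Dx.
Qed.

(** A difference quotient of [1 - e^(-s)] at [0] with steps [1 / n.+1], whose slope [u n] may itself
    vary. It differentiates the exponential on both sides of the Laplace formula, where the slope is
    a sum over [gamma] or a convergent sequence of integrals. *)
Lemma cvg_expm1 (u : nat -> R) (l : R) : (forall n, 0 <= u n) -> u @ \oo --> l ->
  (fun n => n.+1%:R * (1 - expR (- (u n / n.+1%:R)))) @ \oo --> l.
Proof.
move=> u0 ul.
apply: (@squeeze_cvgr _ _ _ _ (fun n => u n / (1 + u n * n.+1%:R^-1)) u) => //.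
- apply: nearW => n.
  have un0 : 0 <= u n / n.+1%:R by rewrite divr_ge0.
  have /andP[h1 h2] := expm1_bounds un0.
  have n0 : 0 < n.+1%:R :> R by [].
  apply/andP; split.
    apply: le_trans (ler_wpM2l (ltW n0) h1).
    by rewrite mulrA [n.+1%:R * _]mulrC divfK// gt_eqF.
  apply: le_trans (ler_wpM2l (ltW n0) h2) _.
  by rewrite [leLHS]mulrC divfK// gt_eqF.
- rewrite [X in _ --> X](_ : l = l / (1 + l * 0)); last by rewrite mulr0 addr0 divr1.
  apply: cvgM => //; apply: cvgV; first by rewrite mulr0 addr0 oner_neq0.
  apply: cvgD; first exact: cvg_cst.
  by apply: cvgM => //; exact: cvg_harmonic.
Qed.

End expm1_limit.

Section campbell.
Context (R : realType) (d : nat).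
Let E := euclid R d.
Variables (sigma : {sigma_finite_measure set E -> \bar R}).
Hypothesis sigma_radon : radon sigma.
Variable P : probability (conf R d) R.
Hypothesis P_poisson : poisson sigma P.
Implicit Types (f v psi : E -> R).

Lemma measurable_norm_ball K : measurable [set x : E | `|x| <= K].
Proof.
rewrite -[X in measurable X]setCK; apply: measurableC.
apply: open_measurable_euclid; apply: closed_openC.
by apply: compact_closed; [exact: norm_hausdorff|exact: compact_norm_ball].
Qed.

Lemma supported_integrable K M f : measurable_fun setT f ->
  supported_in K f -> (forall x, `|f x| <= M) -> Rintegrable sigma f.
Proof.
move=> mf fK fM.
pose B := [set x : E | `|x| <= K].
have mB : measurable B := measurable_norm_ball K.
apply: (@Rintegrable_le _ _ _ _ _ (fun x => M * \1_B x)) => //.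
  apply: RintegrableZ; apply/integrableP; split.
    by apply/measurable_EFinP; exact: measurable_indic.
  under eq_integral => x _ do rewrite /= ger0_norm//.
  rewrite integral_indic// setIT; apply: sigma_radon; exact: compact_norm_ball.
move=> x; rewrite indicE; have [->|fx] := eqVneq (f x) 0.
  rewrite normr0 mulr_ge0//; exact: le_trans (normr_ge0 _) (fM x).
by rewrite mem_set ?mulr1//; exact: fK.
Qed.

Lemma testfun_integrable f : testfun f -> Rintegrable sigma f.
Proof.
move=> tf; have [K fK] := testfun_supported tf; have [M fM] := testfun_bounded tf.
by apply: supported_integrable fK fM; exact: testfun_measurable.
Qed.

Lemma measurable_pairing_testfun f : testfun f ->
  measurable_fun setT (fun gamma : conf R d => pairing gamma f).
Proof.
move=> tf; have [K fK] := testfun_supported tf.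
by apply: measurable_pairing fK _; exact: testfun_measurable.
Qed.

Lemma measurable_exp_pairing psi : testfun psi ->
  measurable_fun setT (fun gamma : conf R d => expR (- pairing gamma psi)).
Proof.
move=> tpsi; apply: measurableT_comp => //; apply: measurableT_comp => //.
exact: measurable_pairing_testfun.
Qed.

Lemma exp_pairing_le1 (gamma : conf R d) psi : (forall x, 0 <= psi x) ->
  `|expR (- pairing gamma psi)| <= 1.
Proof.
by move=> p0; rewrite ger0_norm ?expR_ge0// expR_le1 oppr_le0 pairing_ge0.
Qed.

Lemma probability_integrable_bounded (X : conf R d -> R) M :
  measurable_fun setT X -> (forall g, `|X g| <= M) -> Rintegrable P X.
Proof.
move=> mX XM; apply: (@Rintegrable_le _ _ _ _ _ (fun=> M)) => //.
by apply: finite_measure_integrable_cst.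
Qed.

Lemma exp_pairing_integrable psi : testfun psi -> (forall x, 0 <= psi x) ->
  Rintegrable P (fun gamma => expR (- pairing gamma psi)).
Proof.
move=> tpsi p0; apply: (@probability_integrable_bounded _ 1).
  exact: measurable_exp_pairing.
by move=> gamma; exact: exp_pairing_le1.
Qed.

Lemma laplace psi : testfun psi -> (forall x, 0 <= psi x) ->
  \int[P]_gamma expR (- pairing gamma psi)
  = expR (\int[sigma]_x (expR (- psi x) - 1)).
Proof.
move=> tpsi p0; have [K pK] := testfun_supported tpsi.
have tN : testfun (fun x => - psi x).
  rewrite (_ : (fun x => _) = fun x => -1 * psi x); first exact: testfunZ.
  by apply/funext => x; rewrite mulN1r.
transitivity (fine (\int[P]_gamma (expR (pairing gamma (fun x => - psi x)))%:E)%E).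
  2: by rewrite (P_poisson tN).
congr fine.
apply: eq_integral => gamma _; congr (expR _)%:E.
rewrite -mulN1r -(pairingZ _ _ pK).
by apply: eq_pairing => x _; rewrite mulN1r.
Qed.

Lemma exp_sub1_integrable psi : testfun psi -> (forall x, 0 <= psi x) ->
  Rintegrable sigma (fun x => expR (- psi x) - 1).
Proof.
move=> tpsi p0; apply: (Rintegrable_le _ (testfun_integrable tpsi)).
  apply: measurable_funB => //; apply: measurableT_comp => //.
  by apply: measurableT_comp => //; exact: testfun_measurable.
move=> x; have := expm1_bounds (p0 x) => /andP[h1 h2].
have h3 : 0 <= psi x / (1 + psi x) by rewrite divr_ge0// addr_ge0.
by rewrite ler_norml; apply/andP; split; lra.
Qed.

(* The derivative of the Laplace functional at [psi] in the direction [v]. *)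
Lemma campbell psi v : testfun psi -> (forall x, 0 <= psi x) ->
  testfun v -> (forall x, 0 <= v x) ->
  Rintegrable P (fun gamma => pairing gamma v * expR (- pairing gamma psi)) /\
  \int[P]_gamma (pairing gamma v * expR (- pairing gamma psi)) =
  (\int[sigma]_x (v x * expR (- psi x))) *
  \int[P]_gamma expR (- pairing gamma psi).
Proof.
move=> tp p0 tv v0.
have [K0 pK0] := testfun_supported tp; have [K1 vK1] := testfun_supported tv.
pose K := Num.max K0 K1.
have pK : supported_in K psi by apply: supported_in_le pK0; rewrite le_max lexx.
have vK : supported_in K v by apply: supported_in_le vK1; rewrite le_max lexx orbT.
(* Steps in the positive direction only, so that the argument stays nonnegative and [laplace]
   applies. *)
pose psi_ n x := n.+1%:R^-1 * v x + psi x.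
have tp_ n : testfun (psi_ n) by exact: testfun_lin.
have p_0 n x : 0 <= psi_ n x by rewrite addr_ge0// mulr_ge0// invr_ge0.
pose L := \int[P]_gamma expR (- pairing gamma psi).
pose D := \int[sigma]_x (v x * expR (- psi x)).
pose q n x := n.+1%:R * (1 - expR (- (v x / n.+1%:R))).
have qE n x : n.+1%:R * (expR (- psi x) - expR (- psi_ n x)) = q n x * expR (- psi x).
  by rewrite /q /psi_ opprD expRD mulrC [v x / _]mulrC; ring.
have q0v n x : 0 <= q n x <= v x.
  have n0 : 0 < n.+1%:R :> R by [].
  have vn0 : 0 <= v x / n.+1%:R by rewrite divr_ge0.
  have /andP[h1 h2] := expm1_bounds vn0; apply/andP; split.
    by rewrite mulr_ge0// (le_trans _ h1)// divr_ge0// addr_ge0.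
  apply: le_trans (ler_wpM2l (ltW n0) h2) _.
  by rewrite [leLHS]mulrC divfK// gt_eqF.
(* Here [u n / n.+1] is the difference of the exponents of the Laplace functional at [psi] and at
   [psi_ n]. *)
pose u n := n.+1%:R * (\int[sigma]_x (expR (- psi x) - 1) - \int[sigma]_x (expR (- psi_ n x) - 1)).
have uE n : u n = \int[sigma]_x (q n x * expR (- psi x)).
  rewrite /u -RintegralB//; [|exact: exp_sub1_integrable..].
  rewrite -RintegralZl//; last by apply: RintegrableB; exact: exp_sub1_integrable.
  by apply: eq_Rintegral => x _; rewrite -qE; ring.
have u0 n : 0 <= u n.
  rewrite uE; apply: Rintegral_ge0 => x _; rewrite mulr_ge0 ?expR_ge0//.
  by case/andP: (q0v n x).
have mexp : measurable_fun setT (fun x => expR (- psi x)).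
  apply: measurableT_comp => //; apply: measurableT_comp => //.
  exact: testfun_measurable.
have uD : u @ \oo --> D.
  rewrite (_ : u = fun n => \int[sigma]_x (q n x * expR (- psi x))); last exact/funext.
  apply: (proj2 (@Rintegral_dominated_cvg _ _ _ sigma
    (fun n x => q n x * expR (- psi x)) _ v _ _ _ _)).
  - move=> n; apply: measurable_funM => //; apply: measurable_funM => //.
    apply: measurable_funB => //; apply: measurableT_comp => //.
    apply: measurableT_comp => //; apply: measurable_funM => //.
    exact: testfun_measurable.
  - exact: testfun_integrable.
  - move=> n x; have /andP[h1 h2] := q0v n x.
    rewrite normrM !ger0_norm ?expR_ge0//.
    rewrite -[leRHS]mulr1 ler_pM ?expR_ge0//.
    by rewrite expR_le1 oppr_le0.
  - move=> x; apply: cvgM; last exact: cvg_cst.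
    by apply: cvg_expm1 => //; exact: cvg_cst.
pose X n gamma := n.+1%:R * (1 - expR (- (pairing gamma v / n.+1%:R)))
  * expR (- pairing gamma psi).
have XE n gamma : X n gamma = n.+1%:R * (expR (- pairing gamma psi)
    - expR (- pairing gamma (psi_ n))).
  rewrite /psi_ (pairing_lin _ _ vK pK) opprD expRD /X.
  by rewrite [pairing gamma v / _]mulrC; ring.
have EX n : \int[P]_gamma X n gamma = L * (n.+1%:R * (1 - expR (- (u n / n.+1%:R)))).
  under eq_Rintegral do rewrite XE.
  rewrite RintegralZl//; last by apply: RintegrableB; exact: exp_pairing_integrable.
  rewrite RintegralB//; [|exact: exp_pairing_integrable..].
  rewrite (_ : u n / n.+1%:R = \int[sigma]_x (expR (- psi x) - 1) -
      \int[sigma]_x (expR (- psi_ n x) - 1)); last by rewrite /u mulrC mulKf.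
  rewrite opprB expRD.
  rewrite -laplace//; rewrite expRN -laplace// -/L.
  have L0 : L != 0 by rewrite /L laplace// gt_eqF// expR_gt0.
  by field.
have EXcvg : (fun n => \int[P]_gamma X n gamma) @ \oo --> L * D.
  rewrite (_ : (fun n => _) =
    fun n => L * (n.+1%:R * (1 - expR (- (u n / n.+1%:R))))); last exact/funext.
  by apply: cvgM; [exact: cvg_cst|exact: cvg_expm1].
pose Y gamma := pairing gamma v * expR (- pairing gamma psi).
have mX n : measurable_fun setT (X n).
  rewrite (_ : X n = fun gamma => n.+1%:R * (expR (- pairing gamma psi)
    - expR (- pairing gamma (psi_ n)))); last exact/funext.
  by apply: measurable_funM => //; apply: measurable_funB; exact: measurable_exp_pairing.
have mY : measurable_fun setT Y.
  by apply: measurable_funM; [exact: measurable_pairing_testfun|exact: measurable_exp_pairing].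
have XY n gamma : 0 <= X n gamma <= Y gamma.
  have n0 : 0 < n.+1%:R :> R by [].
  have N0 : 0 <= pairing gamma v / n.+1%:R by rewrite divr_ge0// pairing_ge0.
  have /andP[h1 h2] := expm1_bounds N0; apply/andP; split.
    rewrite mulr_ge0 ?expR_ge0// mulr_ge0// (le_trans _ h1)// divr_ge0// addr_ge0//.
  apply: ler_wpM2r; first exact: expR_ge0.
  apply: le_trans (ler_wpM2l (ltW n0) h2) _.
  by rewrite [leLHS]mulrC divfK// gt_eqF.
have cX gamma : X ^~ gamma @ \oo --> Y gamma.
  apply: cvgM; last exact: cvg_cst.
  by apply: cvg_expm1; [move=> n; exact: pairing_ge0|exact: cvg_cst].
have iX n : Rintegrable P (X n).
  rewrite (_ : X n = fun gamma => n.+1%:R * (expR (- pairing gamma psi)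
    - expR (- pairing gamma (psi_ n)))); last exact/funext.
  by apply: RintegrableZ; apply: RintegrableB; exact: exp_pairing_integrable.
(* The integrals of the quotients [X n] converge, so Fatou's lemma gives integrability of their
   limit [Y]. Only then can [Y] serve as dominating function for the same sequence. *)
have iY : Rintegrable P Y.
  apply/integrableP; split; first exact/measurable_EFinP.
  have -> : (\int[P]_gamma `|(EFin \o Y) gamma| =
      \int[P]_gamma limn_einf (fun n => (X n gamma)%:E))%E.
    apply: eq_integral => gamma _.
    have /andP[h1 h2] := XY 0 gamma.
    have cE : (X n gamma)%:E @[n --> \oo] --> (Y gamma)%:E.
      by apply: cvg_EFin; [exact: nearW|exact: cX].
    rewrite is_cvg_limn_einfE; last by apply/cvg_ex; eexists; exact: cE.
    by rewrite (cvg_lim _ cE)//= ger0_norm// (le_trans h1).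
  apply: le_lt_trans (fatou _ _ _ _) _ => //.
  - by move=> n; exact/measurable_EFinP.
  - by move=> n gamma _; rewrite lee_fin; case/andP: (XY n gamma).
  - have cE : (fun n => \int[P]_gamma (X n gamma)%:E)%E @ \oo --> (L * D)%:E.
      under eq_cvg do rewrite RintegralE//.
      by apply: cvg_EFin; [exact: nearW|exact: EXcvg].
    rewrite is_cvg_limn_einfE; last by apply/cvg_ex; eexists; exact: cE.
    by rewrite (cvg_lim _ cE)// ltry.
split => //; rewrite [RHS]mulrC -/L -/D.
apply: (cvg_unique _ _ EXcvg) => //.
apply: (proj2 (Rintegral_dominated_cvg mX iY _ cX)).
by move=> n gamma; case/andP: (XY n gamma) => h1 h2; rewrite ger0_norm.
Qed.

End campbell.

Section product_Rintegral.
Context d1 d2 (T1 : measurableType d1) (T2 : measurableType d2) (R : realType).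
Variables (m1 : {sigma_finite_measure set T1 -> \bar R}).
Variables (m2 : {sigma_finite_measure set T2 -> \bar R}).

Lemma measurable_fun_fst (f : T1 -> R) : measurable_fun setT f ->
  measurable_fun setT (fun p : T1 * T2 => f p.1).
Proof. by move=> mf; exact: measurableT_comp mf measurable_fst. Qed.

Lemma measurable_fun_snd (f : T2 -> R) : measurable_fun setT f ->
  measurable_fun setT (fun p : T1 * T2 => f p.2).
Proof. by move=> mf; exact: measurableT_comp mf measurable_snd. Qed.

Lemma Rintegral_prod (f : T1 -> R) (g : T2 -> R) :
  Rintegrable m1 f -> Rintegrable m2 g ->
  Rintegrable (m1 \x m2)%E (fun p => f p.1 * g p.2) /\
  \int[(m1 \x m2)%E]_p (f p.1 * g p.2) = (\int[m1]_x f x) * (\int[m2]_y g y).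
Proof.
move=> fi gi.
have mf := Rintegrable_measurable fi; have mg := Rintegrable_measurable gi.
have mfg : measurable_fun setT (fun p : T1 * T2 => f p.1 * g p.2).
  by apply: measurable_funM; [exact: measurable_fun_fst|exact: measurable_fun_snd].
have mfgE : measurable_fun setT (EFin \o (fun p : T1 * T2 => f p.1 * g p.2)).
  exact/measurable_EFinP.
have inner x : (\int[m2]_y (f x * g y)%:E)%E = (f x * \int[m2]_y g y)%:E.
  by rewrite -RintegralZl// -RintegralE//; exact: RintegrableZ.
have ifg : Rintegrable (m1 \x m2)%E (fun p => f p.1 * g p.2).
  apply/integrable12ltyP => //=.
  under eq_integral => x _.
    under eq_integral => y _ do rewrite /= normrM.
    rewrite RintegralE; last by apply: RintegrableZ; exact: Rintegrable_norm.
    rewrite RintegralZl//; last exact: Rintegrable_norm.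
    over.
  rewrite /= RintegralE ?ltry//.
  under [X in Rintegrable _ X]eq_fun do rewrite mulrC.
  by apply: RintegrableZ; exact: Rintegrable_norm.
split => //; rewrite /Rintegral -integral12_prod_meas1//.
rewrite (_ : fubini_F _ _ = fun x => (f x * \int[m2]_y g y)%:E); last first.
  by apply/funext => x; rewrite /fubini_F/= inner.
rewrite -/(Rintegral m1 setT (fun x => f x * \int[m2]_y g y)) RintegralZr//.
Qed.

End product_Rintegral.

Section mecke.
Context (R : realType) (d : nat).
Let E := euclid R d.
Local Notation CE := (conf R d * E)%type.

(** The weight [w], a test function in what follows, makes the sum finite, so that [H] may run
    through all measurable functions, constants included, with no condition on its support. *)
Definition mecke_sum (w : E -> R) (H : CE -> R) (gamma : conf R d) : R :=
  pairing gamma (fun x => H (conf_rem gamma x, x) * w x).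

Definition exp_class : set (CE -> R) := [set Y | exists psi u : E -> R,
  [/\ testfun psi, testfun u, forall x, 0 <= psi x, forall x, 0 <= u x &
      Y = fun p => expR (- pairing p.1 psi) * expR (- u p.2)]].

Lemma exp_class_bounded Y : exp_class Y -> exists K, forall p, `|Y p| <= K.
Proof.
move=> [psi [u [_ _ p0 u0 ->]]]; exists 1 => p.
rewrite normrM -[leRHS]mulr1 ler_pM//; first exact: exp_pairing_le1.
by rewrite ger0_norm ?expR_ge0// expR_le1 oppr_le0.
Qed.

Lemma exp_class_mul Y Z : exp_class Y -> exp_class Z ->
  mclass exp_class (fun p => Y p * Z p).
Proof.
move=> [psi [u [tp tu p0 u0 ->]]] [psi' [u' [tp' tu' p0' u0' ->]]].
apply: mclass_base; exists (fun x => psi x + psi' x), (fun x => u x + u' x).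
split; [exact: testfunD|exact: testfunD|by move=> x; rewrite addr_ge0|
  by move=> x; rewrite addr_ge0|].
have [K0 pK0] := testfun_supported tp; have [K1 pK1] := testfun_supported tp'.
apply/funext => p; rewrite (pairingD _ (K := Num.max K0 K1)).
- by rewrite !opprD !expRD; ring.
- by apply: supported_in_le pK0; rewrite le_max lexx.
- by apply: supported_in_le pK1; rewrite le_max lexx orbT.
Qed.

Let S : set (set CE) := [set A | mclass exp_class \1_A].

Let sS : sigma_algebra setT S.
Proof. by apply: mclass_sigma_algebra; [exact: exp_class_bounded|exact: exp_class_mul]. Qed.

Lemma sigma_algebra_preimage (T U : Type) (f : U -> T) (G : set (set U)) :
  sigma_algebra setT G -> sigma_algebra setT [set A : set T | G (f @^-1` A)].
Proof.
move=> [G0 GC GU]; split => /=; first by rewrite preimage_set0.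
  by move=> A GA; rewrite setTD -preimage_setC -setTD; exact: GC.
by move=> F GF; rewrite preimage_bigcup; exact: GU.
Qed.

Let testfun0' : testfun ((fun=> 0) : E -> R) := @testfun0 R d.

Let exp_class_snd (B : set E) : measurable B -> S (snd @^-1` B).
Proof.
move: B; apply: (@boxes_generate R d [set B | S (snd @^-1` B)]).
  exact: sigma_algebra_preimage.
move=> a b; rewrite /S /=.
rewrite (_ : \1_(_) = fun p : CE => 1 - (fun p : CE => 1 - \1_(box a b) p.2) p); last first.
  by apply/funext => p; rewrite opprB addrC subrK !indicE.
apply: mclassB; first exact: mclass_cst.
(* With [b] the bump, [e^(-k b)] tends to [1] off the box and to [0] on it: it is the complement of
   the box that is approximated. *)
apply: (@mclass_lim _ _ _ (fun k p => expR (- pairing p.1 (fun=> 0)) *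
  expR (- (k.+1%:R * box_bump a b 0 p.2))) _ 1).
- move=> k; apply: mclass_base; exists (fun=> 0), (fun x => k.+1%:R * box_bump a b 0 x).
  split => //; first by apply: testfunZ; exact: testfun_box_bump.
  by move=> x; rewrite mulr_ge0//; case/andP: (box_bump_ge0_le1 a b 0 x).
- move=> k p; rewrite normrM -[leRHS]mulr1 ler_pM//; first exact: exp_pairing_le1.
  rewrite ger0_norm ?expR_ge0// expR_le1 oppr_le0 mulr_ge0//.
  by case/andP: (box_bump_ge0_le1 a b 0 p.2).
- move=> p; rewrite /pairing.
  under eq_cvg do rewrite fsbig1// oppr0 expR0 mul1r.
  have [pab|pab] := pselect (box a b p.2); last first.
    rewrite indicE memNset// subr0; apply: cvg_near_cst; apply: nearW => k.
    by rewrite (box_bump_eq0 0 pab) mulr0 oppr0 expR0.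
  rewrite indicE mem_set// subrr.
  have b0 := box_bump_gt0 0 pab.
  apply: (@squeeze_cvgr _ _ _ _ (cst 0) (fun k => (1 + k.+1%:R * box_bump a b 0 p.2)^-1)).
  + apply: nearW => k; rewrite /cst/= expR_ge0/= expRN.
    have k0 : 0 <= k.+1%:R * box_bump a b 0 p.2 by rewrite mulr_ge0// ltW.
    by rewrite lef_pV2 ?posrE ?expR_gt0 ?expR_ge1Dx// ltr_pwDl.
  + exact: cvg_cst.
  + apply: (@squeeze_cvgr _ _ _ _ (cst 0) (fun k => (k.+1%:R)^-1 * (box_bump a b 0 p.2)^-1)).
    * apply: nearW => k.
      have k0 : 0 < k.+1%:R :> R by [].
      have kb : 0 < k.+1%:R * box_bump a b 0 p.2 by rewrite mulr_gt0.
      rewrite /cst/= invr_ge0 addr_ge0 ?(ltW kb)//= -invfM.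
      by rewrite lef_pV2 ?posrE// ?addr_gt0// lerDr.
    * exact: cvg_cst.
    * rewrite -[X in _ --> X](mul0r (box_bump a b 0 p.2)^-1).
      apply: cvgM; last exact: cvg_cst.
      exact: cvg_harmonic.
Qed.

Let exp_class_fst (A : set (conf R d)) : measurable A -> S (fst @^-1` A).
Proof.
move: A; apply: (@conf_boxes_generate R d [set A | S (fst @^-1` A)]).
  exact: sigma_algebra_preimage.
move=> a b; apply: measurable_fun_gt => r; apply: sub_sigma_algebra => /=.
(* This is [e^(-N)] with [N] the number of points in the box; [mclass_gt] then yields the sets
   [N > r]. *)
have mN : mclass exp_class (fun p : CE => expR (- pairing p.1 \1_(box a b))).
  apply: (@mclass_lim _ _ _ (fun n p =>
    expR (- pairing p.1 (box_bump a b n)) * expR (- (fun=> 0) p.2)) _ 1).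
  - move=> n; apply: mclass_base; exists (box_bump a b n), (fun=> 0).
    by split => //; [exact: testfun_box_bump|move=> x; case/andP: (box_bump_ge0_le1 a b n x)].
  - move=> n p; rewrite oppr0 expR0 mulr1; apply: exp_pairing_le1 => x.
    by case/andP: (box_bump_ge0_le1 a b n x).
  - move=> p; under eq_cvg do rewrite oppr0 expR0 mulr1.
    have [K [bK iK]] := box_bump_supported a b.
    apply: continuous_cvg; first exact: continuous_expR.
    apply: cvgN; apply: pairing_cvg iK _ => // x; exact: box_bump_cvg.
rewrite /S/=.
rewrite (_ : fst @^-1` _ = [set p : CE | - expR (- r) < -1 * expR (- pairing p.1 \1_(box a b))]).
  by apply: mclass_gt; [exact: exp_class_bounded|exact: exp_class_mul|exact: mclassZ].
by apply/seteqP; split => p /=; rewrite mulN1r ltrN2 ltr_expR ltrN2.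
Qed.

Lemma exp_class_generates (A : set CE) : measurable A -> mclass exp_class \1_A.
Proof.
have [S0 SC SU] := sS.
move: A; rewrite measurable_prod_measurableType; apply: smallest_sub => //.
move=> _ [A mA [B mB <-]].
rewrite /= (_ : A `*` B = fst @^-1` A `&` snd @^-1` B)// indicI.
by apply: mclassM; [exact: exp_class_bounded|exact: exp_class_mul|
  exact: exp_class_fst|exact: exp_class_snd].
Qed.

Variable w : E -> R.
Hypothesis w_testfun : testfun w.

Lemma mecke_sum_lin a (H G : CE -> R) gamma :
  mecke_sum w (fun p => a * H p + G p) gamma =
  a * mecke_sum w H gamma + mecke_sum w G gamma.
Proof.
have [K wK] := testfun_supported w_testfun.
rewrite /mecke_sum -(@pairing_lin _ _ _ K); [|exact: supported_inMl..].
by apply: eq_pairing => x _; ring.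
Qed.

Lemma mecke_sum_cvg (H_ : nat -> CE -> R) (H : CE -> R) gamma :
  (forall p, H_ ^~ p @ \oo --> H p) ->
  (fun n => mecke_sum w (H_ n) gamma) @ \oo --> mecke_sum w H gamma.
Proof.
move=> cH; have [K wK] := testfun_supported w_testfun.
apply: (@pairing_cvg _ _ _ K); [move=> n; exact: supported_inMl|exact: supported_inMl|].
by move=> x; apply: cvgM; [exact: cH|exact: cvg_cst].
Qed.

(** For [x] in [gamma], removing [x] multiplies [e^(-<gamma, psi>)] by [e^(psi x)]. What remains is
    the sum over [gamma] of the test function [e^(psi - u) w], a case for [campbell]. *)
Lemma mecke_sum_exp psi u gamma : testfun psi ->
  mecke_sum w (fun p => expR (- pairing p.1 psi) * expR (- u p.2)) gamma =
  pairing gamma (fun x => expR (psi x + -1 * u x) * w x) * expR (- pairing gamma psi).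
Proof.
move=> tp; have [K wK] := testfun_supported w_testfun.
have [L pL] := testfun_supported tp.
rewrite mulrC -(@pairingZ _ _ _ K); last exact: supported_inMl.
apply: eq_pairing => x gx /=; rewrite (pairing_conf_rem pL gx) opprD !expRD mulN1r.
have : expR (- psi x) * expR (psi x) = 1 by rewrite -expRD addNr expR0.
set A := expR (- psi x); set B := expR (psi x); set C := expR _; set D := expR _.
by move=> AB; transitivity (C * D * w x * (A * B)); [rewrite AB|]; ring.
Qed.

Lemma testfun_exp_mul (psi u : E -> R) : testfun psi -> testfun u ->
  testfun (fun x => expR (psi x + -1 * u x) * w x).
Proof.
move=> tp tu; apply: testfunMl => //; apply: smooth_expR.
apply: smoothD; first exact: testfun_smooth.
by apply: testfun_smooth; exact: testfunZ.
Qed.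

Lemma measurable_mecke_sum H : measurable_fun setT H ->
  measurable_fun setT (mecke_sum w H).
Proof.
pose V (H : CE -> R) := measurable_fun setT (mecke_sum w H).
have Vlin a (Y Z : CE -> R) : V Y -> V Z -> V (fun p => a * Y p + Z p).
  move=> VY VZ; rewrite /V (_ : mecke_sum _ _ = fun gamma =>
      a * mecke_sum w Y gamma + mecke_sum w Z gamma).
    by apply: measurable_funD => //; exact: measurable_funM.
  by apply/funext => gamma; rewrite mecke_sum_lin.
have Vlim (Y : nat -> CE -> R) (Z : CE -> R) : (forall n, V (Y n)) ->
    (forall p, Y ^~ p @ \oo --> Z p) -> V Z.
  by move=> VY cY; apply: (measurable_fun_pointwise_cvg VY) => gamma; exact: mecke_sum_cvg.
apply: (measurable_fun_ind _ Vlin Vlim) => A /exp_class_generates.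
elim=> {H} [_ [psi [u [tp tu _ _ ->]]]|c|a Y Z _ VY _ VZ|Y Z k _ VY _ cY].
- rewrite /V (_ : mecke_sum _ _ = fun gamma =>
    pairing gamma (fun x => expR (psi x + -1 * u x) * w x) * expR (- pairing gamma psi)).
    apply: measurable_funM; last exact: measurable_exp_pairing.
    by apply: measurable_pairing_testfun; exact: testfun_exp_mul.
  by apply/funext => gamma; exact: mecke_sum_exp.
- by apply: measurable_pairing_testfun; exact: testfunZ.
- exact: Vlin.
- exact: Vlim cY.
Qed.

End mecke.

Section mecke_formula.
Context (R : realType) (d : nat).
Let E := euclid R d.
Local Notation CE := (conf R d * E)%type.
Variables (sigma : {sigma_finite_measure set E -> \bar R}).
Hypothesis sigma_radon : radon sigma.
Variable P : probability (conf R d) R.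
Hypothesis P_poisson : poisson sigma P.
Variable w : E -> R.
Hypothesis w_testfun : testfun w.
Hypothesis w_ge0 : forall x, 0 <= w x.
Implicit Types H G : CE -> R.

Let PS : {measure set CE -> \bar R} := (P \x sigma)%E.

Let mecke_spec H := [/\ Rintegrable P (mecke_sum w H),
  Rintegrable PS (fun p => H p * w p.2) &
  \int[P]_gamma mecke_sum w H gamma = \int[PS]_p (H p * w p.2)].

Let mecke_spec_lin a H G : mecke_spec H -> mecke_spec G ->
  mecke_spec (fun p => a * H p + G p).
Proof.
move=> [h1 h2 h3] [g1 g2 g3]; split.
- rewrite (_ : mecke_sum _ _ = fun gamma => a * mecke_sum w H gamma + mecke_sum w G gamma).
    by apply: RintegrableD => //; exact: RintegrableZ.
  by apply/funext => gamma; exact: mecke_sum_lin.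
- rewrite (_ : (fun p => _) = fun p => a * (H p * w p.2) + G p * w p.2).
    by apply: RintegrableD => //; exact: RintegrableZ.
  by apply/funext => p; ring.
- under eq_Rintegral do rewrite mecke_sum_lin//.
  under [RHS]eq_Rintegral do rewrite mulrDl -mulrA.
  rewrite RintegralD//; last exact: RintegrableZ.
  rewrite RintegralZl// h3 g3 RintegralD//; last exact: RintegrableZ.
  by rewrite RintegralZl.
Qed.

Let mecke_spec_exp H : exp_class H -> mecke_spec H.
Proof.
move=> [psi [u [tp tu p0 u0 ->]]].
have tv := testfun_exp_mul w_testfun tp tu.
have v0 x : 0 <= expR (psi x + -1 * u x) * w x by rewrite mulr_ge0// expR_ge0.
have [c1 c2] := campbell sigma_radon P_poisson tp p0 tv v0.
have tg : testfun (fun x => expR (- u x) * w x).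
  apply: testfunMl => //; rewrite (_ : (fun x => _) = fun x => expR (-1 * u x)).
    by apply: smooth_expR; apply: testfun_smooth; exact: testfunZ.
  by apply/funext => x; rewrite mulN1r.
have [r1 r2] := Rintegral_prod (exp_pairing_integrable P tp p0)
  (testfun_integrable sigma_radon tg).
have eM : mecke_sum w (fun p => expR (- pairing p.1 psi) * expR (- u p.2)) =
    fun gamma => pairing gamma (fun x => expR (psi x + -1 * u x) * w x)
      * expR (- pairing gamma psi).
  by apply/funext => gamma; exact: mecke_sum_exp.
have eP : (fun p : CE => expR (- pairing p.1 psi) * expR (- u p.2) * w p.2) =
    fun p => expR (- pairing p.1 psi) * (expR (- u p.2) * w p.2).
  by apply/funext => p; rewrite mulrA.
split; [by rewrite eM|by rewrite eP|].
rewrite eM c2; transitivity (\int[PS]_p (expR (- pairing p.1 psi) * (expR (- u p.2) * w p.2))).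
  2: by apply: eq_Rintegral => p _; rewrite mulrA.
rewrite r2 mulrC; congr (_ * _); apply: eq_Rintegral => x _.
rewrite expRD mulN1r.
have : expR (- psi x) * expR (psi x) = 1 by rewrite -expRD addNr expR0.
set A := expR (- psi x); set B := expR (psi x) => AB.
by transitivity (expR (- u x) * w x * (A * B)); [ring|rewrite AB mulr1].
Qed.

Let mecke_spec_cst c : mecke_spec (fun=> c).
Proof.
have s1 : mecke_spec (fun=> 1).
  apply: mecke_spec_exp; exists (fun=> 0), (fun=> 0).
  split => //; [exact: testfun0|exact: testfun0|].
  by apply/funext => p; rewrite /pairing fsbig1// oppr0 expR0 mulr1.
rewrite (_ : (fun=> c) = fun=> (c - 1) * 1 + 1); first exact: mecke_spec_lin.
by apply/funext => p; ring.
Qed.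

Lemma ler_mecke_sum H k gamma : (forall p, `|H p| <= k) ->
  `|mecke_sum w H gamma| <= k * pairing gamma w.
Proof.
move=> Hk; have [K wK] := testfun_supported w_testfun.
rewrite /mecke_sum; apply: le_trans.
  apply: (@ler_norm_pairing _ _ gamma K); exact: supported_inMl.
rewrite -(pairingZ _ _ wK); apply: (@le_pairing _ _ _ K).
- by move=> x; rewrite normr_eq0 mulf_eq0 negb_or => /andP[_ /wK].
- exact: supported_inMl.
- by move=> x _; rewrite normrM (ger0_norm (w_ge0 x)) ler_wpM2r.
Qed.

Let mecke_spec_mclass H : mclass (@exp_class R d) H -> mecke_spec H.
Proof.
elim=> {H} [H|c|a Y Z _ VY _ VZ|Y Z k _ VY Yk cY].
- exact: mecke_spec_exp.
- exact: mecke_spec_cst.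
- exact: mecke_spec_lin.
(* The instance for the constant [k] provides the dominating functions [k <gamma, w>] and [k w] of
   the two sides. *)
- have [i1 i2 _] := mecke_spec_cst k.
  have [|n gamma|gamma|d1 d2] := @Rintegral_dominated_cvg _ _ _ P
    (fun n => mecke_sum w (Y n)) (mecke_sum w Z) _ _ i1.
  + by move=> n; have [i _ _] := VY n; exact: Rintegrable_measurable i.
  + apply: le_trans (ler_mecke_sum gamma (Yk n)) _.
    have [K wK] := testfun_supported w_testfun.
    by rewrite -(pairingZ _ _ wK).
  + exact: mecke_sum_cvg.
  have [|n p|p|e1 e2] := @Rintegral_dominated_cvg _ _ _ PS
    (fun n p => Y n p * w p.2) (fun p => Z p * w p.2) _ _ i2.
  + by move=> n; have [_ i _] := VY n; exact: Rintegrable_measurable i.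
  + by rewrite normrM (ger0_norm (w_ge0 _)) ler_wpM2r.
  + by apply: cvgM; [exact: cY|exact: cvg_cst].
  split => //; rewrite -(cvg_lim _ d2)// -(cvg_lim _ e2)//.
  by congr (lim (_ @ \oo)); apply/funext => n; have [_ _ ->] := VY n.
Qed.

(** Stated in [[0, +oo]], so that in the signed case integrability of the sum can be deduced from
    that of [H w]. *)
Lemma mecke_ge0 H : measurable_fun setT H -> (forall p, 0 <= H p) ->
  (\int[P]_gamma (mecke_sum w H gamma)%:E = \int[PS]_p (H p * w p.2)%:E)%E.
Proof.
move=> mH H0.
pose Hn n p := Num.min (H p) n%:R.
have mHn n : measurable_fun setT (Hn n) by exact: measurable_minr.
have Hn0 n p : 0 <= Hn n p by rewrite le_min H0/=.
have VHn n : mecke_spec (Hn n).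
  apply: mecke_spec_mclass; apply: (@mclass_measurable _ _ _ _ _ _ n%:R) => //.
    exact: exp_class_generates.
  by move=> p; rewrite ger0_norm// ge_min lexx orbT.
have ndHn p : {homo Hn ^~ p : n m / (n <= m)%N >-> n <= m}.
  move=> n m nm; rewrite /Hn le_min !ge_min lexx/=; apply/orP; right.
  by rewrite ler_nat.
have cHn p : Hn ^~ p @ \oo --> H p.
  apply: cvg_near_cst; near=> n; rewrite /Hn min_l//.
  by near: n; exact: nbhs_infty_ger.
have [K wK] := testfun_supported w_testfun.
have c1 : ((fun n => \int[P]_gamma (mecke_sum w (Hn n) gamma)%:E) @ \oo -->
    \int[P]_gamma (mecke_sum w H gamma)%:E)%E.
  apply: integral_EFin_monotone_cvg => [n|n gamma|gamma n m nm|gamma].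
  - exact: measurable_mecke_sum.
  - by apply: pairing_ge0 => x; rewrite mulr_ge0.
  - apply: (@le_pairing _ _ _ K); [exact: supported_inMl|exact: supported_inMl|].
    by move=> x _; rewrite ler_wpM2r// ndHn.
  - exact: mecke_sum_cvg.
have c2 : ((fun n => \int[PS]_p (Hn n p * w p.2)%:E) @ \oo -->
    \int[PS]_p (H p * w p.2)%:E)%E.
  apply: integral_EFin_monotone_cvg => [n|n p|p n m nm|p].
  - by have [_ i _] := VHn n; exact: Rintegrable_measurable i.
  - by rewrite mulr_ge0.
  - by rewrite ler_wpM2r// ndHn.
  - by apply: cvgM; [exact: cHn|exact: cvg_cst].
apply: (cvg_unique _ c1) => //.
rewrite (_ : (fun n => _) = (fun n => \int[PS]_p (Hn n p * w p.2)%:E)%E)//.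
by apply/funext => n; have [i1 i2 e] := VHn n; rewrite !RintegralE// e.
Unshelve. all: by end_near. Qed.

Lemma mecke H : measurable_fun setT H -> Rintegrable PS (fun p => H p * w p.2) ->
  Rintegrable P (mecke_sum w H) /\
  \int[P]_gamma mecke_sum w H gamma = \int[PS]_p (H p * w p.2).
Proof.
have pos G : measurable_fun setT G -> (forall p, 0 <= G p) ->
    Rintegrable PS (fun p => G p * w p.2) -> Rintegrable P (mecke_sum w G) /\
    \int[P]_gamma mecke_sum w G gamma = \int[PS]_p (G p * w p.2).
  move=> mG G0 iG; split; last by rewrite /Rintegral mecke_ge0.
  apply/integrableP; split; first by apply/measurable_EFinP; exact: measurable_mecke_sum.
  under eq_integral => gamma _.
    rewrite /= ger0_norm; last by apply: pairing_ge0 => x; rewrite mulr_ge0.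
    over.
  by rewrite mecke_ge0// RintegralE// ltry.
move=> mH iH.
pose Hp p := Num.max (H p) 0; pose Hm p := Num.max (- H p) 0.
have HE : H = fun p => -1 * Hm p + Hp p.
  apply/funext => p; rewrite /Hp /Hm mulN1r; have [h|] := boolP (0 <= H p).
    by rewrite (max_l h) (max_r (y := 0)) ?oppr_le0// oppr0 add0r.
  by rewrite -ltNge => /ltW h; rewrite (max_r h) max_l ?oppr_ge0// opprK addr0.
have nHp p : `|Hp p| <= `|H p|.
  by rewrite ger0_norm ?le_max ?lexx ?orbT// ge_max ler_norm/=.
have nHm p : `|Hm p| <= `|H p|.
  by rewrite ger0_norm ?le_max ?lexx ?orbT// ge_max -normrN ler_norm/=.
have mHp : measurable_fun setT Hp by apply: measurable_maxr.
have mHm : measurable_fun setT Hm.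
  by apply: measurable_maxr => //; exact: measurableT_comp.
have mw : measurable_fun setT (fun p : CE => w p.2).
  by apply: measurable_fun_snd; exact: testfun_measurable.
have iHp : Rintegrable PS (fun p => Hp p * w p.2).
  apply: (Rintegrable_le _ (Rintegrable_norm iH)); first exact: measurable_funM.
  by move=> p; rewrite !normrM ler_wpM2r.
have iHm : Rintegrable PS (fun p => Hm p * w p.2).
  apply: (Rintegrable_le _ (Rintegrable_norm iH)); first exact: measurable_funM.
  by move=> p; rewrite !normrM ler_wpM2r.
have Hp0 p : 0 <= Hp p by rewrite le_max lexx orbT.
have Hm0 p : 0 <= Hm p by rewrite le_max lexx orbT.
have [p1 p2] := pos _ mHp Hp0 iHp; have [m1 m2] := pos _ mHm Hm0 iHm.
by rewrite HE; have [] := mecke_spec_lin (-1) (And3 m1 iHm m2) (And3 p1 iHp p2).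
Qed.

End mecke_formula.

(** * The dual difference operator *)

Section mclass_orthogonal.
Context d (T : measurableType d) (R : realType).
Variables (mu : {measure set T -> \bar R}) (M : set (T -> R)).
Hypothesis M1 : M (fun=> 1).
Hypothesis M_measurable : forall Y, M Y -> measurable_fun setT Y.
Hypothesis M_bounded : forall Y, M Y -> exists K, forall x, `|Y x| <= K.
Hypothesis M_generates : forall A, measurable A -> mclass M \1_A.

(** Only integrability of [X] is available, so [X] is tested against bounded functions;
    orthogonality reaches all indicators, and then every integral of [X] over a measurable set
    vanishes. *)
Lemma mclass_orthogonal X : Rintegrable mu X ->
  (forall Y, M Y -> \int[mu]_x (Y x * X x) = 0) -> {ae mu, forall x, X x = 0}.
Proof.
move=> iX MX.
have V Y : mclass M Y -> measurable_fun setT Y /\ \int[mu]_x (Y x * X x) = 0.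
  have int Z : mclass M Z -> measurable_fun setT Z -> Rintegrable mu (fun x => Z x * X x).
    move=> mZ Zm; have [K ZK] := mclass_bounded M_bounded mZ.
    exact: Rintegrable_bounded_mul ZK iX.
  elim=> {Y} [Y MY|c|a Y Z mY [VY VY'] mZ [VZ VZ']|Y Z K mY VY YK cY].
  - by split; [exact: M_measurable|exact: MX].
  - split => //; rewrite RintegralZl//.
    by have := MX _ M1; under eq_Rintegral do rewrite mul1r; move=> ->; rewrite mulr0.
  - split; first by apply: measurable_funD => //; exact: measurable_funM.
    under eq_Rintegral do rewrite mulrDl -mulrA.
    rewrite RintegralD//; [|by apply: RintegrableZ; exact: int|exact: int].
    by rewrite RintegralZl ?VY' ?VZ' ?mulr0 ?addr0//; exact: int.
  - have mYn n := proj1 (VY n).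
    have mZ : measurable_fun setT Z := measurable_fun_pointwise_cvg mYn cY.
    split => //.
    have [|n x|x|_ c] := @Rintegral_dominated_cvg _ _ _ mu (fun n x => Y n x * X x)
      (fun x => Z x * X x) (fun x => K * `|X x|) _ (RintegrableZ _ (Rintegrable_norm iX)).
    + by move=> n; apply: measurable_funM => //; exact: Rintegrable_measurable iX.
    + by rewrite normrM ler_wpM2r.
    + by apply: cvgM; [exact: cY|exact: cvg_cst].
    rewrite -(cvg_lim _ c)//; apply/cvg_lim => //; apply: cvg_near_cst.
    by apply: nearW => n; have [] := VY n.
have : ae_eq mu setT (EFin \o X) (cst 0%E).
  apply: integral_ae_eq => // E _ mE; rewrite integral0.
  rewrite integral_mkcond; have [_] := V _ (M_generates mE).
  have iE : Rintegrable mu (fun x => \1_E x * X x).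
    have mi : measurable_fun setT (\1_E : T -> R) by exact: measurable_indic.
    apply: (Rintegrable_bounded_mul (K := 1) mi _ iX).
    by move=> x; rewrite indicE; case: (_ \in _); rewrite ?normr1 ?normr0.
  move=> e; transitivity (\int[mu]_x (\1_E x * X x)%:E)%E.
    apply: eq_integral => x _; rewrite patchE indicE.
    by case: ifPn => _; rewrite ?mul1r ?mul0r.
  by rewrite RintegralE// e.
apply: filterS => x /(_ I)/= xX; exact: EFin_inj xX.
Qed.

End mclass_orthogonal.

Section conf_families.
Context (R : realType) (d : nat).
Let E := euclid R d.
Local Notation C := (conf R d).

Lemma pairing0 (gamma : C) : pairing gamma ((fun=> 0) : E -> R) = 0.
Proof. by rewrite /pairing fsbig1. Qed.

Definition exp_family : set (C -> R) := [set Y | exists psi : E -> R,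
  [/\ testfun psi, forall x, 0 <= psi x & Y = fun gamma => expR (- pairing gamma psi)]].

(** The phase closes the family under products up to linear combinations, and lets it contain both
    the constant 1 and the sines. *)
Definition cos_family : set (C -> R) := [set Y | exists (psi : E -> R) (theta : R),
  testfun psi /\ Y = fun gamma => cos (pairing gamma psi + theta)].

(* A bounded multiplicative family whose monotone class determines all
   [pairing gamma psi] generates the sigma-algebra of the configuration space. *)
Lemma family_generates (M : set (C -> R)) :
  (forall Y, M Y -> exists K, forall g, `|Y g| <= K) ->
  (forall Y Z, M Y -> M Z -> mclass M (fun g => Y g * Z g)) ->
  (forall psi, testfun psi -> (forall x, 0 <= psi x) ->
    measurable_fun setT (fun g : g_sigma_algebraType [set A | mclass M \1_A] =>
       pairing (g : C) psi : R)) ->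
  forall A, measurable A -> mclass M \1_A.
Proof.
move=> Mb MM mp; apply: conf_boxes_generate; first exact: mclass_sigma_algebra.
move=> a b; have [K [bK iK]] := box_bump_supported a b.
apply: (@measurable_fun_pointwise_cvg _ (g_sigma_algebraType [set A | mclass M \1_A])
  R (fun n g => pairing (g : C) (box_bump a b n))).
  move=> n; apply: mp => //; first exact: testfun_box_bump.
  by move=> x; case/andP: (box_bump_ge0_le1 a b n x).
move=> g; apply: pairing_cvg iK _ => // x; exact: box_bump_cvg.
Qed.

Lemma exp_family_bounded Y : exp_family Y -> exists K, forall g, `|Y g| <= K.
Proof. by move=> [psi [_ p0 ->]]; exists 1 => g; exact: exp_pairing_le1. Qed.

Lemma exp_family_generates A : measurable A -> mclass exp_family \1_A.
Proof.
have MM Y Z : exp_family Y -> exp_family Z -> mclass exp_family (fun g => Y g * Z g).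
  move=> [psi [tp p0 ->]] [psi' [tp' p0' ->]].
  apply: mclass_base; exists (fun x => psi x + psi' x); split.
  - exact: testfunD.
  - by move=> x; rewrite addr_ge0.
  have [K0 pK0] := testfun_supported tp; have [K1 pK1] := testfun_supported tp'.
  apply/funext => p; rewrite (pairingD _ (K := Num.max K0 K1)).
  - by rewrite opprD expRD.
  - by apply: supported_in_le pK0; rewrite le_max lexx.
  - by apply: supported_in_le pK1; rewrite le_max lexx orbT.
move: A; apply: family_generates => //; first exact: exp_family_bounded.
move=> psi tp p0; apply: measurable_fun_gt => s.
apply: sub_sigma_algebra => /=.
rewrite (_ : [set _ | _] = [set g : C | - expR (- s) < -1 * expR (- pairing g psi)]).
  apply: mclass_gt => //; first exact: exp_family_bounded.
  by apply: mclassZ; apply: mclass_base; exists psi.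
by apply/seteqP; split => p /=; rewrite mulN1r ltrN2 ltr_expR ltrN2.
Qed.

Lemma cos_family_bounded Y : cos_family Y -> exists K, forall g, `|Y g| <= K.
Proof. by move=> [psi [theta [_ ->]]]; exists 1 => g; rewrite ler_norml cos_geN1 cos_le1. Qed.

Lemma cvg_sinV (y : R) : (fun n => n.+1%:R * sin (y / n.+1%:R)) @ \oo --> y.
Proof.
have [->|y0] := eqVneq y 0.
  by apply: cvg_near_cst; apply: nearW => n; rewrite mul0r sin0 mulr0.
have [ds s0] := is_derive_sin (0 : R); rewrite cos0 in s0.
have c : h^-1 *: (sin (h *: 1 + 0) - sin 0) @[h --> 0^'] --> (1 : R).
  by rewrite -[X in _ --> X]s0; exact: ds.
have c' : (fun n => (y / n.+1%:R)^-1 * sin (y / n.+1%:R)) @ \oo --> (1 : R).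
  apply/cvgrPdist_lt => e e0.
  move/cvgrPdist_lt : c => /(_ e e0); rewrite near_withinE => nP.
  have cy : (fun n => y / n.+1%:R) @ \oo --> (0 : R).
    rewrite -[X in _ --> X](mulr0 y); apply: cvgM; first exact: cvg_cst.
    exact: cvg_harmonic.
  have H : \forall n \near \oo, y / n.+1%:R != 0 ->
      `|1 - (y / n.+1%:R)^-1 *: (sin ((y / n.+1%:R) *: 1 + 0) - sin 0)| < e := cy _ nP.
  near=> n.
  have yn : y / n.+1%:R != 0 by rewrite mulf_neq0// invr_eq0.
  have : y / n.+1%:R != 0 ->
    `|1 - (y / n.+1%:R)^-1 *: (sin ((y / n.+1%:R) *: 1 + 0) - sin 0)| < e by near: n.
  by move=> /(_ yn); rewrite sin0 subr0 addr0 [_%:A]mulr1.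
rewrite -[X in _ --> X]mulr1.
rewrite (_ : (fun n => _) = fun n => y * ((y / n.+1%:R)^-1 * sin (y / n.+1%:R))).
  by apply: cvgM => //; exact: cvg_cst.
by apply/funext => n; rewrite invfM invrK !mulrA divff// mul1r.
Unshelve. all: by end_near. Qed.

Lemma cos_family_generates A : measurable A -> mclass cos_family \1_A.
Proof.
have MM Y Z : cos_family Y -> cos_family Z -> mclass cos_family (fun g => Y g * Z g).
  move=> [psi [theta [tp ->]]] [psi' [theta' [tp' ->]]].
  have [K0 pK0] := testfun_supported tp; have [K1 pK1] := testfun_supported tp'.
  have pK : supported_in (Num.max K0 K1) psi by apply: supported_in_le pK0; rewrite le_max lexx.
  have pK' : supported_in (Num.max K0 K1) psi'.
    by apply: supported_in_le pK1; rewrite le_max lexx orbT.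
  rewrite (_ : (fun g => _) = fun g =>
      2^-1 * cos (pairing g (fun x => 1 * psi' x + psi x) + (theta + theta')) +
      2^-1 * cos (pairing g (fun x => -1 * psi' x + psi x) + (theta - theta'))).
    apply: mclassD; apply: mclassZ; apply: mclass_base; do 2 eexists; split;
      [|reflexivity| |reflexivity]; exact: testfun_lin.
  apply/funext => g; rewrite !(pairing_lin _ _ pK' pK).
  set a := pairing g psi; set b := pairing g psi'.
  rewrite (_ : 1 * b + a + (theta + theta') = (a + theta) + (b + theta')); last by ring.
  rewrite (_ : -1 * b + a + (theta - theta') = (a + theta) - (b + theta')); last by ring.
  by rewrite (cosD (a + theta)) (cosB (a + theta)); field.
move: A; apply: family_generates => //; first exact: cos_family_bounded.
move=> psi tp p0.
have [K pK] := testfun_supported tp.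
(* As [cos (t - pi / 2) = sin t] and [n sin (t / n)] tends to [t], the bounded cosines recover the
   unbounded [<gamma, psi>]. *)
apply: (@measurable_fun_pointwise_cvg _ (g_sigma_algebraType [set A | mclass cos_family \1_A])
    R (fun n g => n.+1%:R * cos (pairing (g : C) (fun x => n.+1%:R^-1 * psi x) - pi / 2))) => [n|g].
  apply: measurable_funM => //.
  apply: (mclass_measurable_sigma cos_family_bounded MM) => //.
  apply: mclass_base; exists (fun x => n.+1%:R^-1 * psi x), (- (pi / 2)).
  by split => //; exact: testfunZ.
under eq_cvg do rewrite (pairingZ _ _ pK) [_^-1 * _]mulrC cosBpihalf.
exact: cvg_sinV.
Qed.

End conf_families.

Lemma Rintegral_fubini d1 d2 (T1 : measurableType d1) (T2 : measurableType d2)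
    (R : realType) (m1 : {sigma_finite_measure set T1 -> \bar R})
    (m2 : {sigma_finite_measure set T2 -> \bar R}) (h : T1 * T2 -> R) :
  Rintegrable (m1 \x m2)%E h -> (forall x, Rintegrable m2 (fun y => h (x, y))) ->
  Rintegrable m1 (fun x => \int[m2]_y h (x, y)) /\
  \int[(m1 \x m2)%E]_p h p = \int[m1]_x \int[m2]_y h (x, y).
Proof.
move=> ih ihx.
have FE : fubini_F m2 (EFin \o h) = EFin \o (fun x => \int[m2]_y h (x, y)).
  by apply/funext => x; rewrite /fubini_F/= RintegralE.
split; first by rewrite -FE; exact: integrable_fubini_F.
by rewrite [LHS]/Rintegral -integral12_prod_meas1// FE.
Qed.

Lemma conf_eq (R : realType) (d : nat) (gamma gamma' : conf R d) :
  pts gamma = pts gamma' -> gamma = gamma'.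
Proof.
case: gamma gamma' => [A fA] [B fB] /= AB; subst B.
by congr Conf; exact: Prop_irrelevance.
Qed.

Lemma conf_add_id (R : realType) (d : nat) (gamma : conf R d) x :
  pts gamma x -> conf_add gamma x = gamma.
Proof.
by move=> gx; apply: conf_eq => /=; apply/seteqP; split => y /=; [case=> [//|->]|left].
Qed.

Section conf_null.
Context (R : realType) (d : nat).
Let E := euclid R d.
Variables (sigma : {measure set E -> \bar R}).
Hypothesis sigma_nonatomic : nonatomic sigma.

Lemma measurable_euclid1 (x : E) : measurable [set x].
Proof.
rewrite -[X in measurable X]setCK; apply: measurableC.
apply: open_measurable_euclid; apply: closed_openC.
exact: (@accessible_closed_set1 _ (hausdorff_accessible (@norm_hausdorff _ _))).
Qed.

Lemma pts_bigcup (gamma : conf R d) :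
  pts gamma = \bigcup_n \bigcup_(x in [set` pts_in gamma n%:R]) [set x].
Proof.
apply/seteqP; split => x.
  move=> gx; exists (Num.truncn `|x|).+1 => //; exists x => //=.
  by apply/pts_inP; split => //; apply: ltW; exact: truncnS_gt.
by move=> [n _ [y /= /pts_inP[gy _] ->]].
Qed.

Lemma measurable_pts (gamma : conf R d) : measurable (pts gamma).
Proof.
rewrite pts_bigcup; apply: bigcupT_measurable => n.
by apply: fin_bigcup_measurable => // x _; exact: measurable_euclid1.
Qed.

Lemma negligible_pts (gamma : conf R d) : sigma.-negligible (pts gamma).
Proof.
rewrite pts_bigcup; apply: negligible_bigcup => n.
have neg1 x : sigma.-negligible [set x].
  by apply/negligibleP; [exact: measurable_euclid1|exact: sigma_nonatomic].
have negs (s : seq E) : sigma.-negligible [set y | y \in s].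
  elim: s => [|x s IH].
    rewrite (_ : [set y | _] = set0); first exact: negligible_set0.
    by apply/seteqP; split.
  apply: negligibleS (negligibleU (neg1 x) IH) => y /=.
  by rewrite inE => /predU1P[->|ys]; [left|right].
by apply: negligibleS (negs (pts_in gamma n%:R)) => x [y /= ? ->].
Qed.

Lemma Rintegral_eq_off_pts (gamma : conf R d) (f g : E -> R) :
  measurable_fun setT f -> measurable_fun setT g ->
  (forall x, ~ pts gamma x -> f x = g x) -> \int[sigma]_x f x = \int[sigma]_x g x.
Proof.
move=> mf mg fg; congr fine; apply: ae_eq_integral => //.
- exact/measurable_EFinP.
- exact/measurable_EFinP.
- apply: negligibleS (negligible_pts gamma) => x /= nfg; apply: contrapT => ngx.
  by apply: nfg => _ /=; rewrite fg.
Qed.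

End conf_null.

Section nabla_star.
Context (R : realType) (d : nat).
Let E := euclid R d.
Local Notation C := (conf R d).
Local Notation CE := (conf R d * E)%type.
Variables (sigma : {sigma_finite_measure set E -> \bar R}).
Hypothesis sigma_radon : radon sigma.
Hypothesis sigma_nonatomic : nonatomic sigma.
Variable P : probability (conf R d) R.
Hypothesis P_poisson : poisson sigma P.
Variable phi : E -> R.
Hypothesis phi_test : testfun phi.

Definition nabla_star (g : C -> R) (gamma : C) : R :=
  pairing gamma (fun x => g (conf_rem gamma x) * phi x)
  - g gamma * \int[sigma]_x phi x.

Let int_phi : Rintegrable sigma phi := testfun_integrable sigma_radon phi_test.

Let int_prod_bounded (g : C -> R) (Phi : CE -> R) K : Rintegrable P g ->
  measurable_fun setT Phi -> (forall p, `|Phi p| <= K) ->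
  Rintegrable (P \x sigma)%E (fun p => Phi p * (g p.1 * phi p.2)).
Proof.
move=> ig mPhi PhiK.
have [i _] := Rintegral_prod ig int_phi.
exact: Rintegrable_bounded_mul PhiK i.
Qed.

Lemma sum_rem_integral (g : C -> R) (Phi : CE -> R) K : Rintegrable P g ->
  measurable_fun setT Phi -> (forall p, `|Phi p| <= K) ->
  Rintegrable P (fun gamma => pairing gamma
     (fun x => Phi (conf_rem gamma x, x) * g (conf_rem gamma x) * phi x)) /\
  \int[P]_gamma pairing gamma
     (fun x => Phi (conf_rem gamma x, x) * g (conf_rem gamma x) * phi x) =
  \int[(P \x sigma)%E]_p (Phi p * (g p.1 * phi p.2)).
Proof.
move=> ig mPhi PhiK; have [w [tw w0 wphi]] := testfun_majorant phi_test.
(* The formula [mecke] wants a nonnegative weight, so the signed [phi] is split as [w] times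
   [phi / w]: [expR (- ln w)] is [1 / w] where [w > 0], and [phi] vanishes elsewhere. *)
pose H (p : CE) := Phi p * (g p.1 * (phi p.2 * expR (- ln (w p.2)))).
have phiw x : phi x * expR (- ln (w x)) * w x = phi x.
  have [p0|p0] := eqVneq (phi x) 0; first by rewrite p0 !mul0r.
  have wx := wphi _ p0; by rewrite expRN lnK// divfK// gt_eqF.
have mH : measurable_fun setT H.
  apply: measurable_funM => //; apply: measurable_funM.
    by apply: measurable_fun_fst; exact: Rintegrable_measurable ig.
  apply: (@measurable_fun_snd _ _ _ _ _ (fun x => phi x * expR (- ln (w x)))).
  apply: measurable_funM; first exact: testfun_measurable.
  apply: measurableT_comp => //; apply: measurableT_comp => //.
  by apply: measurableT_comp => //; exact: testfun_measurable.
have HwE : (fun p => H p * w p.2) = fun p => Phi p * (g p.1 * phi p.2).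
  by apply/funext => p; rewrite /H -[in RHS](phiw p.2); ring.
have iHw : Rintegrable (P \x sigma)%E (fun p => H p * w p.2).
  by rewrite HwE; exact: int_prod_bounded PhiK.
have [m1 m2] := mecke sigma_radon P_poisson tw w0 mH iHw.
have mE : mecke_sum w H = fun gamma => pairing gamma
     (fun x => Phi (conf_rem gamma x, x) * g (conf_rem gamma x) * phi x).
  by apply/funext => gamma; apply: eq_pairing => x _; rewrite /H/= -[in RHS](phiw x); ring.
rewrite mE in m1 m2; split => //.
by rewrite m2; apply: eq_Rintegral => p _; rewrite /H -[in RHS](phiw p.2); ring.
Qed.

Lemma nabla_star_integrable g : Rintegrable P g -> Rintegrable P (nabla_star g).
Proof.
move=> ig; apply: RintegrableB.
  have [|p|i _] := @sum_rem_integral g (fun=> 1) 1 ig => //.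
    by rewrite normr1.
  move: i; congr (Rintegrable P _); apply/funext => gamma.
  by apply: eq_pairing => x _; rewrite mul1r.
under [X in Rintegrable _ X]eq_fun do rewrite mulrC.
exact: RintegrableZ.
Qed.

(** [Phi (gamma, x)] plays the role of [F (gamma + eps_x)] as a jointly measurable function. It is
    tied to [F] through removals only, so no exceptional set occurs: moving [F] inside the sum turns
    it into [Phi], and the Mecke formula followed by Fubini does the rest. *)
Lemma nabla_star_integral (g F : C -> R) (Phi : CE -> R) K :
  Rintegrable P g -> measurable_fun setT F -> (forall gamma, `|F gamma| <= K) ->
  measurable_fun setT Phi -> (forall p, `|Phi p| <= K) ->
  (forall gamma x, pts gamma x -> F gamma = Phi (conf_rem gamma x, x)) ->
  Rintegrable P
    (fun gamma => \int[sigma]_x ((Phi (gamma, x) - F gamma) * phi x) * g gamma) /\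
  \int[P]_gamma (F gamma * nabla_star g gamma) =
  \int[P]_gamma ((\int[sigma]_x ((Phi (gamma, x) - F gamma) * phi x)) * g gamma).
Proof.
move=> ig mF FK mPhi PhiK FPhi.
have [i1 e1] := sum_rem_integral ig mPhi PhiK.
have iFg : Rintegrable P (fun gamma => F gamma * g gamma).
  exact: Rintegrable_bounded_mul FK ig.
have iPhix gamma : Rintegrable sigma (fun x => Phi (gamma, x) * phi x).
  apply: (Rintegrable_bounded_mul (K := K)) => //.
  exact: measurableT_comp mPhi (pair1_measurable _).
have [|i2 e2] := Rintegral_fubini (int_prod_bounded ig mPhi PhiK).
  move=> gamma /=.
  rewrite (_ : (fun y => _) = fun y => g gamma * (Phi (gamma, y) * phi y)).
    exact: RintegrableZ.
  by apply/funext => y; ring.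
have inner gamma : \int[sigma]_x ((Phi (gamma, x) - F gamma) * phi x) * g gamma =
    \int[sigma]_x (Phi (gamma, x) * (g gamma * phi x))
    - (\int[sigma]_x phi x) * (F gamma * g gamma).
  under eq_Rintegral do rewrite mulrBl.
  rewrite RintegralB//; last exact: RintegrableZ.
  rewrite RintegralZl// mulrBl.
  congr (_ - _); last by ring.
  rewrite mulrC -RintegralZl//; apply: eq_Rintegral => x _; ring.
have FE gamma : F gamma * nabla_star g gamma = pairing gamma
     (fun x => Phi (conf_rem gamma x, x) * g (conf_rem gamma x) * phi x)
     - (\int[sigma]_x phi x) * (F gamma * g gamma).
  have [L pL] := testfun_supported phi_test.
  rewrite /nabla_star mulrBr -(@pairingZ _ _ _ L).
    congr (_ - _); last by ring.
    by apply: eq_pairing => x gx; rewrite (FPhi _ _ gx) mulrA.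
  exact: supported_inMl.
split.
  under [X in Rintegrable _ X]eq_fun do rewrite inner.
  by apply: RintegrableB => //; exact: RintegrableZ.
under eq_Rintegral do rewrite FE.
under [RHS]eq_Rintegral do rewrite inner.
rewrite RintegralB//; last exact: RintegrableZ.
rewrite [RHS]RintegralB//; last exact: RintegrableZ.
by rewrite e1 e2.
Qed.

Lemma nabla_star_exp (g : C -> R) psi : Rintegrable P g ->
  testfun psi -> (forall x, 0 <= psi x) ->
  \int[P]_gamma (expR (- pairing gamma psi) * nabla_star g gamma) =
  (\int[sigma]_x ((expR (- psi x) - 1) * phi x)) *
  \int[P]_gamma (expR (- pairing gamma psi) * g gamma).
Proof.
move=> ig tp p0.
pose F gamma := expR (- pairing gamma psi).
pose Phi (p : CE) := F p.1 * expR (- psi p.2).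
have mF : measurable_fun setT F by exact: measurable_exp_pairing.
have mpsi : measurable_fun setT (fun x => expR (- psi x)).
  apply: measurableT_comp => //; apply: measurableT_comp => //.
  exact: testfun_measurable.
have F1 gamma : `|F gamma| <= 1 by exact: exp_pairing_le1.
have mPhi : measurable_fun setT Phi.
  by apply: measurable_funM; [exact: measurable_fun_fst mF|exact: measurable_fun_snd mpsi].
have Phi1 p : `|Phi p| <= 1.
  rewrite normrM -[leRHS]mulr1 ler_pM//.
  by rewrite ger0_norm ?expR_ge0// expR_le1 oppr_le0.
have [L pL] := testfun_supported tp.
have FPhi gamma x : pts gamma x -> F gamma = Phi (conf_rem gamma x, x).
  by move=> gx; rewrite /F (pairing_conf_rem pL gx) opprD expRD mulrC.
have [_ e] := nabla_star_integral ig mF F1 mPhi Phi1 FPhi.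
rewrite e -RintegralZl//; last exact: Rintegrable_bounded_mul F1 ig.
apply: eq_Rintegral => gamma _; rewrite mulrA; congr (_ * _).
rewrite mulrC -RintegralZl//.
  by apply: eq_Rintegral => x _; rewrite /Phi /F/=; ring.
apply: (Rintegrable_bounded_mul (K := 1)) => //.
  by apply: measurable_funB.
move=> x; have := expR_ge0 (- psi x); have : expR (- psi x) <= 1 by rewrite expR_le1 oppr_le0.
by move=> ? ?; rewrite ler_norml; apply/andP; split; lra.
Qed.

Lemma cylinder_measurable N (psi : 'I_N -> E -> R) (f : 'rV[R]_N -> R) :
  (forall i, testfun (psi i)) -> continuous f ->
  measurable_fun setT (fun gamma : C => f (\row_i pairing gamma (psi i))).
Proof.
move=> tp cf.
have mf := continuous_measurable_euclid (cf : continuous (f : euclid R N -> R)).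
apply: (measurableT_comp mf); apply: measurable_fun_euclid => i.
by under eq_fun do rewrite mxE; exact: measurable_pairing_testfun.
Qed.

(** Here [Phi (gamma, x)] can differ from [F (conf_add gamma x)] only for [x] in [gamma], a
    countable set that the non-atomic [sigma] does not charge. *)
Lemma nabla_star_cylinder (g : C -> R) N (psi : 'I_N -> E -> R)
    (f : 'rV[R]_N -> R) K : Rintegrable P g ->
  (forall i, testfun (psi i)) -> continuous f -> (forall y, `|f y| <= K) ->
  let F gamma := f (\row_i pairing gamma (psi i)) in
  Rintegrable P (fun gamma =>
    \int[sigma]_x ((F (conf_add gamma x) - F gamma) * phi x) * g gamma) /\
  \int[P]_gamma (F gamma * nabla_star g gamma) =
  \int[P]_gamma ((\int[sigma]_x ((F (conf_add gamma x) - F gamma) * phi x)) * g gamma).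
Proof.
move=> ig tp cf fK F.
pose Phi (p : CE) := f (\row_i (psi i p.2 + pairing p.1 (psi i))).
have mf := continuous_measurable_euclid (cf : continuous (f : euclid R N -> R)).
have mPhi : measurable_fun setT Phi.
  apply: (measurableT_comp mf); apply: measurable_fun_euclid => i.
  under eq_fun do rewrite mxE; apply: measurable_funD.
    by apply: measurable_fun_snd; exact: testfun_measurable.
  apply: (@measurable_fun_fst _ _ _ _ _ (fun g => pairing g (psi i))).
  exact: measurable_pairing_testfun.
have FPhi gamma x : pts gamma x -> F gamma = Phi (conf_rem gamma x, x).
  move=> gx; congr f; apply/rowP => i; rewrite !mxE/=.
  by have [L pL] := testfun_supported (tp i); rewrite (pairing_conf_rem pL gx).
have FPhi' gamma x : ~ pts gamma x -> F (conf_add gamma x) = Phi (gamma, x).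
  move=> gx; congr f; apply/rowP => i; rewrite !mxE/=.
  by have [L pL] := testfun_supported (tp i); rewrite (pairing_conf_add pL gx).
have [] := nabla_star_integral ig (cylinder_measurable tp cf) (fun _ => fK _)
  mPhi (fun _ => fK _) FPhi.
have -> : (fun gamma => \int[sigma]_x ((Phi (gamma, x) - F gamma) * phi x) * g gamma) =
    (fun gamma => \int[sigma]_x ((F (conf_add gamma x) - F gamma) * phi x) * g gamma).
  apply/funext => gamma; congr (_ * _).
  have mPx : measurable_fun setT (fun x => Phi (gamma, x)).
    exact: measurableT_comp mPhi (pair1_measurable _).
  apply: (Rintegral_eq_off_pts sigma_nonatomic (gamma := gamma)).
  - apply: measurable_funM; last exact: testfun_measurable.
    exact: measurable_funB.
  - apply: measurable_funM; last exact: testfun_measurable.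
    apply: measurable_funB => //.
    (* Adding a point of [gamma] changes nothing, so the integrand is constant on [gamma] and
       measurable piece by piece. *)
    rewrite (_ : (fun x => _) = fun x => \1_(~` pts gamma) x * Phi (gamma, x)
        + \1_(pts gamma) x * F gamma).
      have mg := measurable_pts gamma.
      apply: measurable_funD; apply: measurable_funM => //; apply: measurable_indic => //.
      exact: measurableC.
    apply/funext => x; rewrite !indicE in_setC.
    have [gx|gx] := boolP (x \in pts gamma); rewrite /= ?mul1r ?mul0r ?addr0 ?add0r.
      by congr F; apply: conf_add_id; exact: set_mem gx.
    by apply: FPhi' => g'; move: gx; rewrite mem_set.
  - by move=> x gx; rewrite FPhi'.
by [].
Qed.

End nabla_star.

(** * Charlier kernels *)

Section power_series.
Context (R : realType).

(** The term [2 q^k] makes the bound inductive: from [k] to [k + 1] the left side changes by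
    [q^k (2 q - 1) <= 0]. *)
Lemma geometric_le2 (q : R) k : 0 <= q -> q <= 2^-1 ->
  \sum_(i < k) q ^+ i + 2 * q ^+ k <= 2.
Proof.
move=> q0 q2; elim: k => [|k IH]; first by rewrite big_ord0 add0r expr0 mulr1.
apply: le_trans IH; rewrite big_ord_recr/= -addrA lerD2l exprS.
have qk : 0 <= q ^+ k by rewrite exprn_ge0.
nra.
Qed.

(** Convergence at one [r > 0] bounds [a i r^i]. Once the coefficients below [n] vanish, the tail
    beyond [n] is [O(t^(n+1))] for [t <= r / 2], and dividing by [t^n] leaves [a n = O(t)]. *)
Lemma power_series_eq0 (a : nat -> R) :
  (\forall t \near (0 : R), series (fun n => a n * t ^+ n) @ \oo --> (0 : R)) ->
  forall n, a n = 0.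
Proof.
move=> /nbhs_ballP[e /= e0 He].
pose r := e / 2; have r0 : 0 < r by rewrite divr_gt0.
have Hr t : 0 <= t <= r -> series (fun n => a n * t ^+ n) @ \oo --> (0 : R).
  move=> /andP[t0 tr]; apply: He; rewrite -ball_normE /ball_/= sub0r normrN ger0_norm//.
  by rewrite (le_lt_trans tr)// /r ltr_pdivrMr// mulr_natr mulr2n ltrDl.
have [K HK] : exists K, forall n, `|a n * r ^+ n| <= K.
  have : cvgn (series (fun n => a n * r ^+ n)).
    by apply/cvg_ex; exists 0; apply: Hr; rewrite lexx ltW.
  move=> /cvg_series_cvg_0 c0.
  have : bounded_fun (fun n => a n * r ^+ n).
    by apply: cvg_seq_bounded; apply/cvg_ex; exists 0.
  by move=> [M [Mr HM]]; exists (M + 1) => n; apply: (HM (M + 1)) => //; rewrite ltrDl.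
have K0 : 0 <= K := le_trans (normr_ge0 _) (HK 0).
elim/ltn_ind => n IH.
have key t : 0 < t -> t <= r / 2 -> `|a n| <= (2 * K / r ^+ n.+1) * t.
  move=> t0 tr.
  have t_r : 0 <= t <= r by rewrite ltW//= (le_trans tr)// ler_pdivrMr// mulr_natr mulr2n lerDl ltW.
  pose q := t / r; have q0 : 0 <= q by rewrite divr_ge0// ltW.
  have q2 : q <= 2^-1 by rewrite /q ler_pdivrMr// mulrC.
  have tE i : t ^+ i = r ^+ i * q ^+ i by rewrite -exprMn /q mulrC divfK// gt_eqF.
  have bound N : `|series (fun i => a i * t ^+ i) (n.+1 + N)%N - a n * t ^+ n| <= 2 * K * q ^+ n.+1.
    rewrite /series/= big_mkord.
    rewrite big_split_ord/= big_ord_recr/= big1 ?add0r; last first.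
      by move=> i _; rewrite IH ?mul0r.
    rewrite addrAC subrr add0r (le_trans (ler_norm_sum _ _ _))//.
    apply: (@le_trans _ _ (\sum_(i < N) K * q ^+ n.+1 * q ^+ i)).
      apply: ler_sum => i _; rewrite tE mulrA normrM (ger0_norm (exprn_ge0 _ q0)).
      by rewrite -mulrA -exprD ler_wpM2r// exprn_ge0.
    rewrite -mulr_sumr (_ : 2 * K * _ = K * q ^+ n.+1 * 2); last by ring.
    rewrite ler_wpM2l ?mulr_ge0 ?exprn_ge0//; have := geometric_le2 N q0 q2.
    have : 0 <= q ^+ N by rewrite exprn_ge0.
    lra.
  have lim : (fun N => `|series (fun i => a i * t ^+ i) (n.+1 + N)%N - a n * t ^+ n|)
      @ \oo --> `|0 - a n * t ^+ n|.
    apply: cvg_norm; apply: cvgB; last exact: cvg_cst.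
    rewrite (_ : (fun N => _) = fun N => series (fun i => a i * t ^+ i) (N + n.+1)%N); last first.
      by apply/funext => N; rewrite addnC.
    by rewrite (cvg_shiftn n.+1 (series (fun i => a i * t ^+ i))); exact: Hr.
  have : `|0 - a n * t ^+ n| <= 2 * K * q ^+ n.+1.
    rewrite -(cvg_lim _ lim)//; apply: limr_le; first by apply/cvg_ex; eexists; exact: lim.
    exact: nearW.
  rewrite sub0r normrN normrM (ger0_norm (exprn_ge0 _ (ltW t0))).
  rewrite -ler_pdivlMr ?exprn_gt0// => /le_trans; apply.
  rewrite /q exprMn exprVn exprS.
  rewrite le_eqVlt; apply/orP; left; apply/eqP.
  by field; rewrite !gt_eqF// exprn_gt0.
apply/eqP; rewrite -normr_le0; apply/ler_addgt0Pl => eps eps0; rewrite addr0.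
pose A := 2 * K / r ^+ n.+1; have A0 : 0 <= A by rewrite divr_ge0 ?mulr_ge0// exprn_ge0// ltW.
(* The first bound is the one that [key] requires, the second gives [A t <= eps]; [A + 1] avoids
   dividing by [0]. *)
pose t := Num.min (r / 2) (eps / (A + 1)).
have A1 : 0 < A + 1 by rewrite ltr_pwDr.
have t0 : 0 < t by rewrite lt_min !divr_gt0.
apply: le_trans (key t t0 _) _; first by rewrite ge_min lexx.
apply: (@le_trans _ _ (A * (eps / (A + 1)))).
  by apply: ler_wpM2l => //; rewrite ge_min lexx orbT.
rewrite mulrCA ler_piMr ?(ltW eps0)// ler_pdivrMr// mul1r lerDl//.
Qed.

Lemma power_series_inj (a b : nat -> R) (f : R -> R) :
  (\forall t \near (0 : R), series (fun n => a n * t ^+ n) @ \oo --> f t) ->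
  (\forall t \near (0 : R), series (fun n => b n * t ^+ n) @ \oo --> f t) ->
  forall n, a n = b n.
Proof.
move=> fa fb n; apply/eqP; rewrite -subr_eq0; apply/eqP.
apply: (@power_series_eq0 (fun n => a n - b n)).
near=> t.
rewrite (_ : series _ = fun N =>
  series (fun n => a n * t ^+ n) N - series (fun n => b n * t ^+ n) N).
  by rewrite -[X in _ --> X](subrr (f t)); apply: cvgB; near: t.
apply/funext => N; rewrite /series/= -sumrB; apply: eq_bigr => i _; ring.
Unshelve. all: by end_near. Qed.

End power_series.

Section charlier_diag.
Context (R : realType) (d : nat).
Let E := euclid R d.
Variables (psi : E -> R) (I : R).

(* The Taylor coefficients at 0 of [prod_(x <- l) (1 + t psi x) * exp (- t I)]. *)
Fixpoint charlier_coef (l : seq E) (n : nat) : R :=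
  if l is x :: l' then
    charlier_coef l' n + psi x * (if n is m.+1 then charlier_coef l' m else 0)
  else (- I) ^+ n / n`!%:R.

Lemma charlier_coef_cvg l (t : R) :
  series (fun n => charlier_coef l n * t ^+ n) @ \oo -->
  (\prod_(x <- l) (1 + t * psi x)) * expR (- (t * I)).
Proof.
elim: l => [|x l IH].
  rewrite big_nil mul1r.
  rewrite (_ : (fun n => _) = exp_coeff (- (t * I))); first exact: is_cvg_series_exp_coeff.
  apply/funext => n; rewrite /exp_coeff/= -[- (t * I)]mulrN exprMn.
  by rewrite mulrC mulrA.
rewrite big_cons -cvg_shiftS.
(* Multiplication by [1 + t psi x] adds to the partial sum of order [N.+1] the one of order [N]
   times [t psi x], whence the shift of the index. *)
rewrite (_ : (fun n => _) = fun N => series (fun n => charlier_coef l n * t ^+ n) N.+1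
   + (t * psi x) * series (fun n => charlier_coef l n * t ^+ n) N).
  rewrite -mulrA mulrDl mul1r; apply: cvgD; first by rewrite cvg_shiftS.
  by apply: cvgM => //; exact: cvg_cst.
apply/funext => N; rewrite /series/= mulr_sumr [X in _ + X]big_mkord !big_mkord.
under eq_bigr do rewrite mulrDl.
rewrite big_split/=; congr (_ + _).
rewrite big_ord_recl/= mulr0 mul0r add0r; apply: eq_bigr => i _.
by rewrite /bump/= add1n exprS; ring.
Qed.

(** Both sides are the coefficient of [t^n] in the derivative of the generating product: Leibniz's
    rule deletes the factors one at a time, and the exponential contributes [- I]. *)
Lemma charlier_coefS l n : uniq l ->
  n.+1%:R * charlier_coef l n.+1 =
  \sum_(x <- l) psi x * charlier_coef (rem x l) n - I * charlier_coef l n.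
Proof.
elim: l n => [|y l IH] n.
  move=> _; rewrite big_nil sub0r /= factS natrM exprS.
  by field; rewrite !pnatr_eq0 -!lt0n fact_gt0 /=.
rewrite cons_uniq => /andP[yl ul]; rewrite big_cons /= eqxx.
(* As [y] does not occur in [l], each removal acts below [y], and the definition of [charlier_coef]
   unfolds once. *)
have -> : \sum_(x <- l) psi x * charlier_coef (if y == x then l else y :: rem x l) n =
    \sum_(x <- l) psi x * charlier_coef (rem x l) n +
    psi y * (if n is m.+1 then \sum_(x <- l) psi x * charlier_coef (rem x l) m else 0).
  transitivity (\sum_(x <- l) (psi x * charlier_coef (rem x l) n +
      psi y * (if n is m.+1 then psi x * charlier_coef (rem x l) m else 0))).
    rewrite big_seq [RHS]big_seq; apply: eq_bigr => x xl.
    case: eqP => [yx|_]; first by rewrite yx xl in yl.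
    by rewrite /=; case: n; [rewrite !mulr0 !addr0|move=> m; ring].
  rewrite big_split/= -mulr_sumr; congr (_ + psi y * _).
  by case: n => //; rewrite big1.
rewrite mulrDr IH//; case: n => [|m]; first by rewrite !mulr0 !addr0; ring.
have := IH m ul; set S := \sum_(x <- l) psi x * charlier_coef (rem x l) m => e.
set S' := \sum_(x <- l) _.
have -> : S = m.+1%:R * charlier_coef l m.+1 + I * charlier_coef l m by rewrite e; ring.
by rewrite -[in LHS]natr1; ring.
Qed.

End charlier_diag.

(** * Polarization of symmetric multilinear forms *)

Section polarization.
Context (R : comRingType) (V : lmodType R) (D : set V).
Hypothesis D0 : D 0.
Hypothesis D_lin : forall a u v, D u -> D v -> D (a *: u + v).

Definition multilinear_on n (B : ('I_n -> V) -> R) :=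
  forall (psi : 'I_n -> V) i a u v, (forall j, D (psi j)) -> D u -> D v ->
  B [eta psi with i |-> a *: u + v] =
  a * B [eta psi with i |-> u] + B [eta psi with i |-> v].

Lemma domain_sum (I : Type) (r : seq I) (P : pred I) (v : I -> V) :
  (forall i, D (v i)) -> D (\sum_(i <- r | P i) v i).
Proof.
move=> Dv; elim/big_rec : _ => // i x _ Dx.
by rewrite -[v i]scale1r; exact: D_lin.
Qed.

Lemma multilinear_sum n (B : ('I_n -> V) -> R) (psi : 'I_n -> V) i
    (I : Type) (r : seq I) (P : pred I) (v : I -> V) :
  multilinear_on B -> (forall j, D (psi j)) -> (forall k, D (v k)) ->
  B [eta psi with i |-> \sum_(k <- r | P k) v k] =
  \sum_(k <- r | P k) B [eta psi with i |-> v k].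
Proof.
move=> Bl Dpsi Dv.
have B0 : B [eta psi with i |-> 0] = 0.
  have := Bl psi i (-1) 0 0 Dpsi D0 D0.
  by rewrite scaler0 addr0 mulN1r addNr.
elim: r => [|k r IH]; first by rewrite !big_nil.
rewrite !big_cons; case: ifP => // _.
have := Bl psi i 1 (v k) (\sum_(k <- r | P k) v k) Dpsi (Dv k) (domain_sum _ _ Dv).
by rewrite scale1r mul1r IH.
Qed.

Definition fcons (T : Type) n (u : T) (psi : 'I_n -> T) (i : 'I_n.+1) : T :=
  if unlift ord0 i is Some j then psi j else u.

Lemma fcons_with0 n (u u' : V) (psi : 'I_n -> V) :
  fcons u psi = [eta fcons u' psi with ord0 |-> u].
Proof.
apply/funext => i /=; rewrite /fcons; case: unliftP => [j ->|->]; last by rewrite eqxx.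
by rewrite -(inj_eq val_inj).
Qed.

Lemma fcons_with_lift n (u w : V) (psi : 'I_n -> V) i :
  fcons u [eta psi with i |-> w] = [eta fcons u psi with lift ord0 i |-> w].
Proof.
apply/funext => k /=; rewrite /fcons; case: unliftP => [j ->|->].
  by rewrite (inj_eq (@lift_inj _ ord0)) /=.
by rewrite -(inj_eq val_inj).
Qed.

Lemma domain_fcons n (u : V) (psi : 'I_n -> V) :
  D u -> (forall j, D (psi j)) -> forall i, D (fcons u psi i).
Proof. by move=> Du Dpsi i; rewrite /fcons; case: unlift. Qed.

Lemma multilinear_expand n (B : ('I_n -> V) -> R) m (v : 'I_m -> V) (S : {set 'I_m}) :
  multilinear_on B -> (forall j, D (v j)) ->
  B (fun=> \sum_(j in S) v j) =
  \sum_(f : {ffun 'I_n -> 'I_m} | [forall i, f i \in S]) B (fun i => v (f i)).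
Proof.
move=> + Dv; elim: n B => [|n IH] B Bl.
  rewrite (big_pred1 (ffun0 (card_ord 0))) => [|f]; last first.
    apply/forallP/eqP => [_|_ []//].
    by apply/ffunP => -[].
  by congr B; apply/funext => -[].
set s := \sum_(j in S) v j.
have Ds : D s by exact: domain_sum.
have -> : (fun=> s) = fcons s (fun=> s) :> ('I_n.+1 -> V).
  by apply/funext => i; rewrite /fcons; case: unlift.
(* The [0] is a placeholder in slot 0, overwritten by the sum [s]. *)
rewrite (fcons_with0 _ 0) multilinear_sum//; last first.
  by apply: domain_fcons => // j.
under eq_bigr => j _.
  rewrite -fcons_with0 (IH (fun psi => B (fcons (v j) psi))); last first.
    move=> psi i a u u' Dpsi Du Du'; rewrite !fcons_with_lift Bl//.
    exact: domain_fcons.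
  over.
rewrite /= pair_big /=.
pose h (p : 'I_m * {ffun 'I_n -> 'I_m}) : {ffun 'I_n.+1 -> 'I_m} :=
  [ffun i => fcons p.1 p.2 i].
pose h' (f : {ffun 'I_n.+1 -> 'I_m}) : 'I_m * {ffun 'I_n -> 'I_m} :=
  (f ord0, [ffun i => f (lift ord0 i)]).
have hK : cancel h h'.
  move=> [j f]; rewrite /h /h' /= ffunE /fcons unlift_none; congr pair.
  by apply/ffunP => i; rewrite !ffunE liftK.
have h'K : cancel h' h.
  move=> f; apply/ffunP => i; rewrite ffunE /fcons /h' /=.
  by case: unliftP => [j ->|->]; rewrite ?ffunE.
rewrite [RHS](reindex h); last by exists h' => p _.
apply: eq_big => [[j f]|[j f] _] /=.
  apply/andP/forallP => [[jS /forallP fS] i|H].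
    by rewrite ffunE /fcons; case: unlift.
  split; first by have := H ord0; rewrite ffunE /fcons unlift_none.
  by apply/forallP => i; have := H (lift ord0 i); rewrite ffunE /fcons liftK.
congr B; apply/funext => i; rewrite ffunE /fcons.
by case: unlift.
Qed.

(** Expand over all index maps [f]. The signed sum over the sets [S] containing the range of [f]
    vanishes unless [f] is onto, hence a permutation, and the [n!] permutations all contribute
    [B v]. *)
Lemma polarization n (B : ('I_n -> V) -> R) (v : 'I_n -> V) :
  multilinear_on B -> (forall j, D (v j)) ->
  (forall s : 'S_n, B (fun i => v (s i)) = B v) ->
  n`!%:R * B v = \sum_(S : {set 'I_n})
    (\prod_(i < n) (if i \in S then 1 else -1)) * B (fun=> \sum_(j in S) v j).
Proof.
move=> Bl Dv Bs.
under [RHS]eq_bigr => S _ do rewrite multilinear_expand// mulr_sumr.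
rewrite (exchange_big_dep predT)//=.
have inner (f : {ffun 'I_n -> 'I_n}) :
    \sum_(S : {set 'I_n} | [forall i, f i \in S])
      (\prod_(i < n) (if i \in S then 1 else -1)) * B (fun i => v (f i)) =
    (injectiveb f)%:R * B (fun i => v (f i)).
  rewrite -mulr_suml; congr (_ * _).
  (* The [0] excludes the sets that miss a value of [f]. The sum over [S] thus becomes a product
     over [i] of factors [1 + 0] or [1 - 1]. *)
  transitivity (\sum_(S : {set 'I_n})
      \prod_(i < n) (if i \in S then 1 else (if i \in codom f then 0 else -1 : R))).
    rewrite big_mkcond; apply: eq_bigr => S _.
    case: ifPn => [/forallP fS|/forallPn[i fiS]].
      apply: eq_bigr => i _; case: ifPn => // iS; case: ifPn => // /codomP[j ij].
      by rewrite ij fS in iS.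
    by rewrite (bigD1 (f i))//= (negPf fiS) codom_f mul0r.
  rewrite -bigA_distr.
  case: (boolP (injectiveb f)) => [/injectiveP fi|fi] /=.
    rewrite big1// => i _; rewrite ifT ?addr0//.
    by apply/codomP; exists (invF fi i); rewrite f_invF.
  have [i ni] : exists i, i \notin codom f.
    apply/existsP; apply: contraR fi; rewrite negb_exists => /forallP h.
    have fc i : i \in codom f by have := h i; rewrite negbK.
    have cT : #|fintype.image f predT| == #|(predT : pred 'I_n)|.
      by apply/eqP/eq_card => i; rewrite [RHS]inE; exact: fc.
    have finj := elimT (@fintype.image_injP _ _ f predT) cT; apply/injectiveP => i j; exact: finj.
  by rewrite (bigD1 i)//= ifN// subrr mul0r.
under eq_bigr => f _ do rewrite inner.
rewrite (bigID (fun f : {ffun 'I_n -> 'I_n} => injectiveb f)) /=.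
rewrite [X in _ + X]big1 ?addr0; last first.
  by move=> f /negPf ->; rewrite mul0r.
rewrite (reindex (@pval _)) /=; last first.
  pose in_Sn := insubd (1%g : 'S_n).
  by exists in_Sn => /= f Uf; first apply: val_inj; apply: insubdK.
rewrite (eq_bigl predT) => [|s]; last by rewrite (valP s).
rewrite (eq_bigr (fun=> B v)) => [|s _]; last first.
  rewrite (valP s) mul1r -[RHS](Bs s); congr B; apply/funext => i.
  by rewrite pvalE.
rewrite sumr_const mulr_natl; congr (_ *+ _).
exact: esym (card_Sn n).
Qed.

End polarization.

Section charlier_kernel.
Context (R : realType) (d : nat).
Let E := euclid R d.
Variables (sigma : {sigma_finite_measure set E -> \bar R}).
Hypothesis sigma_radon : radon sigma.
Variable C : kernel_family R d.
Hypothesis C_charlier : is_charlier sigma C.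
Implicit Types (psi : E -> R) (gamma : conf R d).

Definition charlier_rec psi n : conf R d -> R :=
  iter n (nabla_star sigma psi) (fun=> 1).

(** The list [l] is any enumeration, not a canonical one, so that the induction can pass from
    [gamma] and [l] to [conf_rem gamma x] and [rem x l]. Multiplied by [n!], [charlier_coefS] is the
    recursion given by [nabla_star]. *)
Lemma charlier_rec_coef psi K n gamma (l : seq E) : supported_in K psi ->
  uniq l -> (forall x, x \in l <-> (pts gamma x /\ `|x| <= K)) ->
  charlier_rec psi n gamma =
  n`!%:R * charlier_coef psi (\int[sigma]_x psi x) l n.
Proof.
move=> pK; have coef0 (s : seq E) : charlier_coef psi (\int[sigma]_x psi x) s 0 = 1.
  by elim: s => [|x s IH] /=; rewrite ?expr0 ?fact0 ?divr1// IH mulr0 addr0.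
elim: n gamma l => [|n IH] gamma l ul hl.
  by rewrite /= coef0 fact0 mulr1.
rewrite factS natrM mulrAC -mulrA [X in _ = X](_ : _ =
  n`!%:R * (n.+1%:R * charlier_coef psi (\int[sigma]_x psi x) l n.+1)); last by ring.
rewrite charlier_coefS// /= /nabla_star.
rewrite (IH gamma l)// (@pairingE _ _ _ _ K); last exact: supported_inMl.
rewrite (perm_big l)/=; last first.
  apply: uniq_perm => // [|x]; first exact: fset_uniq.
  by apply/idP/idP => [/pts_inP/hl|/hl/pts_inP].
rewrite mulrBr mulr_sumr; congr (_ - _); last by ring.
rewrite big_seq [RHS]big_seq; apply: eq_bigr => x xl.
rewrite (IH _ (rem x l)); [by ring|exact: rem_uniq|] => y.
rewrite mem_rem_uniq// inE/=; split.
  by move=> /andP[/eqP yx /hl[gy yK]]; split.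
by move=> [[gy yx] yK]; apply/andP; split; [exact/eqP|exact/hl].
Qed.

Let testfunV_lin (a : R) (u v : E -> R) : testfun u -> testfun v ->
  testfun (a *: u + v : E -> R).
Proof. exact: testfun_lin. Qed.

Let testfunV0 : testfun (0 : E -> R). Proof. exact: testfun0. Qed.

Lemma charlier_multilinear gamma n :
  multilinear_on (@testfun R d) (@C gamma n).
Proof.
move=> psi i a u v tpsi tu tv.
by have [h _ _] := C_charlier gamma; exact: h.
Qed.

Lemma charlier_homogeneous gamma n psi (t : R) : testfun psi ->
  C gamma (fun _ : 'I_n => (fun x => t * psi x)) = t ^+ n * C gamma (fun _ : 'I_n => psi).
Proof.
move=> tp.
have tt : testfun (fun x => t * psi x) by exact: testfunZ.
(* The slots are scaled one at a time from the left; the axiom, which concerns [a u + v], is used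
   with [v = 0]. *)
pose f k (i : 'I_n) : E -> R := if (i < k)%N then (fun x => t * psi x) else psi.
have tf k i : testfun (f k i) by rewrite /f; case: ifP.
have key k : (k <= n)%N -> C gamma (f k) = t ^+ k * C gamma (fun _ : 'I_n => psi).
  elim: k => [_|k IH kn].
    by rewrite expr0 mul1r; congr (C gamma _).
  have -> : f k.+1 = [eta f k with Ordinal kn |-> t *: psi + 0].
    apply/funext => i /=; rewrite addr0 /f ltnS leq_eqVlt -val_eqE /=.
    by case: eqP.
  have -> := @charlier_multilinear gamma n _ (Ordinal kn) t _ _ (tf k) tp testfunV0.
  have -> : C gamma [eta f k with Ordinal kn |-> 0] = 0.
    have := @charlier_multilinear gamma n _ (Ordinal kn) (-1) _ _ (tf k) testfunV0 testfunV0.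
    by rewrite scaler0 addr0 mulN1r addNr.
  rewrite addr0 exprS -mulrA -IH ?(ltnW kn)//; congr (_ * C gamma _).
  apply/funext => i /=; case: eqP => // ->; by rewrite /f/= ltnn.
rewrite -key//; congr (C gamma _); apply/funext => i.
by rewrite /f ltn_ord.
Qed.

Lemma charlier_diag gamma n psi : testfun psi ->
  C gamma (fun _ : 'I_n => psi) = charlier_rec psi n gamma.
Proof.
move=> tp; have [K pK] := testfun_supported tp.
have [M pM] := testfun_bounded tp.
pose l : seq E := pts_in gamma K.
have hl x : x \in l <-> (pts gamma x /\ `|x| <= K) by exact: pts_inP.
rewrite (charlier_rec_coef n pK _ hl); last exact: fset_uniq.
set I := \int[sigma]_x psi x.
have n0 : n`!%:R != 0 :> R by rewrite pnatr_eq0 -lt0n fact_gt0.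
apply: (mulfI (invr_neq0 n0)); rewrite mulKf//.
apply: (@power_series_inj R (fun n => n`!%:R^-1 * C gamma (fun _ : 'I_n => psi))
   (charlier_coef psi I l)
   (fun t => (\prod_(x <- l) (1 + t * psi x)) * expR (- (t * I)))); last first.
  by near=> t; exact: charlier_coef_cvg.
have [_ _ /(_ psi tp) gen] := C_charlier gamma.
have M1 : 0 < `|M| + 1 by rewrite ltr_wpDl.
(* This range keeps [1 + t psi] positive, so that [expR] undoes [ln] and the generating function
   becomes a finite product. *)
have near_small : \forall t \near (0 : R), `|t| < (`|M| + 1)^-1.
  apply/nbhs_ballP; exists (`|M| + 1)^-1; first by rewrite /= invr_gt0.
  by move=> t; rewrite -ball_normE /ball_/= sub0r normrN.
near=> t.
have tM : `|t| < (`|M| + 1)^-1.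
  by near: t.
have pos x : 0 < 1 + t * psi x.
  have : `|t * psi x| < 1.
    rewrite normrM; apply: (@le_lt_trans _ _ (`|t| * (`|M| + 1))).
      by rewrite ler_wpM2l// (le_trans (pM x))// (le_trans (ler_norm _))// lerDl.
    by rewrite -ltr_pdivlMr// mul1r.
  by rewrite ltr_norml => /andP[? ?]; lra.
have -> : (fun n => n`!%:R^-1 * C gamma (fun _ : 'I_n => psi) * t ^+ n) =
    (fun n => n`!%:R^-1 * C gamma (fun _ : 'I_n => (fun x => t * psi x))).
  by apply/funext => m; rewrite charlier_homogeneous// mulrA mulrAC.
have -> : (\prod_(x <- l) (1 + t * psi x)) * expR (- (t * I)) =
    expR (pairing gamma (fun x => ln (1 + t * psi x)) - \int[sigma]_x (t * psi x)).
  rewrite expRD RintegralZl//; last exact: testfun_integrable.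
  congr (_ * _); rewrite (@pairingE _ _ _ _ K).
    by rewrite expR_sum; apply: eq_bigr => x _; rewrite lnK// posrE.
  by move=> x lx; apply: pK; apply: contraNneq lx => ->; rewrite mulr0 addr0 ln1.
by near: t.
Unshelve. all: by end_near. Qed.

Variable P : probability (conf R d) R.
Hypothesis P_poisson : poisson sigma P.

Lemma charlier_rec_integrable psi n : testfun psi ->
  Rintegrable P (charlier_rec psi n).
Proof.
move=> tp; elim: n => [|n IH] /=; first exact: finite_measure_integrable_cst.
exact: nabla_star_integrable.
Qed.

(** The exponential is an eigenfunction of the difference operator, so each [nabla_star] contributes
    the same factor. *)
Lemma charlier_rec_integral psi n eta : testfun psi ->
  testfun eta -> (forall x, 0 <= eta x) ->
  \int[P]_gamma (expR (- pairing gamma eta) * charlier_rec psi n gamma) =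
  (\int[sigma]_x ((expR (- eta x) - 1) * psi x)) ^+ n *
  \int[P]_gamma expR (- pairing gamma eta).
Proof.
move=> tp te e0; elim: n => [|n IH] /=.
  by rewrite expr0 mul1r; apply: eq_Rintegral => gamma _; rewrite mulr1.
rewrite nabla_star_exp//; last exact: charlier_rec_integrable.
by rewrite IH exprS mulrA.
Qed.

Lemma exp_sub1_mul_integrable eta psi : testfun eta -> (forall x, 0 <= eta x) ->
  testfun psi -> Rintegrable sigma (fun x => (expR (- eta x) - 1) * psi x).
Proof.
move=> te e0 tp.
apply: (Rintegrable_bounded_mul (K := 1)).
- by have := Rintegrable_measurable (exp_sub1_integrable sigma_radon te e0).
- move=> x; have := expR_ge0 (- eta x).
  have : expR (- eta x) <= 1 by rewrite expR_le1 oppr_le0.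
  by move=> ? ?; rewrite ler_norml; apply/andP; split; lra.
- exact: testfun_integrable.
Qed.

Lemma charlier_kernel_integral n (psi : 'I_n -> E -> R) eta :
  (forall i, testfun (psi i)) -> testfun eta -> (forall x, 0 <= eta x) ->
  Rintegrable P (fun gamma => C gamma psi) /\
  \int[P]_gamma (expR (- pairing gamma eta) * C gamma psi) =
  (\prod_(i < n) \int[sigma]_x ((expR (- eta x) - 1) * psi i x)) *
  \int[P]_gamma expR (- pairing gamma eta).
Proof.
move=> tp te e0.
pose c (S : {set 'I_n}) : R := \prod_(i < n) (if i \in S then 1 else -1).
pose s (S : {set 'I_n}) : E -> R := fun x => \sum_(j in S) psi j x.
have ts S : testfun (s S) by exact: testfun_sum.
have n0 : n`!%:R != 0 :> R by rewrite pnatr_eq0 -lt0n fact_gt0.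
have CE gamma : C gamma psi = n`!%:R^-1 * \sum_(S : {set 'I_n}) c S * charlier_rec (s S) n gamma.
  apply: (mulfI n0); rewrite mulVKf//.
  rewrite (polarization testfunV0 testfunV_lin (@charlier_multilinear gamma n) tp).
    apply: eq_bigr => S _; congr (_ * _); rewrite -charlier_diag//; congr (C gamma _).
    by apply/funext => _; apply/funext => x; rewrite /s fct_sumE.
  by move=> p; have [_ h _] := C_charlier gamma; exact: h.
have iterm S : Rintegrable P (fun gamma => c S * charlier_rec (s S) n gamma).
  by apply: RintegrableZ; exact: charlier_rec_integrable.
have [isum _] := Rintegral_sum (index_enum {set 'I_n}) iterm.
have CE' : (fun gamma => C gamma psi) = fun gamma => n`!%:R^-1 *
    \sum_(S : {set 'I_n}) c S * charlier_rec (s S) n gamma by apply/funext.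
split; first by rewrite CE'; exact: RintegrableZ.
pose y i := \int[sigma]_x ((expR (- eta x) - 1) * psi i x).
have ys S : \int[sigma]_x ((expR (- eta x) - 1) * s S x) = \sum_(j in S) y j.
  have [_ e] := Rintegral_sum (enum S)
    (fun j => exp_sub1_mul_integrable te e0 (tp j)).
  rewrite -[RHS]big_enum -e.
  apply: eq_Rintegral => x _; rewrite /s mulr_sumr.
  by rewrite -[LHS]big_enum.
have eterm S : Rintegrable P (fun gamma => expR (- pairing gamma eta) * charlier_rec (s S) n gamma).
  apply: (Rintegrable_bounded_mul (K := 1)); [exact: measurable_exp_pairing|
    by move=> g; exact: exp_pairing_le1|exact: charlier_rec_integrable].
transitivity (n`!%:R^-1 * \sum_(S : {set 'I_n}) c S *
    ((\sum_(j in S) y j) ^+ n * \int[P]_gamma expR (- pairing gamma eta))).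
  transitivity (\int[P]_gamma (n`!%:R^-1 * \sum_(S : {set 'I_n}) c S *
      (expR (- pairing gamma eta) * charlier_rec (s S) n gamma))).
    apply: eq_Rintegral => g _; rewrite CE mulrCA mulr_sumr; congr (_ * _).
    by apply: eq_bigr => S _; ring.
  have [j1 j2] := Rintegral_sum (index_enum {set 'I_n}) (fun S => RintegrableZ (c S) (eterm S)).
  rewrite RintegralZl//; congr (_ * _); rewrite j2.
  apply: eq_bigr => S _; rewrite RintegralZl//; congr (_ * _).
  by rewrite charlier_rec_integral// ys.
apply: (mulfI n0); rewrite mulVKf// mulrA.
under eq_bigr do rewrite mulrA.
rewrite -mulr_suml; congr (_ * _).
(* The remaining signed sum of [n]-th powers is the polarization of the form [z |-> prod z_i] on the
   reals, read backwards. *)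
have := @polarization R R^o setT _ _ n (fun z => \prod_(i < n) z i) y.
move=> ->//.
- by apply: eq_bigr => S _; congr (_ * _); rewrite prodr_const card_ord.
- move=> z i a u v _ _ _ /=.
  rewrite (bigD1 i)//= eqxx [X in _ = a * X + _](bigD1 i)//= eqxx.
  rewrite [X in _ = _ + X](bigD1 i)//= eqxx.
  have eq0 w : \prod_(j < n | j != i) (if j == i then w else z j) = \prod_(j < n | j != i) z j.
    by apply: eq_bigr => j /negPf ->.
  by rewrite !eq0 /GRing.scale/=; ring.
- by move=> p; rewrite [RHS](reindex_perm p).
Qed.

End charlier_kernel.

(** * Chaos expansion and creation operator *)

Section Rintegral_pushforward.
Context d1 d2 (T1 : measurableType d1) (T2 : measurableType d2) (R : realType).
Variables (mu : {measure set T1 -> \bar R}) (h : T1 -> T2).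
Hypothesis mh : measurable_fun setT h.

Let nu : {measure set T2 -> \bar R} :=
  measure_function_pushforward__canonical__measure_function_Measure mu mh.

Lemma Rintegral_pushforward (f : T2 -> R) :
  measurable_fun setT f -> Rintegrable mu (fun x => f (h x)) ->
  Rintegrable nu f /\ \int[nu]_y f y = \int[mu]_x f (h x).
Proof.
move=> mf ifh.
have mfE : measurable_fun setT (EFin \o f) by exact/measurable_EFinP.
have iE : mu.-integrable (h @^-1` setT) ((EFin \o f) \o h) by rewrite preimage_setT.
split; first exact: (integrable_pushforward mh mfE iE measurableT).
by rewrite /Rintegral (integral_pushforward mh mfE iE measurableT) preimage_setT.
Qed.

End Rintegral_pushforward.

(** * The product powers of [sigma] *)

Section mpow.
Context (R : realType) (d : nat).
Let E := euclid R d.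
Variables (sigma : {sigma_finite_measure set E -> \bar R}).
Hypothesis sigma_radon : radon sigma.

Definition cube n (k : nat) : set (n.-tuple E) :=
  [set t | forall i, `|tnth t i| <= k%:R].

Lemma measurable_cube n k : measurable (@cube n k).
Proof.
rewrite (_ : @cube n k = \bigcap_(i in [set: 'I_n])
    (fun t : n.-tuple E => tnth t i) @^-1` [set x | `|x| <= k%:R]).
  apply: fin_bigcap_measurable => // i _.
  rewrite -[X in measurable X]setTI; apply: measurable_tnth => //.
  exact: measurable_norm_ball.
by apply/seteqP; split => t /= h i; [move=> _; exact: h|exact: h].
Qed.

Lemma tnth_tcons0 n (p : n.-tuple E * E) : tnth (tcons p) ord0 = p.2.
Proof. by rewrite (tnth_nth p.2). Qed.

Lemma tnth_tcons_lift n (p : n.-tuple E * E) i :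
  tnth (tcons p) (lift ord0 i) = tnth p.1 i.
Proof. by rewrite !(tnth_nth p.2). Qed.

Lemma mpow_cube_lty n k : (mpow sigma n (@cube n k) < +oo)%E.
Proof.
elim: n => [|n IH] /=.
  by rewrite diracE; case: (_ \in _); rewrite ltry.
rewrite /pushforward (_ : _ @^-1` _ = @cube n k `*` [set x | `|x| <= k%:R]).
  rewrite product_measure1E//; last exact: measurable_norm_ball.
    apply: lte_mul_pinfty => //.
      by rewrite ge0_fin_numE.
    by apply: sigma_radon; exact: compact_norm_ball.
  exact: measurable_cube.
apply/seteqP; split => [p /= h|p [/= h1 h2] i].
  split => [i|]; first by have := h (lift ord0 i); rewrite tnth_tcons_lift.
  by have := h ord0; rewrite tnth_tcons0.
by case: (unliftP ord0 i) => [j ->|->]; rewrite ?tnth_tcons_lift ?tnth_tcons0.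
Qed.

Lemma mpow_sigma_finite n : sigma_finite setT (mpow sigma n).
Proof.
exists (@cube n); last first.
  by move=> k; split; [exact: measurable_cube|exact: mpow_cube_lty].
apply/seteqP; split => // t _.
exists (\sum_(i < n) (Num.truncn `|tnth t i|).+1)%N => // i.
apply: (@le_trans _ _ (Num.truncn `|tnth t i|).+1%:R).
  by apply: ltW; exact: truncnS_gt.
by rewrite ler_nat (bigD1 i)//= leq_addr.
Qed.

(** A second name that carries the sigma-finite structure, which the product integral needs in the
    induction on [n]. *)
Definition mpow_sf n : set (n.-tuple E) -> \bar R := mpow sigma n.

HB.instance Definition _ n := Measure.on (@mpow_sf n).

HB.instance Definition _ n :=
  @Measure_isSigmaFinite.Build _ (n.-tuple E) R (@mpow_sf n) (mpow_sigma_finite n).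

Lemma Rintegral_mpow_prod n (f : 'I_n -> E -> R) :
  (forall i, Rintegrable sigma (f i)) ->
  Rintegrable (mpow sigma n) (fun t => \prod_(i < n) f i (tnth t i)) /\
  \int[mpow sigma n]_t (\prod_(i < n) f i (tnth t i)) = \prod_(i < n) \int[sigma]_x f i x.
Proof.
elim: n f => [|n IH] f fi.
  have -> : (fun t : 0.-tuple E => \prod_(i < 0) f i (tnth t i)) = fun=> 1.
    by apply/funext => t; rewrite big_ord0.
  rewrite big_ord0 /=; split; first exact: finite_measure_integrable_cst.
  have m0 : mpow sigma 0 [set: 0.-tuple E] = 1%E by rewrite /= diracE mem_set.
  by rewrite Rintegral_cst// m0 mulr1.
have [IH1 IH2] := IH (fun i => f (lift ord0 i)) (fun i => fi _).
have [i1 e1] := @Rintegral_prod _ _ _ _ _ (@mpow_sf n) sigma _ _ IH1 (fi ord0).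
have mf : measurable_fun setT (fun t : n.+1.-tuple E => \prod_(i < n.+1) f i (tnth t i)).
  apply: measurable_prod => i _; apply: measurableT_comp; last exact: measurable_tnth.
  exact: Rintegrable_measurable (fi i).
have fE : (fun p : n.-tuple E * E => \prod_(i < n.+1) f i (tnth (tcons p) i)) =
   fun p => (\prod_(i < n) f (lift ord0 i) (tnth p.1 i)) * f ord0 p.2.
  apply/funext => p /=; rewrite big_ord_recl tnth_tcons0 mulrC; congr (_ * _).
  by apply: eq_bigr => i _; rewrite tnth_tcons_lift.
have fiE : Rintegrable (mpow sigma n \x sigma)%E
    (fun p => \prod_(i < n.+1) f i (tnth (tcons p) i)).
  by rewrite fE.
have [j1 j2] := Rintegral_pushforward (measurable_tcons (n:=n)) mf fiE.
split; first exact: j1.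
rewrite fE in j2.
by rewrite big_ord_recl mulrC -IH2; exact: etrans j2 e1.
Qed.

End mpow.

(** * Complex [L^2] functions tested against real weights *)

Section part.
Context (R : realType).
Implicit Types (z : R[i]) (b : bool).

(** The boolean lets one real statement cover both parts of a complex identity. *)
Definition part b z : R := if b then complex.Im z else complex.Re z.

Lemma partD b z z' : part b (z + z') = part b z + part b z'.
Proof. by case: b z z' => -[? ?] [? ?]. Qed.

Lemma partB b z z' : part b (z - z') = part b z - part b z'.
Proof. by case: b z z' => -[? ?] [? ?]. Qed.

Lemma part_sum b (I : Type) (r : seq I) (P : pred I) (F : I -> R[i]) :
  part b (\sum_(i <- r | P i) F i) = \sum_(i <- r | P i) part b (F i).
Proof.
elim: r => [|i r IH]; first by rewrite !big_nil; case: b.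
by rewrite !big_cons; case: ifP => // _; rewrite partD IH.
Qed.

Lemma partMr b z (r : R) : part b (z * r%:C) = part b z * r.
Proof. by case: b z => -[x y] /=; ring. Qed.

Lemma normc_sqr z : Normc.normc z ^+ 2 = complex.Re z ^+ 2 + complex.Im z ^+ 2.
Proof. by case: z => x y /=; rewrite sqr_sqrtr// addr_ge0// sqr_ge0. Qed.

Lemma ler_part b z : `|part b z| <= Normc.normc z.
Proof.
rewrite -(@ler_pXn2r _ 2) ?nnegrE ?normr_ge0//; last first.
  by case: z => x y /=; exact: sqrtr_ge0.
by rewrite normc_sqr real_normK ?num_real//; case: b => /=; rewrite ?lerDl ?lerDr sqr_ge0.
Qed.

Lemma normc_ge0 z : 0 <= Normc.normc z.
Proof. by case: z => x y; exact: sqrtr_ge0. Qed.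

Lemma part_inj z z' : (forall b, part b z = part b z') -> z = z'.
Proof.
case: z z' => [x y] [x' y'] h.
by have /= -> := h false; have /= -> := h true.
Qed.

End part.

Section L2_tools.
Context d (T : measurableType d) (R : realType).
Variable mu : {measure set T -> \bar R}.
Implicit Types (f : T -> R[i]) (w : T -> R).

Definition measurable_parts f := forall b, measurable_fun setT (fun x => part b (f x)).

Lemma L2_measurable_parts f : L2 mu f -> measurable_parts f.
Proof. by move=> [mr mi _] []. Qed.

Lemma measurable_normc_sqr f : measurable_parts f ->
  measurable_fun setT (fun x => Normc.normc (f x) ^+ 2).
Proof.
move=> mf; under eq_fun do rewrite normc_sqr.
by apply: measurable_funD; apply: measurable_funX;
  [exact: (mf false)|exact: (mf true)].
Qed.

Lemma sqnorm_integrable f : measurable_parts f -> (sqnorm mu f < +oo)%E ->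
  Rintegrable mu (fun x => Normc.normc (f x) ^+ 2).
Proof.
move=> mf sf; apply/integrableP; split.
  by apply/measurable_EFinP; exact: measurable_normc_sqr.
apply: le_lt_trans sf; rewrite le_eqVlt; apply/orP; left; apply/eqP.
by apply: eq_integral => x _; rewrite /= ger0_norm// sqr_ge0.
Qed.

Lemma L2_sqr_integrable f : L2 mu f -> Rintegrable mu (fun x => Normc.normc (f x) ^+ 2).
Proof. by move=> Lf; apply: sqnorm_integrable; [exact: L2_measurable_parts|case: Lf]. Qed.

(** This weighted Young inequality does the work of Cauchy-Schwarz: [eps = 1] gives integrability of
    products, and small [eps] gives continuity in [L^2]. *)
Lemma mul_part_bound b (w1 : R) (z : R[i]) (eps : R) : 0 < eps ->
  `|w1 * part b z| <= eps * w1 ^+ 2 + eps^-1 * Normc.normc z ^+ 2.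
Proof.
move=> e0; rewrite normrM.
have h1 : 0 <= `|w1| := normr_ge0 _.
have h2 : 0 <= Normc.normc z := normc_ge0 z.
apply: (@le_trans _ _ (`|w1| * Normc.normc z)); first by rewrite ler_wpM2l// ler_part.
rewrite -(real_normK (num_real w1)).
rewrite -(ler_pM2l e0) mulrDr mulVKf ?gt_eqF//.
set a := `|w1| in h1 *; set c := Normc.normc z in h2 *.
have := sqr_ge0 (eps * a - c); have : 0 <= eps * a * c by rewrite !mulr_ge0// ltW.
by nra.
Qed.

Lemma mul_part_integrable b w f : measurable_fun setT w ->
  Rintegrable mu (fun x => w x ^+ 2) -> L2 mu f ->
  Rintegrable mu (fun x => w x * part b (f x)).
Proof.
move=> mw iw Lf.
apply: (Rintegrable_le (g := fun x => 1 * w x ^+ 2 + 1^-1 * Normc.normc (f x) ^+ 2)).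
- by apply: measurable_funM => //; exact: L2_measurable_parts.
- by apply: RintegrableD; apply: RintegrableZ => //; exact: L2_sqr_integrable.
- by move=> x; exact: mul_part_bound.
Qed.

Lemma L2cvg_integral b w (u : nat -> T -> R[i]) f : measurable_fun setT w ->
  Rintegrable mu (fun x => w x ^+ 2) -> L2 mu f ->
  (forall k, measurable_parts (u k)) ->
  (forall k, Rintegrable mu (fun x => w x * part b (u k x))) ->
  L2cvg mu u f ->
  (fun k => \int[mu]_x (w x * part b (u k x))) @ \oo --> \int[mu]_x (w x * part b (f x)).
Proof.
move=> mw iw Lf mu_ iu cu; apply/cvgrPdist_lt => e e0.
pose W := \int[mu]_x w x ^+ 2.
have W0 : 0 <= W by apply: Rintegral_ge0 => x _; exact: sqr_ge0.
have W1 : 0 < 2 * (W + 1) by rewrite mulr_gt0// ltr_wpDl.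
(* Chosen so that [eps W <= e / 2]; the other term is below [e / 2] once the squared distance is
   below [eps e / 2]. The [+ 1] covers [W = 0]. *)
pose eps := e / (2 * (W + 1)); have eps0 : 0 < eps by rewrite divr_gt0.
have small : \forall k \near \oo, (sqnorm mu (fun x => u k x - f x)%R < (eps * (e / 2))%:E)%E.
  have ee : (0%:E < (eps * (e / 2))%:E)%E by rewrite lte_fin mulr_gt0// divr_gt0.
  exact: cu _ (open_ereal_lt' ee).
near=> k.
have sk : (sqnorm mu (fun x => u k x - f x)%R < (eps * (e / 2))%:E)%E by near: k.
have mv : measurable_parts (fun x => u k x - f x).
  move=> b'; under eq_fun do rewrite partB.
  by apply: measurable_funB; [exact: mu_|exact: L2_measurable_parts].
have iv := sqnorm_integrable mv (lt_trans sk (ltry _)).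
set v := fun x => _ in iv.
have sv : \int[mu]_x v x < eps * (e / 2).
  by rewrite -lte_fin -RintegralE.
have iwf := mul_part_integrable b mw iw Lf.
rewrite distrC -RintegralB//.
have iwB := RintegrableB (iu k) iwf.
apply: le_lt_trans (le_normr_Rintegral measurableT iwB) _.
have iB : Rintegrable mu (fun x => eps * w x ^+ 2 + eps^-1 * v x).
  by apply: RintegrableD; exact: RintegrableZ.
apply: (@le_lt_trans _ _ (\int[mu]_x (eps * w x ^+ 2 + eps^-1 * v x))).
  apply: le_Rintegral => //; first exact: Rintegrable_norm.
  by move=> x _; rewrite -mulrBr -partB; exact: mul_part_bound.
rewrite RintegralD//; [|exact: RintegrableZ..].
rewrite !RintegralZl// -/W.
have h1 : eps * W <= e / 2.
  have W1' : 0 < W + 1 by rewrite ltr_wpDl.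
  rewrite (_ : eps * W = (e / 2) * (W / (W + 1))); last first.
    by rewrite /eps; field; rewrite gt_eqF.
  rewrite ler_piMr ?divr_ge0// ?(ltW e0)// ler_pdivrMr// mul1r lerDl//.
have h2 : eps^-1 * \int[mu]_x v x < e / 2 by rewrite mulrC ltr_pdivrMr// mulrC.
lra.
Unshelve. all: by end_near. Qed.

End L2_tools.

Section linear_extension.
Context d1 d2 (T1 : measurableType d1) (T2 : measurableType d2) (R : realType).
Variables (mu : {measure set T1 -> \bar R}) (nu : {measure set T2 -> \bar R}).
Variables (w : T1 -> R) (e : T2 -> R) (K : R).
Variable B : set ((T1 -> R[i]) * (T2 -> R[i])).
Hypothesis B_real : forall fG, B fG -> exists (f : T1 -> R) (G : T2 -> R),
  [/\ fG = ((fun x => (f x)%:C), (fun y => (G y)%:C)),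
      measurable_fun setT f, measurable_fun setT G,
      Rintegrable mu (fun x => w x * f x) /\ Rintegrable nu (fun y => e y * G y) &
      \int[nu]_y (e y * G y) = K * \int[mu]_x (w x * f x)].

Lemma linear_ext_integral b u : linear_ext B u ->
  [/\ measurable_parts u.1, measurable_parts u.2,
      Rintegrable mu (fun x => w x * part b (u.1 x)),
      Rintegrable nu (fun y => e y * part b (u.2 y)) &
      \int[nu]_y (e y * part b (u.2 y)) = K * \int[mu]_x (w x * part b (u.1 x))].
Proof.
move=> [m [c [g [Bg u1 u2]]]].
have /choice[f /choice[G fG]] : forall k, exists f, exists G, _ := fun k => B_real (Bg k).
have p1 b' x : part b' (u.1 x) = \sum_k part b' (c k) * f k x.
  rewrite u1 part_sum; apply: eq_bigr => k _.
  by have [-> _ _ _ _] := fG k; rewrite partMr.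
have p2 b' y : part b' (u.2 y) = \sum_k part b' (c k) * G k y.
  rewrite u2 part_sum; apply: eq_bigr => k _.
  by have [-> _ _ _ _] := fG k; rewrite partMr.
have e1 : (fun x => w x * part b (u.1 x)) =
    fun x => \sum_(k < m) part b (c k) * (w x * f k x).
  by apply/funext => x; rewrite p1 mulr_sumr; apply: eq_bigr => k _; rewrite mulrCA.
have e2 : (fun y => e y * part b (u.2 y)) =
    fun y => \sum_(k < m) part b (c k) * (e y * G k y).
  by apply/funext => y; rewrite p2 mulr_sumr; apply: eq_bigr => k _; rewrite mulrCA.
have if_ k : Rintegrable mu (fun x => w x * f k x) by case: (fG k) => _ _ _ [].
have iG_ k : Rintegrable nu (fun y => e y * G k y) by case: (fG k) => _ _ _ [].
have [i1 j1] := Rintegral_sum (index_enum 'I_m) (fun k => RintegrableZ (part b (c k)) (if_ k)).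
have [i2 j2] := Rintegral_sum (index_enum 'I_m) (fun k => RintegrableZ (part b (c k)) (iG_ k)).
split.
- move=> b'; under eq_fun do rewrite p1; apply: measurable_sum => k.
  by apply: measurable_funM => //; have [] := fG k.
- move=> b'; under eq_fun do rewrite p2; apply: measurable_sum => k.
  by apply: measurable_funM => //; have [] := fG k.
- by rewrite e1.
- by rewrite e2.
- rewrite e1 e2 j1 j2 mulr_sumr; apply: eq_bigr => k _.
  by rewrite !RintegralZl//; have [_ _ _ _ ->] := fG k; rewrite mulrCA.
Qed.

Hypotheses (mw : measurable_fun setT w) (me : measurable_fun setT e).
Hypotheses (iw : Rintegrable mu (fun x => w x ^+ 2)).
Hypotheses (ie : Rintegrable nu (fun y => e y ^+ 2)).

(** Both sides are [L^2]-continuous because the weights are square integrable, so the identity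
    passes from the generators to the closure of the graph without any operator bound. *)
Lemma L2_ext_integral b f G : L2_ext mu nu (linear_ext B) (f, G) ->
  \int[nu]_y (e y * part b (G y)) = K * \int[mu]_x (w x * part b (f x)).
Proof.
move=> [/= Lf LG [u [Bu c1 c2]]].
have h k := linear_ext_integral b (Bu k).
have l1 : (fun k => \int[mu]_x (w x * part b ((u k).1 x))) @ \oo -->
    \int[mu]_x (w x * part b (f x)).
  by apply: L2cvg_integral => // k; have [] := h k.
have l2 : (fun k => \int[nu]_y (e y * part b ((u k).2 y))) @ \oo -->
    \int[nu]_y (e y * part b (G y)).
  by apply: L2cvg_integral => // k; have [] := h k.
apply: (cvg_unique _ l2) => //.
rewrite (_ : (fun k => _) = fun k => K * \int[mu]_x (w x * part b ((u k).1 x))).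
  by apply: cvgM => //; exact: cvg_cst.
by apply/funext => k; have [] := h k.
Qed.

End linear_extension.

Section chaos.
Context (R : realType) (d : nat).
Let E := euclid R d.
Variables (sigma : {sigma_finite_measure set E -> \bar R}).
Hypothesis sigma_radon : radon sigma.

Definition real_symtensor n (psi : 'I_n -> E -> R) (t : n.-tuple E) : R :=
  n`!%:R^-1 * \sum_(s : 'S_n) \prod_(i < n) psi (s i) (tnth t i).

Lemma symtensor_real n (psi : 'I_n -> E -> R) :
  symtensor (fun i x => (psi i x)%:C) = fun t => (real_symtensor psi t)%:C.
Proof.
apply/funext => t; rewrite /symtensor /real_symtensor rmorphM fmorphV rmorph_nat.
congr (_ * _); rewrite rmorph_sum; apply: eq_bigr => s _.
by rewrite rmorph_prod.
Qed.

Lemma measurable_real_symtensor n (psi : 'I_n -> E -> R) :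
  (forall i, measurable_fun setT (psi i)) ->
  measurable_fun setT (real_symtensor psi).
Proof.
move=> mpsi; apply: measurable_funM => //; apply: measurable_sum => s.
apply: measurable_prod => i _.
by apply: measurableT_comp (measurable_tnth i) => //; exact: mpsi.
Qed.

Lemma real_symtensor_cst n (psi : E -> R) (t : n.-tuple E) :
  real_symtensor (fun=> psi) t = \prod_(i < n) psi (tnth t i).
Proof.
by rewrite /real_symtensor sumr_const card_Sn -[X in _ * X]mulr_natl mulKf.
Qed.

(** The weight [chi^(tensor n)] is symmetric, so all permutations in the symmetrization give the
    same product. *)
Lemma Rintegral_symtensor n (chi : E -> R) (psi : 'I_n -> E -> R) :
  (forall i, Rintegrable sigma (fun x => chi x * psi i x)) ->
  Rintegrable (mpow sigma n)
    (fun t => (\prod_(i < n) chi (tnth t i)) * real_symtensor psi t) /\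
  \int[mpow sigma n]_t ((\prod_(i < n) chi (tnth t i)) * real_symtensor psi t) =
  \prod_(i < n) \int[sigma]_x (chi x * psi i x).
Proof.
move=> ipsi.
have hs (s : 'S_n) := Rintegral_mpow_prod sigma_radon (fun i => ipsi (s i)).
have -> : (fun t : n.-tuple E => (\prod_(i < n) chi (tnth t i)) * real_symtensor psi t) =
    fun t => n`!%:R^-1 * \sum_(s : 'S_n) \prod_(i < n) (chi (tnth t i) * psi (s i) (tnth t i)).
  apply/funext => t; rewrite /real_symtensor mulrCA mulr_sumr; congr (_ * _).
  by apply: eq_bigr => s _; rewrite big_split.
have [i1 j1] := Rintegral_sum (index_enum 'S_n) (fun s => (hs s).1).
split; first exact: RintegrableZ.
rewrite RintegralZl// j1.
under eq_bigr => s _ do rewrite (hs s).2.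
have hp (s : 'S_n) : \prod_(i < n) \int[sigma]_x (chi x * psi (s i) x) =
    \prod_(i < n) \int[sigma]_x (chi x * psi i x) by rewrite [RHS](reindex_perm s).
under eq_bigr => s _ do rewrite hp.
by rewrite sumr_const card_Sn -[X in _ * X]mulr_natl mulKf.
Qed.

Variable eta : E -> R.
Hypotheses (eta_test : testfun eta) (eta_ge0 : forall x, 0 <= eta x).

Definition expm1N (x : E) : R := expR (- eta x) - 1.
Definition expm1N_prod n (t : n.-tuple E) : R := \prod_(i < n) expm1N (tnth t i).

Lemma expm1N_integrable : Rintegrable sigma expm1N.
Proof. exact: exp_sub1_integrable. Qed.

Lemma measurable_expm1N : measurable_fun setT expm1N.
Proof.
apply: measurable_funB => //; apply: measurableT_comp => //.
by apply: measurableT_comp => //; exact: testfun_measurable.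
Qed.

Lemma expm1N_le1 x : `|expm1N x| <= 1.
Proof.
have := expR_ge0 (- eta x).
have : expR (- eta x) <= 1 by rewrite expR_le1 oppr_le0.
by move=> ? ?; rewrite ler_norml /expm1N; apply/andP; split; lra.
Qed.

Lemma expm1N_sqr_integrable : Rintegrable sigma (fun x => expm1N x * expm1N x).
Proof.
apply: (Rintegrable_bounded_mul (K := 1)); [exact: measurable_expm1N|
  exact: expm1N_le1|exact: expm1N_integrable].
Qed.

Lemma measurable_expm1N_prod n : measurable_fun setT (@expm1N_prod n).
Proof.
apply: measurable_prod => i _.
by apply: measurableT_comp (measurable_tnth i) => //; exact: measurable_expm1N.
Qed.

Lemma expm1N_prod_sqr_integrable n :
  Rintegrable (mpow sigma n) (fun t => @expm1N_prod n t ^+ 2).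
Proof.
have [h _] := Rintegral_mpow_prod sigma_radon (fun _ : 'I_n => expm1N_sqr_integrable).
rewrite (_ : (fun t => _) = fun t : n.-tuple E =>
  \prod_(i < n) (expm1N (tnth t i) * expm1N (tnth t i)))//.
by apply/funext => t; rewrite expr2 -big_split.
Qed.

Variable C : kernel_family R d.
Hypothesis C_charlier : is_charlier sigma C.
Variable P : probability (conf R d) R.
Hypothesis P_poisson : poisson sigma P.

Let e gamma := expR (- pairing gamma eta).

Let me : measurable_fun setT e. Proof. exact: measurable_exp_pairing. Qed.

Let ie : Rintegrable P (fun gamma => e gamma ^+ 2).
Proof.
apply: (@probability_integrable_bounded _ _ _ _ 1); first exact: measurable_funX.
by move=> gamma; rewrite normrX expr_le1// exp_pairing_le1.
Qed.

Lemma charlier_pairing_integral b n f G : @charlier_pairing _ _ sigma P C n (f, G) ->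
  \int[P]_gamma (e gamma * part b (G gamma)) =
  (\int[P]_gamma e gamma) * \int[mpow sigma n]_t (expm1N_prod t * part b (f t)).
Proof.
apply: L2_ext_integral => //; last 2 first.
- exact: measurable_expm1N_prod.
- exact: expm1N_prod_sqr_integrable.
move=> fG [psi [tpsi fE GE]]; exists (real_symtensor psi), (fun gamma => C gamma psi).
have [i1 j1] := charlier_kernel_integral sigma_radon C_charlier P_poisson tpsi eta_test eta_ge0.
have [i2 j2] := Rintegral_symtensor
  (fun i => exp_sub1_mul_integrable sigma_radon eta_test eta_ge0 (tpsi i)).
split.
- by rewrite [fG]surjective_pairing fE GE symtensor_real.
- by apply: measurable_real_symtensor => i; exact: testfun_measurable.
- exact: Rintegrable_measurable i1.
- split=> //; apply: (Rintegrable_bounded_mul (K := 1)) => // gamma.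
  exact: exp_pairing_le1.
- by rewrite j1 j2 mulrC.
Qed.

(** The exponential is its mean times the coherent state with components [chi^(tensor n) / n!], and
    the [n!] of the Fock norm cancels. The series stays a limit of partial sums, the form in which
    [chaos_iso] provides it. *)
Lemma chaos_iso_integral b f g : chaos_iso sigma P C (f, g) ->
  (fun N => (\int[P]_gamma e gamma) *
    \sum_(n < N) \int[mpow sigma n]_t (expm1N_prod t * part b (f n t))) @ \oo -->
  \int[P]_gamma (e gamma * part b (g gamma)).
Proof.
move=> [/= Ff Lg [G [fG cG]]].
have LG n : L2 P (G n) by have [] := fG n.
have iG n : Rintegrable P (fun gamma => e gamma * part b (G n gamma)).
  exact: mul_part_integrable.
have sE N : (fun gamma => e gamma * part b (\sum_(n < N) G n gamma)) =
    fun gamma => \sum_(n < N) e gamma * part b (G n gamma).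
  by apply/funext => gamma; rewrite part_sum mulr_sumr.
have hN N := Rintegral_sum (index_enum 'I_N) (fun n : 'I_N => iG n).
rewrite (_ : (fun N => _) = fun N =>
    \int[P]_gamma (e gamma * part b (\sum_(n < N) G n gamma))).
  apply: L2cvg_integral => //.
    move=> N b'; under eq_fun do rewrite part_sum; apply: measurable_sum => n.
    exact: L2_measurable_parts (LG n) b'.
  by move=> N; rewrite sE; exact: (hN N).1.
apply/funext => N; rewrite sE (hN N).2 mulr_sumr; apply: eq_bigr => n _.
by rewrite (charlier_pairing_integral b (fG n)).
Qed.

End chaos.

Lemma part_conjc (R : realType) b (z : R[i]) : part b (conjc z) = (-1) ^+ b * part b z.
Proof. by case: b z => -[x y] /=; rewrite ?mulN1r ?mul1r. Qed.

Lemma part_cint d (T : measurableType d) (R : realType)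
    (mu : {measure set T -> \bar R}) b (f : T -> R[i]) :
  part b (cint mu f) = \int[mu]_x part b (f x).
Proof. by case: b. Qed.

Lemma lim_series_single (R : realType) (a : nat -> R) n :
  (forall m, m != n -> a m = 0) -> limn (series a) = a n.
Proof.
move=> a0; apply: lim_near_cst; first exact: Rhausdorff.
near=> N.
have nN : (n < N)%N by near: N; exact: nbhs_infty_gt.
rewrite /series/= big_mkord (bigD1 (Ordinal nN))//= big1 ?addr0// => m mn.
by apply: a0; apply: contra mn => /eqP mn; apply/eqP/val_inj.
Unshelve. all: by end_near. Qed.

Section creation.
Context (R : realType) (d : nat).
Let E := euclid R d.
Variables (sigma : {sigma_finite_measure set E -> \bar R}).
Hypothesis sigma_radon : radon sigma.
Variable eta : E -> R.
Hypotheses (eta_test : testfun eta) (eta_ge0 : forall x, 0 <= eta x).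

Let chi := expm1N eta.
Let w n := @expm1N_prod R d eta n.

(** The multiple [a chi^(tensor n)] in degree [n]: the homogeneous pieces of the coherent state,
    which lie in the domain of annihilation. *)
Definition fock_at (n : nat) (a : R) : fockvec R d :=
  fun m t => ((m == n)%:R * a * w t)%:C.
Arguments fock_at : clear implicits.

Lemma real_L2 d' (T : measurableType d') (mu : {measure set T -> \bar R}) (v : T -> R) :
  measurable_fun setT v -> Rintegrable mu (fun x => v x ^+ 2) ->
  L2 mu (fun x => (v x)%:C).
Proof.
move=> mv iv; split => //.
rewrite /sqnorm; under eq_integral => x _ do rewrite normc_sqr /= expr0n addr0.
by rewrite RintegralE// ltry.
Qed.

Lemma fock_at_L2 n a m : L2 (mpow sigma m) (fock_at n a m).
Proof.
apply: real_L2; first by apply: measurable_funM => //; exact: measurable_expm1N_prod.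
under eq_fun do rewrite exprMn.
by apply: RintegrableZ; exact: expm1N_prod_sqr_integrable.
Qed.

Lemma fock_at_Fock n a : Fock sigma (fock_at n a).
Proof.
split=> [m|].
  split; first exact: fock_at_L2.
  move=> s; apply: aeW => t /=; rewrite /fock_at; congr (_ * _)%:C.
  rewrite /w /expm1N_prod [RHS](reindex_perm s); apply: eq_bigr => i _.
  by rewrite tnth_mktuple.
rewrite (nneseries_split 0 n.+1)//; last first.
  by move=> k _; apply: mule_ge0 => //; apply: integral_ge0 => t _; rewrite lee_fin sqr_ge0.
rewrite add0n eseries0 ?adde0.
  rewrite big_mkord; apply: lte_sum_pinfty => k _.
  by apply: lte_mul_pinfty => //; have [] := fock_at_L2 n a k.
move=> m nm _; rewrite /sqnorm (eq_integral (cst 0%E)) ?integral0 ?mule0// => t _.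
by rewrite /fock_at gtn_eqF// !mul0r /= expr0n addr0 sqrtr0 expr0n.
Qed.

Lemma Fock_dot_at b n a (f : fockvec R d) : Fock sigma f ->
  part b (Fock_dot sigma (fock_at n a) f) =
  n`!%:R * ((-1) ^+ b * (a * \int[mpow sigma n]_t (w t * part b (f n t)))).
Proof.
move=> [fE _].
pose u m := part b (m`!%:R * L2dot (mpow sigma m) (fock_at n a m) (f m)).
have -> : part b (Fock_dot sigma (fock_at n a) f) = limn (series u).
  by rewrite /Fock_dot; case: (b) @u.
have uE m : u m = m`!%:R * \int[mpow sigma m]_t
    ((m == n)%:R * a * ((-1) ^+ b * (w t * part b (f m t)))).
  rewrite /u mulrC -(rmorph_nat (real_complex R)) partMr mulrC; congr (_ * _).
  rewrite part_cint; apply: eq_Rintegral => t _.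
  by rewrite /fock_at mulrC partMr part_conjc; ring.
rewrite (lim_series_single (n := n)).
  have i1 : Rintegrable (mpow sigma n) (fun t => w t * part b (f n t)).
    apply: mul_part_integrable; [exact: measurable_expm1N_prod|
      exact: expm1N_prod_sqr_integrable|by case: (fE n)].
  rewrite uE eqxx mul1r RintegralZl//; last exact: RintegrableZ.
  by rewrite RintegralZl//; congr (_ * _); rewrite mulrCA.
move=> m mn; rewrite uE (negPf mn).
under eq_Rintegral do rewrite !mul0r.
by rewrite /Rintegral integral0 mulr0.
Qed.

Variable phi : E -> R.
Hypothesis phi_test : testfun phi.
Let c := \int[sigma]_x (chi x * phi x).

(** For [n = 0] the convention [n.-1 = 0] is harmless, since the factor [n%:R] makes the image
    zero. *)
Lemma annihilation_fock_at n :
  annihilation sigma phi (fock_at n 1, fock_at n.-1 (n%:R * c)).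
Proof.
split=> /=; [exact: fock_at_Fock|exact: fock_at_Fock| |].
  exists n.+1 => m nm; apply: aeW => t.
  by rewrite /fock_at gtn_eqF// !mul0r.
move=> m; split; [exact: fock_at_L2|exact: fock_at_L2|].
(* Each component is already a multiple of a generator, with coefficient 1 or 0 according to the
   degree, so a constant sequence approximates it. *)
exists (fun=> (fock_at n 1 m.+1, fock_at n.-1 (n%:R * c) m)); split; first last.
- rewrite /L2cvg; under eq_fun do under [X in sqnorm _ X]eq_fun do rewrite subrr.
  apply: cvg_near_cst; apply: nearW => k.
  rewrite /sqnorm (eq_integral (cst 0%E)) ?integral0// => t _.
  by rewrite /= expr0n addr0 sqrtr0 expr0n.
- rewrite /L2cvg; under eq_fun do under [X in sqnorm _ X]eq_fun do rewrite subrr.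
  apply: cvg_near_cst; apply: nearW => k.
  rewrite /sqnorm (eq_integral (cst 0%E)) ?integral0// => t _.
  by rewrite /= expr0n addr0 sqrtr0 expr0n.
move=> _; exists 1%N, (fun=> (m.+1 == n)%:R).
exists (fun=> (symtensor (fun (_ : 'I_m.+1) x => (chi x)%:C),
  fun t => \sum_(j < m.+1) cint sigma (fun x => (phi x)%:C * (chi x)%:C)
            * symtensor (fun (_ : 'I_m) x => (chi x)%:C) t)); split.
- move=> _; exists (fun _ x => (chi x)%:C); split=> //= i.
  apply: real_L2; first exact: measurable_expm1N.
  under eq_fun do rewrite expr2; exact: expm1N_sqr_integrable.
- move=> t /=; rewrite big_ord1 symtensor_real real_symtensor_cst /fock_at mulr1.
  by rewrite rmorphM rmorph_nat.
move=> t /=; rewrite big_ord1 sumr_const card_ord symtensor_real real_symtensor_cst.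
have -> : cint sigma (fun x => (phi x)%:C * (chi x)%:C) = c%:C.
  apply: part_inj => b; rewrite part_cint; case: b => /=.
    by under eq_Rintegral do rewrite mulr0 mul0r addr0; rewrite /Rintegral integral0.
  by apply: eq_Rintegral => x _; rewrite mulr0 subr0 mulrC.
rewrite /fock_at -[_ *+ m.+1]mulr_natl -(rmorph_nat (real_complex R) m.+1).
rewrite -(rmorph_nat (real_complex R) (m.+1 == n)) -!rmorphM; congr _%:C.
rewrite mulrA -/(w t) !mulrA; congr (_ * _ * _).
by case: n => [|n]; rewrite ?eqSS /= ?mulr0 ?mul0r//; case: eqP => [->|]; rewrite ?mul0r.
Qed.

Lemma creation_integral b f f' n : creation sigma phi (f, f') ->
  n`!%:R * \int[mpow sigma n]_t (w t * part b (f' n t)) =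
  (n.-1)`!%:R * (n%:R * c * \int[mpow sigma n.-1]_t (w t * part b (f n.-1 t))).
Proof.
move=> [/= Ff Ff' /(_ _ _ (annihilation_fock_at n))/(congr1 (part b))].
rewrite !Fock_dot_at// mul1r => /esym.
(* [Fock_dot] conjugates its second argument, which produces the same sign on both sides. *)
have sN : ((-1) ^+ b : R) != 0 by rewrite signr_eq0.
rewrite ![_`!%:R * (_ * _)]mulrCA.
by move/(mulfI sN).
Qed.

Lemma creation_integral0 b f f' : creation sigma phi (f, f') ->
  \int[mpow sigma 0]_t (w t * part b (f' 0 t)) = 0.
Proof. by move=> /(creation_integral b 0); rewrite fact0 mul1r mul0r mul0r mulr0. Qed.

Lemma creation_integralS b f f' n : creation sigma phi (f, f') ->
  \int[mpow sigma n.+1]_t (w t * part b (f' n.+1 t)) =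
  c * \int[mpow sigma n]_t (w t * part b (f n t)).
Proof.
move=> /(creation_integral b n.+1) /=; rewrite factS natrM => h.
have n0 : n.+1%:R * n`!%:R != 0 :> R by rewrite -natrM pnatr_eq0 -lt0n muln_gt0 fact_gt0.
by apply: (mulfI n0); rewrite h; ring.
Qed.

Variable C : kernel_family R d.
Hypothesis C_charlier : is_charlier sigma C.
Variable P : probability (conf R d) R.
Hypothesis P_poisson : poisson sigma P.

Lemma creation_on_conf_integral b g k : creation_on_conf sigma P C phi (g, k) ->
  \int[P]_gamma (expR (- pairing gamma eta) * part b (k gamma)) =
  c * \int[P]_gamma (expR (- pairing gamma eta) * part b (g gamma)).
Proof.
move=> [/= f' [/= f fg ff'] fk].
have cg := chaos_iso_integral (b := b) sigma_radon eta_test eta_ge0 C_charlier P_poisson fg.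
have ck := chaos_iso_integral (b := b) sigma_radon eta_test eta_ge0 C_charlier P_poisson fk.
(* Creation raises degrees by one and leaves nothing in degree 0, so [N + 1] terms of the expansion
   of [k] match [N] terms of that of [g]. *)
move/(cvg_comp _ _ (cvg_addnr 1)) : ck => ck.
apply: (cvg_unique _ ck) => //.
rewrite (_ : _ \o _ = fun N => c * ((\int[P]_gamma expR (- pairing gamma eta)) *
    \sum_(n < N) \int[mpow sigma n]_t (w t * part b (f n t)))).
  by apply: cvgM => //; exact: cvg_cst.
apply/funext => N /=; rewrite addn1 big_ord_recl (creation_integral0 b ff') add0r.
rewrite [RHS]mulrCA [in RHS]mulr_sumr; congr (_ * _); apply: eq_bigr => n _.
exact: (creation_integralS b n ff').
Qed.

End creation.

(** * The adjoint of the difference operator *)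

Section Cb_infty_cos.
Context (R : realType).

(** Each derivative shifts the phase by [pi / 2] and multiplies the amplitude, so every iterated
    derivative is bounded by its amplitude. *)
Lemma iter_derive_cos (vs : seq 'rV[R]_1) (a theta : R) :
  exists b theta', iter_derive vs (fun y => a * cos (y 0 0 + theta)) =
    fun y => b * cos (y 0 0 + theta').
Proof.
elim: vs => [|v vs [b [theta' IH]]]; first by exists a, theta.
exists (b * v 0 0), (theta' + pi / 2).
rewrite /iter_derive/= -/(iter_derive vs _) IH; apply/funext => y.
have dh (t : R) : is_derive t 1 (fun t => b * cos (t + theta')) (- (b * sin (t + theta'))).
  have d1 : is_derive t 1 (fun t : R => t + theta') 1.
    by rewrite -[X in is_derive _ _ _ X]addr0; exact: is_deriveD.
  have d2 : is_derive t 1 (cos \o (fun t : R => t + theta')) (- sin (t + theta') * 1).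
    exact: is_derive1_comp (is_derive_cos _) d1.
  by apply: is_derive_eq (is_deriveZ b d2) _; rewrite mulr1 [LHS]mulrN.
have [dt dE] := dh (y 0 0).
have dc : differentiable (fun y : 'rV[R]_1 => y 0 0) y by exact: differentiable_coord.
have [_ ->] := derive_comp v dc dt.
by rewrite derive1E dE derive_coord addrA cosDpihalf; ring.
Qed.

Lemma Cb_infty_cos (a theta : R) : Cb_infty (fun y : 'rV[R]_1 => a * cos (y 0 0 + theta)).
Proof.
split=> vs; have [b [theta' ->]] := iter_derive_cos vs a theta.
  move=> y; apply: (differentiable_comp (f := fun y : 'rV[R]_1 => y 0 0)
    (g := fun t => b * cos (t + theta'))); first exact: differentiable_coord.
  by apply/derivable1_diffP.
exists `|b| => y; rewrite normrM -[leRHS]mulr1 ler_wpM2l//.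
by rewrite ler_norml cos_geN1 cos_le1.
Qed.

End Cb_infty_cos.

Section L2dot_tools.
Context d (T : measurableType d) (R : realType).
Variable mu : {measure set T -> \bar R}.
Implicit Types u v : T -> R[i].

Lemma ae_eq_Rintegral_mul (w f g : T -> R) : measurable_fun setT w ->
  measurable_fun setT f -> measurable_fun setT g -> {ae mu, forall x, f x = g x} ->
  \int[mu]_x (w x * f x) = \int[mu]_x (w x * g x).
Proof.
move=> mw mf mg fg; congr fine; apply: ae_eq_integral => //.
- by apply/measurable_EFinP; exact: measurable_funM.
- by apply/measurable_EFinP; exact: measurable_funM.
- by apply: filterS fg => x -> _.
Qed.

(** Integrability is asked of the products themselves, because the lemma is also applied to [Af],
    whose membership in [L^2] has not been established. *)
Lemma part_L2dot b u v :
  (forall b', Rintegrable mu (fun x => part (b (+) b') (u x) * part b' (v x))) ->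
  part b (L2dot mu u v) =
  \int[mu]_x (part b (u x) * part false (v x)) +
  (-1) ^+ b * \int[mu]_x (part (~~ b) (u x) * part true (v x)).
Proof.
move=> i; have := i false; have := i true; rewrite addbT addbF => i1 i0.
rewrite /L2dot part_cint -RintegralZl// -RintegralD//; last exact: RintegrableZ.
apply: eq_Rintegral => x _; case: (u x) (v x) => [x1 y1] [x2 y2].
by case: b {i i0 i1} => /=; ring.
Qed.

Lemma probability_L2_integrable (P : probability T R) b u : L2 P u ->
  Rintegrable P (fun x => part b (u x)).
Proof.
move=> Lu; rewrite (_ : (fun x => _) = fun x => cst 1 x * part b (u x)).
  apply: mul_part_integrable => //; under eq_fun do rewrite expr1n.
  exact: finite_measure_integrable_cst.
by apply/funext => x; rewrite mul1r.
Qed.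

End L2dot_tools.

Section adjoint.
Context (R : realType) (d : nat).
Let E := euclid R d.
Variables (sigma : {sigma_finite_measure set E -> \bar R}).
Hypothesis sigma_radon : radon sigma.
Hypothesis sigma_nonatomic : nonatomic sigma.
Variable P : probability (conf R d) R.
Hypothesis P_poisson : poisson sigma P.
Variable phi : E -> R.
Hypothesis phi_test : testfun phi.
Implicit Types g h k : conf R d -> R[i].

Definition nabla_star_part b g := nabla_star sigma phi (fun gamma => part b (g gamma)).

Lemma nabla_star_part_integrable b g : L2 P g -> Rintegrable P (nabla_star_part b g).
Proof. by move=> Lg; apply: nabla_star_integrable => //; exact: probability_L2_integrable. Qed.

Lemma creation_on_conf_ae (C : kernel_family R d) b g k : is_charlier sigma C ->
  creation_on_conf sigma P C phi (g, k) ->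
  {ae P, forall gamma, part b (k gamma) = nabla_star_part b g gamma}.
Proof.
move=> C_charlier gk.
have [Lg Lk] : L2 P g /\ L2 P k.
  by case: gk => /= f' [/= f [_ Lg _] _] [_ Lk _].
have ik := probability_L2_integrable b Lk.
have ig := nabla_star_part_integrable b Lg.
have : {ae P, forall gamma, part b (k gamma) - nabla_star_part b g gamma = 0}.
  apply: (@mclass_orthogonal _ _ _ _ (@exp_family R d)).
  - exists (fun=> 0); split=> //; first exact: testfun0.
    by apply/funext => gamma; rewrite pairing0 oppr0 expR0.
  - by move=> _ [psi [tpsi _ ->]]; exact: measurable_exp_pairing.
  - exact: exp_family_bounded.
  - exact: exp_family_generates.
  - exact: RintegrableB.
  move=> _ [eta [te e0 ->]].
  have iM (X : conf R d -> R) : Rintegrable P X ->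
      Rintegrable P (fun gamma => expR (- pairing gamma eta) * X gamma).
    move=> iX; apply: (Rintegrable_bounded_mul (K := 1)) => //.
      exact: measurable_exp_pairing.
    by move=> gamma; exact: exp_pairing_le1.
  under eq_Rintegral do rewrite mulrBr.
  rewrite RintegralB//; [|exact: iM..].
  rewrite nabla_star_exp//; last exact: probability_L2_integrable.
  by rewrite (creation_on_conf_integral sigma_radon te e0 C_charlier P_poisson b gk) subrr.
by apply: filterS => gamma /eqP; rewrite subr_eq0 => /eqP.
Qed.

(** The two indices are independent, since the complex inner product mixes real and imaginary
    parts. *)
Lemma nablaP_integral b b' g f Af : L2 P g -> nablaP sigma phi (f, Af) ->
  [/\ measurable_fun setT (fun gamma => part b (f gamma)),
      exists K, forall gamma, `|part b (f gamma)| <= K,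
      Rintegrable P (fun gamma => part b (Af gamma) * part b' (g gamma)) &
      \int[P]_gamma (part b (f gamma) * nabla_star_part b' g gamma) =
      \int[P]_gamma (part b (Af gamma) * part b' (g gamma))].
Proof.
move=> Lg [/= [N [psi [F [tpsi FRe FIm ->]]]] ->].
have [sF /(_ [::])[K FK]] : Cb_infty (fun y => part b (F y)) by case: b.
have cF := smooth_continuous sF.
have [i1 e1] := nabla_star_cylinder sigma_radon sigma_nonatomic P_poisson phi_test
  (probability_L2_integrable b' Lg) tpsi cF FK.
split.
- exact: (cylinder_measurable tpsi cF).
- by exists K => gamma; exact: FK.
- rewrite (_ : (fun gamma => _) = fun gamma => (\int[sigma]_x
     ((part b (F (\row_i pairing (conf_add gamma x) (psi i))) -
       part b (F (\row_i pairing gamma (psi i)))) * phi x)) * part b' (g gamma)) //.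
  apply/funext => gamma; rewrite part_cint; congr (_ * _).
  by apply: eq_Rintegral => x _; rewrite partMr partB.
- rewrite /nabla_star_part e1; apply: eq_Rintegral => gamma _.
  rewrite part_cint; congr (_ * _).
  by apply: eq_Rintegral => x _; rewrite partMr partB.
Qed.

Lemma part_L2dot_nablaP b g f Af : L2 P g -> nablaP sigma phi (f, Af) ->
  part b (L2dot P Af g) =
  \int[P]_gamma (part b (f gamma) * nabla_star_part false g gamma) +
  (-1) ^+ b * \int[P]_gamma (part (~~ b) (f gamma) * nabla_star_part true g gamma).
Proof.
move=> Lg fA; rewrite part_L2dot.
  have [_ _ _ ->] := nablaP_integral b false Lg fA.
  by have [_ _ _ ->] := nablaP_integral (~~ b) true Lg fA.
by move=> b'; have [] := nablaP_integral (b (+) b') b' Lg fA.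
Qed.

Lemma part_L2dot_cylinder b k f Af : L2 P k -> nablaP sigma phi (f, Af) ->
  part b (L2dot P f k) =
  \int[P]_gamma (part b (f gamma) * part false (k gamma)) +
  (-1) ^+ b * \int[P]_gamma (part (~~ b) (f gamma) * part true (k gamma)).
Proof.
move=> Lk fA; rewrite part_L2dot// => b'.
have [mf [K fK] _ _] := nablaP_integral (b (+) b') b' Lk fA.
by apply: Rintegrable_bounded_mul mf fK _; exact: probability_L2_integrable.
Qed.

(** An [L^2] function that agrees almost everywhere with the formula is what places [g] in the
    domain of the adjoint. *)
Lemma nablaP_adj_intro g k : L2 P g -> L2 P k ->
  (forall b, {ae P, forall gamma, part b (k gamma) = nabla_star_part b g gamma}) ->
  nablaP_adj sigma P phi (g, k).
Proof.
move=> Lg Lk gk; split=> //= f Af fA; apply: part_inj => b.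
rewrite (part_L2dot_nablaP b Lg fA) (part_L2dot_cylinder b Lk fA).
have eq b1 b2 : \int[P]_gamma (part b1 (f gamma) * part b2 (k gamma)) =
    \int[P]_gamma (part b1 (f gamma) * nabla_star_part b2 g gamma).
  apply: ae_eq_Rintegral_mul => //.
  - by have [] := nablaP_integral b1 b2 Lg fA.
  - exact: (L2_measurable_parts Lk).
  - exact: Rintegrable_measurable (nabla_star_part_integrable b2 Lg).
by rewrite !eq.
Qed.

Lemma nablaP_adj_ae b g h : nablaP_adj sigma P phi (g, h) ->
  {ae P, forall gamma, part b (h gamma) = nabla_star_part b g gamma}.
Proof.
move=> [/= Lg Lh gh].
have ih := probability_L2_integrable b Lh.
have ig := nabla_star_part_integrable b Lg.
have : {ae P, forall gamma, part b (h gamma) - nabla_star_part b g gamma = 0}.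
  apply: (@mclass_orthogonal _ _ _ _ (@cos_family R d)).
  - exists (fun=> 0), 0; split=> //; first exact: testfun0.
    by apply/funext => gamma; rewrite pairing0 addr0 cos0.
  - move=> _ [psi [theta [tpsi ->]]]; have mp := measurable_pairing_testfun tpsi.
    have mc : measurable_fun setT (@cos R).
      by apply: continuous_measurable_fun; exact: continuous_cos.
    exact: (measurableT_comp mc (measurable_funD mp (measurable_cst theta))).
  - exact: cos_family_bounded.
  - exact: cos_family_generates.
  - exact: RintegrableB.
  move=> _ [psi [theta [tpsi ->]]].
  (* A real-valued cylinder function, so that the complex adjoint relation separates into one
     identity for each part of [h]. *)
  pose F (y : 'rV[R]_1) : R[i] := (cos (y 0 0 + theta))%:C.
  pose f (gamma : conf R d) := F (\row_(i < 1) pairing gamma psi).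
  pose Af gamma := cint sigma (fun x => (f (conf_add gamma x) - f gamma) * (phi x)%:C).
  have fA : nablaP sigma phi (f, Af).
    split=> //; exists 1%N, (fun=> psi), F; split=> //.
      have := Cb_infty_cos 1 theta; congr Cb_infty.
      by apply/funext => y; rewrite mul1r.
    (* The zero imaginary part is a cosine of amplitude [0]. *)
    have := Cb_infty_cos 0 theta; congr Cb_infty.
    by apply/funext => y; rewrite mul0r.
  have fE gamma : part false (f gamma) = cos (pairing gamma psi + theta).
    by rewrite /= mxE.
  have f0 X : \int[P]_gamma (part true (f gamma) * X gamma) = 0.
    by under eq_Rintegral do rewrite mul0r; rewrite /Rintegral integral0.
  have key : \int[P]_gamma (part false (f gamma) * nabla_star_part b g gamma) =
      \int[P]_gamma (part false (f gamma) * part b (h gamma)).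
    have /(congr1 (part b)) := gh f Af fA.
    rewrite (part_L2dot_nablaP b Lg fA) (part_L2dot_cylinder b Lh fA).
    case: (b); rewrite !f0 ?mulr0 ?addr0// !add0r.
    by move/(mulfI (_ : (-1) ^+ true != 0)); apply; rewrite signr_eq0.
  have iM (X : conf R d -> R) : Rintegrable P X ->
      Rintegrable P (fun gamma => part false (f gamma) * X gamma).
    have [mf [K fK] _ _] := nablaP_integral false b Lg fA.
    exact: Rintegrable_bounded_mul mf fK.
  under eq_Rintegral do rewrite -fE mulrBr.
  rewrite RintegralB//; [|exact: iM..].
  by rewrite key subrr.
by apply: filterS => gamma /eqP; rewrite subr_eq0 => /eqP.
Qed.

Lemma part_nabla_star b g gamma :
  part b (pairing gamma (fun x => g (conf_rem gamma x) * (phi x)%:C)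
          - g gamma * (\int[sigma]_x phi x)%:C) = nabla_star_part b g gamma.
Proof.
have [K phiK] := testfun_supported phi_test.
rewrite partB partMr /nabla_star_part /nabla_star; congr (_ - _).
rewrite (@pairingE _ _ _ _ K).
  rewrite (@pairingE _ _ _ _ K); last exact: supported_inMl.
  by rewrite part_sum; apply: eq_bigr => x _; rewrite partMr.
move=> x gx; apply: phiK; apply: contraNneq gx => ->.
by rewrite mulr0.
Qed.

End adjoint.

Theorem proposition2p9 (R : realType) (d : nat)
    (sigma : {sigma_finite_measure set (euclid R d) -> \bar R})
    (sigma_radon : radon sigma) (sigma_nonatomic : nonatomic sigma)
    (P : probability (conf R d) R) (P_poisson : poisson sigma P)
    (C : kernel_family R d) (C_charlier : is_charlier sigma C)
    (phi : euclid R d -> R) (phi_test : testfun phi)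
    (g : conf R d -> R[i]) (g_dom : opdom (creation_on_conf sigma P C phi) g) :
  opdom (nablaP_adj sigma P phi) g /\
  forall h : conf R d -> R[i], nablaP_adj sigma P phi (g, h) ->
    {ae P, forall gamma,
      h gamma = pairing gamma (fun x => g (conf_rem gamma x) * (phi x)%:C)
                - g gamma * (\int[sigma]_x phi x)%:C}.
Proof.
case: g_dom => k gk; split.
  (* [k] is [I a^+ I^-1 g]: the inclusion of the domain of creation in that of the adjoint rests on
     its square integrability. *)
  exists k; apply: nablaP_adj_intro => //.
  - by case: gk => /= f' [/= f [_ Lg _] _] _.
  - by case: gk => /= f' _ [_ Lk _].
  - by move=> b; exact: creation_on_conf_ae gk.
move=> h gh.
have := nablaP_adj_ae sigma_radon sigma_nonatomic P_poisson phi_test true gh.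
have := nablaP_adj_ae sigma_radon sigma_nonatomic P_poisson phi_test false gh.
apply: filterS2 => gamma h0 h1; apply: part_inj => b.
by rewrite part_nabla_star//; case: b.
Qed.
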